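(* Let $G$ be a compact quantum group and let $F:\mathrm{Rep}(G)\to\mathrm{Hilb}$ be the canonical fibre functor. The two constructions (a) sending a unitary pseudonatural transformation (UPT) $(\alpha,H):F\to F'$ to the simple Frobenius monoid $\alpha\otimes\alpha^*$ in $\mathrm{End}(F)\cong\mathrm{Rep}(A_G)$ with multiplication $\tfrac1{\sqrt d}\,\mathrm{id}_H\otimes\mathrm{ev}\otimes\mathrm{id}_{H^*}$ and unit $\sqrt d\,\mathrm{coev}'$ ($d=\dim H$), and (b) sending a simple Frobenius monoid in $\mathrm{End}(F)$, brought to the standard form $((\alpha,H\otimes H^* ),m,u)$, to the fibre functor $F_\alpha$ and the UPT $\sqrt\alpha:F\to F_\alpha$, give a bijective correspondence between: 1. unitary monoidal natural isomorphism classes of fibre functors on $\mathrm{Rep}(G)$ accessible from $F$ by a UPT; and Morita equivalence classes of simple Frobenius monoids in $\mathrm{Rep}(A_G)$; 2. equivalence classes of UPTs $\alpha:F\to F'$ for some accessible fibre functor $F'$; and unitary $*$-isomorphism classes of simple Frobenius monoids in $\mathrm{Rep}(A_G)$.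
   Context: A CQG algebra $A_G$ is a Hopf $*$-algebra generated as an algebra by matrix coefficients of its finite-dimensional unitary corepresentations; $\mathrm{Rep}(G)$ is the $C^*$-tensor category (with conjugates) of finite-dimensional unitary corepresentations of $A_G$ and intertwiners. $\mathrm{Hilb}$: finite-dimensional Hilbert spaces and linear maps (treated as strict). A fibre functor is a unitary $\mathbb{C}$-linear monoidal functor $F':\mathrm{Rep}(G)\to\mathrm{Hilb}$, i.e. $F'(f^\dagger)=F'(f)^\dagger$ with coherent unitary multiplicators $m^{F'}_{V,W}$ and unitor $u_{F'}$. The canonical one $F$ forgets the corepresentation. UPT $(\alpha,H):F_1\to F_2$: a finite-dimensional Hilbert space $H$ (taken nonzero here) and unitaries $\alpha_X:F_1(X)\otimes H\to H\otimes F_2(X)$ with: $(\mathrm{id}_H\otimes F_2(f))\alpha_X=\alpha_Y(F_1(f)\otimes\mathrm{id}_H)$ for $f:X\to Y$; $\alpha_{X\otimes Y}(m^{F_1}_{X,Y}\otimes\mathrm{id}_H)=(\mathrm{id}_H\otimes m^{F_2}_{X,Y})(\alpha_X\otimes\mathrm{id})(\mathrm{id}\otimes\alpha_Y)$; $\alpha_{\mathbb{1}}(u_{F_1}\otimes\mathrm{id}_H)=\mathrm{id}_H\otimes u_{F_2}$. Modification $f:(\alpha,H)\to(\beta,H')$: linear $f:H\to H'$ with $(f\otimes\mathrm{id})\alpha_X=\beta_X(\mathrm{id}\otimes f)$ for all $X$. Composite of $(\alpha,H):F_1\to F_2$ followed by $(\beta,H'):F_2\to F_3$: $(\alpha\otimes\beta,H\otimes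 H')$ with $(\alpha\otimes\beta)_X=(\mathrm{id}_H\otimes\beta_X)(\alpha_X\otimes\mathrm{id}_{H'})$. A fibre functor $F'$ is accessible from $F$ if there is a UPT $F\to F'$. UPTs $\alpha_1:F\to F_1$, $\alpha_2:F\to F_2$ are equivalent if there are a unitary monoidal natural isomorphism $E:F_2\to F_1$ (viewed as a UPT with Hilbert space $\mathbb{C}$) and a unitary modification $\tau:\alpha_1\to\alpha_2\otimes E$. $\mathrm{End}(F)$ is the monoidal dagger category of UPTs $F\to F$ and modifications (monoidal product = composition). It is isomorphic to the category $\mathrm{Rep}(A_G)$ of finite-dimensional $*$-representations of $A_G$ and intertwiners, a representation $\pi:A_G\to B(H)$ corresponding to the UPT $\alpha_V(|i\rangle\otimes h)=\sum_k\pi(u_{ki})h\otimes|k\rangle$ where $|i\rangle\mapsto\sum_k|k\rangle\otimes u_{ki}$ is the corepresentation $V$ in an orthonormal basis; the monoidal structure on $\mathrm{Rep}(A_G)$ is the transported one, and Frobenius monoids in $\mathrm{Rep}(A_G)$ are identified with those in $\mathrm{End}(F)$. Duality: $\mathrm{ev}:H^*\otimes H\to\mathbb{C}$, $\mathrm{ev}':H\otimes H^*\to\mathbb{C}$ canonical pairings; $\mathrm{coev}(1)=\sum_i\langle i|\otimes|i\rangle\in H^*\otimes H$, $\mathrm{coev}'(1)=\sum_i|i\rangle\otimes\langle i|\in H\otimes H^*$. Dual UPT of $(\beta,H):F_1\to F_2$: $(\beta^*,H^* ):F_2\to F_1$, $\beta^*_X=(\mathrm{id}_{H^*\otimes F_1(X)}\otimes\mathrm{ev}')(\mathrm{id}_{H^*}\otimes\beta_X^\dagger\otimes\mathrm{id}_{H^*})(\mathrm{coev}\otimes\mathrm{id}_{F_2(X)\otimes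 H^*})$. Frobenius monoid in a monoidal dagger category: a monoid $(A,m_A,u_A)$ with $(m_A\otimes\mathrm{id})(\mathrm{id}\otimes m_A^\dagger)=m_A^\dagger m_A=(\mathrm{id}\otimes m_A)(m_A^\dagger\otimes\mathrm{id})$; special if $m_Am_A^\dagger=\mathrm{id}$. Unitary $*$-isomorphism: a unitary $f:A\to B$ with $fm_A=m_B(f\otimes f)$, $fu_A=u_B$. A Frobenius monoid in $\mathrm{End}(F)$ is simple if its underlying Frobenius monoid in $\mathrm{Hilb}$ is unitarily $*$-isomorphic to a normalised endomorphism algebra $H\otimes H^*$ ($d=\dim H\geq1$) with multiplication $\tfrac1{\sqrt d}\mathrm{id}_H\otimes\mathrm{ev}\otimes\mathrm{id}_{H^*}$ and unit $\sqrt d\,\mathrm{coev}'$; simple Frobenius monoids are special. Standard form: the underlying monoid is exactly this one (obtained by conjugating with the isomorphism). Construction (b): for $((\alpha,H\otimes H^* ),m,u)$ in standard form, $p_V=\tfrac1d(\mathrm{ev}\otimes\mathrm{id})(\mathrm{id}_{H^*}\otimes\alpha_V\otimes\mathrm{id}_H)(\mathrm{id}_{H^*\otimes F(V)\otimes H}\otimes\mathrm{coev})$ is a dagger idempotent on $H^*\otimes F(V)\otimes H$; choose isometries $\iota_V:F_\alpha(V)\to H^*\otimes F(V)\otimes H$ with $\iota_V\iota_V^\dagger=p_V$. $F_\alpha$ is the fibre functor with $F_\alpha(f)=\iota_W^\dagger(\mathrm{id}\otimes F(f)\otimes\mathrm{id})\iota_V$, multiplicators $\sqrt d\,\iota_{V\otimes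 W}^\dagger(\mathrm{id}\otimes m^F_{V,W}\otimes\mathrm{id})(\mathrm{id}\otimes\mathrm{ev}'\otimes\mathrm{id})(\iota_V\otimes\iota_W)$ ($\mathrm{ev}'$ on the inner factors $H\otimes H^*$), unitor $\tfrac1{\sqrt d}\iota_{\mathbb{1}}^\dagger(\mathrm{id}\otimes u_F\otimes\mathrm{id})\mathrm{coev}$; and $\sqrt\alpha_V=\sqrt d(\mathrm{id}_H\otimes\iota_V^\dagger)(\mathrm{coev}'\otimes\mathrm{id}_{F(V)\otimes H})$. Morita equivalence of special Frobenius monoids in a monoidal dagger category with split dagger idempotents. An $A$-$B$-dagger bimodule is an object $M$ with $\rho:A\otimes M\otimes B\to M$ such that $\rho(m_A\otimes\mathrm{id}_M\otimes m_B)=\rho(\mathrm{id}_A\otimes\rho\otimes\mathrm{id}_B)$, $\rho(u_A\otimes\mathrm{id}_M\otimes u_B)=\mathrm{id}_M$, and $\rho=(u_A^\dagger m_A\otimes\mathrm{id}_M\otimes u_B^\dagger m_B)(\mathrm{id}_A\otimes\rho^\dagger\otimes\mathrm{id}_B)$. Isomorphism of bimodules: a unitary commuting with the actions. For ${}_AM_B$, ${}_BN_C$, the relative tensor product $M\otimes_BN$ is the splitting, via an isometry $i:M\otimes_BN\to M\otimes N$, of the dagger idempotent obtained by inserting $m_B^\dagger u_B:\mathbb{1}\to B\otimes B$ between $M$ and $N$ and acting with the first factor on $M$ from the right (using $u_A$ on the left) and with the second on $N$ from the left (using $u_C$ on the right); its action is $i^\dagger\circ(\text{left }A\text{-action on }M\otimes\text{right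 }C\text{-action on }N)\circ(\mathrm{id}_A\otimes i\otimes\mathrm{id}_C)$. ${}_AA_A$ has action $m_A(m_A\otimes\mathrm{id})$. $A,B$ are Morita equivalent if there are dagger bimodules ${}_AM_B,{}_BN_A$ with $M\otimes_BN\cong{}_AA_A$ and $N\otimes_AM\cong{}_BB_B$. *)

(* Defs.v *)
From HB Require Import structures.
From mathcomp Require Import all_boot all_order all_algebra.
From mathcomp Require Import sesquilinear spectral.
From mathcomp Require Import complex mxtens.
From mathcomp Require Import boolp classical_sets functions reals.

Set Implicit Arguments.
Unset Strict Implicit.
Unset Printing Implicit Defensive.

Import Order.TTheory GRing.Theory Num.Theory.
Local Open Scope ring_scope.
Local Open Scope sesquilinear_scope.

(* Hilb is used in its strict matrix form: the natural number n stands for C^n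
   with its standard orthonormal basis, a linear map C^m -> C^n is a matrix in
   'M_(n, m) (acting on columns), the tensor product of maps is the Kronecker
   product *t, the adjoint is the conjugate transpose ^t*, and the dual space
   of C^n is C^n with the dual basis.  Since mxtens orders the basis of a
   tensor product lexicographically, the associators and unitors have identity
   matrices, and the only trace they leave is that (m * n) * p and
   m * (n * p), or 1 * n and n, are different as expressions.  The composite
   [g \c f] identifies two such expressions; [strict_dim] only uses
   associativity and unitality of multiplication, never commutativity, so no
   tensor factors can be permuted. *)
Definition scomp (T : pzRingType) (m n n' p : nat)
    (g : 'M[T]_(p, n')) (f : 'M[T]_(n, m)) (e : n = n') : 'M[T]_(p, m) :=
  g *m castmx (e, erefl m) f.

Ltac strict_dim := by rewrite /= ?mul1n ?muln1 ?mulnA.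

Notation "g \c f" := (scomp g f ltac:(strict_dim))
  (at level 40, left associativity, only parsing) : ring_scope.

Section HilbertMaps.
Variable R : realType.
Local Notation C := R[i].
Local Notation id_ n := (1%:M : 'M[C]_n).

Definition isometry (m n : nat) (f : 'M[C]_(n, m)) : Prop :=
  f ^t* *m f = 1%:M.

Definition unitary (m n : nat) (f : 'M[C]_(n, m)) : Prop :=
  f ^t* *m f = 1%:M /\ f *m f ^t* = 1%:M.

Definition assoc (m n p : nat) : 'M[C]_(m * (n * p), m * n * p) :=
  id_(m * (n * p)) \c id_(m * n * p).
Definition lunit (n : nat) : 'M[C]_(n, 1 * n) := id_ n \c id_(1 * n).
Definition runit (n : nat) : 'M[C]_(n, n * 1) := id_ n \c id_(n * 1).

(* With the dual basis, the same matrix is ev : H^* (x) H -> C and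
   ev' : H (x) H^* -> C; likewise for coev and coev'. *)
Definition ev (d : nat) : 'M[C]_(1, d * d) :=
  \row_k ((mxtens_unindex k).1 == (mxtens_unindex k).2)%:R.
Definition coev (d : nat) : 'M[C]_(d * d, 1) :=
  \col_k ((mxtens_unindex k).1 == (mxtens_unindex k).2)%:R.

Definition sqrtd (d : nat) : C := sqrtC d%:R.

Definition end_mul (d : nat) : 'M[C]_(d * d, d * d * (d * d)) :=
  (sqrtd d)^-1 *:
  (id_(d * d) \c (id_ d *t ev d *t id_ d) \c id_(d * d * (d * d))).
Definition end_unit (d : nat) : 'M[C]_(d * d, 1) := sqrtd d *: coev d.

End HilbertMaps.

Section HopfStar.
Variable R : realType.
Local Notation C := R[i].

(* An element of A (x) A is given by a formal sum of pure tensors.  Two formal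
   sums denote the same element iff every bilinear map takes the same value on
   them (universal property of the tensor product). *)
Definition tensor2_eq (A : algType C) (s t : seq (A * A)) : Prop :=
  forall (W : lmodType C) (b : A -> A -> W),
    (forall x, linear (b x)) -> (forall y, linear (b^~ y)) ->
  \sum_(p <- s) b p.1 p.2 = \sum_(p <- t) b p.1 p.2.

Definition tensor3_eq (A : algType C) (s t : seq (A * A * A)) : Prop :=
  forall (W : lmodType C) (b : A -> A -> A -> W),
    (forall x y, linear (b x y)) -> (forall x z, linear ((b x)^~ z)) ->
    (forall y z, linear (fun x => b x y z)) ->
  \sum_(p <- s) b p.1.1 p.1.2 p.2 = \sum_(p <- t) b p.1.1 p.1.2 p.2.

(* [comul x] is a formal sum representing the coproduct of x. *)
Record hopfStarAlg := HopfStarAlg {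
  hopf_alg :> algType C;
  star : hopf_alg -> hopf_alg;
  comul : hopf_alg -> seq (hopf_alg * hopf_alg);
  counit : {lrmorphism hopf_alg -> C^o};
  antipode : {linear hopf_alg -> hopf_alg};
  star_antilinear : forall (a : C) x y,
    star (a *: x + y) = a^* *: star x + star y;
  starM : forall x y, star (x * y) = star y * star x;
  starK : involutive star;
  comul_linear : forall (a : C) x y,
    tensor2_eq (comul (a *: x + y))
      ([seq (a *: p.1, p.2) | p <- comul x] ++ comul y);
  comulM : forall x y,
    tensor2_eq (comul (x * y))
      [seq (p.1 * q.1, p.2 * q.2) | p <- comul x, q <- comul y];
  comul1 : tensor2_eq (comul 1) [:: (1, 1)];
  comul_star : forall x,
    tensor2_eq (comul (star x)) [seq (star p.1, star p.2) | p <- comul x];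
  comulA : forall x,
    tensor3_eq [seq (q.1, q.2, p.2) | p <- comul x, q <- comul p.1]
               [seq (p.1, q.1, q.2) | p <- comul x, q <- comul p.2];
  counit_l : forall x, \sum_(p <- comul x) (counit p.1 : C) *: p.2 = x;
  counit_r : forall x, \sum_(p <- comul x) (counit p.2 : C) *: p.1 = x;
  antipode_l : forall x,
    \sum_(p <- comul x) antipode p.1 * p.2 = (counit x : C) *: 1;
  antipode_r : forall x,
    \sum_(p <- comul x) p.1 * antipode p.2 = (counit x : C) *: 1
}.

Variable A : hopfStarAlg.

Definition star_mx (m n : nat) (u : 'M[A]_(m, n)) : 'M[A]_(n, m) :=
  (map_mx (@star A) u)^T.

Definition scalar_to_alg (m n : nat) (f : 'M[C]_(m, n)) : 'M[A]_(m, n) :=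
  map_mx (fun a => a *: (1 : A)) f.

(* The coaction is |i> |-> sum_k |k> (x) u_ki. *)
Record corep := Corep {
  cdim : nat;
  cmx :> 'M[A]_cdim;
  cmx_comul : forall i j,
    tensor2_eq (comul (cmx i j)) [seq (cmx i k, cmx k j) | k <- enum 'I_cdim];
  cmx_counit : forall i j, counit A (cmx i j) = (i == j)%:R;
  cmx_unitaryl : star_mx cmx *m cmx = 1%:M;
  cmx_unitaryr : cmx *m star_mx cmx = 1%:M
}.

(* Generation by the coefficients of the unitary corepresentations, in the form
   of an induction principle. *)
Definition is_cqg : Prop :=
  forall P : A -> Prop,
    P 1 ->
    (forall (a : C) x y, P x -> P y -> P (a *: x + y)) ->
    (forall x y, P x -> P y -> P (x * y)) ->
    (forall (V : corep) i j, P (cmx V i j)) ->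
  forall x, P x.

Record inter (V W : corep) := Inter {
  imx :> 'M[C]_(cdim W, cdim V);
  imxP : scalar_to_alg imx *m cmx V == cmx W *m scalar_to_alg imx
}.

End HopfStar.

Section RepG.
Variable R : realType.
Local Notation C := R[i].
Variable A : hopfStarAlg R.
Implicit Types V W X : corep A.

Lemma scalar_to_algM m n p (f : 'M[C]_(m, n)) (g : 'M[C]_(n, p)) :
  scalar_to_alg A (f *m g) = scalar_to_alg A f *m scalar_to_alg A g.
Proof.
apply/matrixP => i j; rewrite !mxE scaler_suml; apply: eq_bigr => k _.
by rewrite !mxE -scalerAl mul1r scalerA.
Qed.

Lemma scalar_to_alg1 n : scalar_to_alg A (1%:M : 'M[C]_n) = 1%:M.
Proof.
by apply/matrixP => i j; rewrite !mxE; case: eqP => _; rewrite ?scale1r ?scale0r.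
Qed.

Lemma starD (x y : A) : star (x + y) = star x + star y.
Proof. by rewrite -{1}[x]scale1r star_antilinear conjC1 scale1r. Qed.

Lemma star0 : star (0 : A) = 0.
Proof. by apply: (addrI (star (0 : A))); rewrite -starD !addr0. Qed.

Lemma starZ (a : C) (x : A) : star (a *: x) = a^* *: star x.
Proof. by rewrite -[a *: x]addr0 star_antilinear star0 addr0. Qed.

Lemma star1 : star (1 : A) = 1.
Proof. by rewrite -[LHS]mulr1 -{2}[1](starK (1:A)) -starM mulr1 starK. Qed.

Lemma star_sum (I : Type) (r : seq I) (F : I -> A) :
  star (\sum_(i <- r) F i) = \sum_(i <- r) star (F i).
Proof. by elim/big_rec2: _ => [|i x y _ <-]; rewrite ?star0 ?starD. Qed.

Lemma star_mxM m n p (u : 'M[A]_(m, n)) (v : 'M[A]_(n, p)) :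
  star_mx (u *m v) = star_mx v *m star_mx u.
Proof.
apply/matrixP => i j; rewrite !mxE star_sum; apply: eq_bigr => k _.
by rewrite !mxE starM.
Qed.

Lemma star_mxK m n (u : 'M[A]_(m, n)) : star_mx (star_mx u) = u.
Proof. by apply/matrixP => i j; rewrite !mxE starK. Qed.

Lemma star_mx_scalar m n (f : 'M[C]_(m, n)) :
  star_mx (scalar_to_alg A f) = scalar_to_alg A (f ^t*).
Proof. by apply/matrixP => i j; rewrite !mxE starZ star1. Qed.

Lemma star_tensE m n p q (u : 'M[A]_(m, n)) (v : 'M[A]_(p, q)) i k j l :
  star_mx (u *t v) (mxtens_index (i, j)) (mxtens_index (k, l)) =
  star (v l j) * star (u k i).
Proof. by rewrite !mxE !mxtens_indexK starM. Qed.

Lemma sum_mxtens (T : nmodType) m n (F : 'I_(m * n) -> T) :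
  \sum_k F k = \sum_i \sum_j F (mxtens_index (i, j)).
Proof.
rewrite pair_big /= (reindex (@mxtens_index m n)); first by apply: eq_bigr => -[].
exists (@mxtens_unindex m n) => i _; by rewrite (mxtens_indexK, mxtens_unindexK).
Qed.

Lemma one_tensE (T : pzRingType) m n (i : 'I_m) (j : 'I_n) k l :
  (1%:M : 'M[T]_(m * n)) (mxtens_index (i, j)) (mxtens_index (k, l)) =
  (1%:M : 'M[T]_m) i k * (1%:M : 'M[T]_n) j l.
Proof.
rewrite !mxE (can_eq (@mxtens_indexK _ _)) xpair_eqE.
by case: eqP; case: eqP => _ _; rewrite ?mulr1 ?mul0r ?mulr0.
Qed.

Fact tens_unitaryl V W : star_mx (V *t W) *m (V *t W) = 1%:M.
Proof.
apply/matrixP => x y.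
case: (mxtens_indexP x) => i j; case: (mxtens_indexP y) => k l.
rewrite one_tensE -(cmx_unitaryl V) -(cmx_unitaryl W) mxE sum_mxtens exchange_big /=.
under eq_bigr => b _ do under eq_bigr => a _ do
  rewrite star_tensE tensmxE mulrA -[_ * star _ * _]mulrA.
under eq_bigr => b _ do rewrite -mulr_suml -mulr_sumr.
have -> : \sum_(a < cdim V) star (V a i) * V a k = (star_mx V *m V) i k.
  by rewrite mxE; apply: eq_bigr => a _; rewrite !mxE.
rewrite cmx_unitaryl [(1%:M : 'M_ _) i k]mxE; case: eqP => _ /=.
  by rewrite mul1r mxE; apply: eq_bigr => b _; rewrite mulr1 !mxE.
by rewrite mul0r big1 // => b _; rewrite mulr0 mul0r.
Qed.

Fact tens_unitaryr V W : (V *t W) *m star_mx (V *t W) = 1%:M.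
Proof.
apply/matrixP => x y.
case: (mxtens_indexP x) => i j; case: (mxtens_indexP y) => k l.
rewrite one_tensE -(cmx_unitaryr V) -(cmx_unitaryr W) mxE sum_mxtens /=.
under eq_bigr => b _ do under eq_bigr => a _ do
  rewrite star_tensE tensmxE mulrA -[V i b * _ * _]mulrA.
under eq_bigr => b _ do rewrite -mulr_suml -mulr_sumr.
have -> : \sum_(a < cdim W) W j a * star (W l a) = (W *m star_mx W) j l.
  by rewrite mxE; apply: eq_bigr => a _; rewrite !mxE.
rewrite cmx_unitaryr [(1%:M : 'M_ _) j l]mxE; case: eqP => _ /=.
  by rewrite mulr1 mxE; apply: eq_bigr => b _; rewrite mulr1 !mxE.
by rewrite mulr0 big1 // => b _; rewrite mulr0 mul0r.
Qed.

Fact tens_comul V W i j :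
  tensor2_eq (comul ((V *t W) i j))
    [seq ((V *t W) i k, (V *t W) k j) | k <- enum 'I_(cdim V * cdim W)].
Proof.
case: (mxtens_indexP i) => {}i i'; case: (mxtens_indexP j) => {}j j'.
rewrite tensmxE => L b linr linl.
have EV (q : A * A) : \sum_(p <- comul (V i j)) b (p.1 * q.1) (p.2 * q.2) =
    \sum_k b (V i k * q.1) (V k j * q.2).
  have := @cmx_comul _ _ V i j L (fun s t => b (s * q.1) (t * q.2)).
  rewrite big_map big_enum; apply => [x|y] a s t /=.
    by rewrite mulrDl -scalerAl linr.
  by rewrite mulrDl -scalerAl linl.
have EW k : \sum_(q <- comul (W i' j')) b (V i k * q.1) (V k j * q.2) =
    \sum_l b (V i k * W i' l) (V k j * W l j').
  have := @cmx_comul _ _ W i' j' L (fun s t => b (V i k * s) (V k j * t)).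
  rewrite big_map big_enum; apply => [x|y] a s t /=.
    by rewrite mulrDr -scalerAr linr.
  by rewrite mulrDr -scalerAr linl.
rewrite (comulM _ _ linr linl) big_allpairs_dep /= exchange_big /=.
rewrite (eq_bigr _ (fun q _ => EV q)) exchange_big /=.
rewrite (eq_bigr _ (fun k _ => EW k)) big_map big_enum sum_mxtens /=.
by apply: eq_bigr => k _; apply: eq_bigr => l _; rewrite !tensmxE.
Qed.

Fact tens_counit V W i j : counit A ((V *t W) i j) = (i == j)%:R.
Proof.
case: (mxtens_indexP i) => {}i i'; case: (mxtens_indexP j) => {}j j'.
rewrite tensmxE rmorphM /= (cmx_counit i j) (cmx_counit i' j').
rewrite (can_eq (@mxtens_indexK _ _)) xpair_eqE.
by rewrite -natrM mulnb.
Qed.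

(* The coaction |i> (x) |j> |-> sum_kl |k> (x) |l> (x) u_ki v_lj. *)
Definition tens_corep V W : corep A :=
  Corep (@tens_comul V W) (@tens_counit V W)
    (tens_unitaryl V W) (tens_unitaryr V W).

Fact unit_comul i j :
  tensor2_eq (comul ((1%:M : 'M[A]_1) i j))
    [seq ((1%:M : 'M[A]_1) i k, (1%:M : 'M[A]_1) k j) | k <- enum 'I_1].
Proof.
rewrite !ord1 => L b linr linl; rewrite big_map big_enum /= big_ord1 !mxE /=.
by rewrite (@comul1 _ A _ _ linr linl) big_seq1.
Qed.

Fact unit_counit (i j : 'I_1) : counit A ((1%:M : 'M[A]_1) i j) = (i == j)%:R.
Proof. by rewrite !ord1 mxE rmorph1. Qed.

Lemma star_mx1 n : star_mx (1%:M : 'M[A]_n) = 1%:M.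
Proof.
apply/matrixP => i j; rewrite !mxE eq_sym.
by case: eqP => _; rewrite ?star1 ?star0.
Qed.

Fact unit_unitary : star_mx (1%:M : 'M[A]_1) *m 1%:M = 1%:M.
Proof. by rewrite star_mx1 mulmx1. Qed.

Fact unit_unitary' : (1%:M : 'M[A]_1) *m star_mx 1%:M = 1%:M.
Proof. by rewrite star_mx1 mulmx1. Qed.

Definition unit_corep : corep A :=
  Corep unit_comul unit_counit unit_unitary unit_unitary'.

Fact inter_idP V :
  scalar_to_alg A (1%:M : 'M[C]_(cdim V)) *m V == V *m scalar_to_alg A 1%:M.
Proof. by rewrite scalar_to_alg1 mul1mx mulmx1. Qed.
Definition inter_id V : inter V V := Inter (inter_idP V).

Fact inter_compP V W X (g : inter W X) (f : inter V W) :
  scalar_to_alg A (g *m f) *m V == X *m scalar_to_alg A (g *m f).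
Proof.
by rewrite scalar_to_algM -mulmxA (eqP (imxP f)) !mulmxA (eqP (imxP g)).
Qed.
Definition inter_comp V W X (g : inter W X) (f : inter V W) : inter V X :=
  Inter (inter_compP g f).

Fact inter_linP V W (a : C) (f g : inter V W) :
  scalar_to_alg A (a *: imx f + imx g) *m V ==
  W *m scalar_to_alg A (a *: imx f + imx g).
Proof.
apply/eqP/matrixP => i j.
have /matrixP/(_ i j) := eqP (imxP f); have /matrixP/(_ i j) := eqP (imxP g).
rewrite !mxE => gE fE.
under eq_bigr => k _ do rewrite !mxE scalerDl -scalerA mulrDl -scalerAl.
under [RHS]eq_bigr => k _ do rewrite !mxE scalerDl -scalerA mulrDr -scalerAr.
rewrite !big_split /= -!scaler_sumr; congr (_ *: _ + _).
  transitivity (\sum_k scalar_to_alg A f i k * V k j).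
    by apply: eq_bigr => k _; rewrite !mxE.
  by rewrite fE; apply: eq_bigr => k _; rewrite !mxE.
transitivity (\sum_k scalar_to_alg A g i k * V k j).
  by apply: eq_bigr => k _; rewrite !mxE.
by rewrite gE; apply: eq_bigr => k _; rewrite !mxE.
Qed.
Definition inter_lin V W (a : C) (f g : inter V W) : inter V W :=
  Inter (inter_linP a f g).

Fact inter_dagP V W (f : inter V W) :
  scalar_to_alg A (imx f ^t*) *m W == V *m scalar_to_alg A (imx f ^t*).
Proof.
have /(congr1 (fun M => star_mx W *m M *m star_mx V)) := eqP (imxP f).
rewrite !mulmxA -2!mulmxA (cmx_unitaryr V) mulmx1 (cmx_unitaryl W) mul1mx.
move/(congr1 (@star_mx _ _ _ _)); rewrite !star_mxM !star_mxK star_mx_scalar.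
by move=> ->.
Qed.
Definition inter_dag V W (f : inter V W) : inter W V := Inter (inter_dagP f).

Lemma scalar_to_alg_tens m n p q (f : 'M[C]_(m, n)) (g : 'M[C]_(p, q)) :
  scalar_to_alg A (f *t g) = scalar_to_alg A f *t scalar_to_alg A g.
Proof. by apply/matrixP => i j; rewrite !mxE -scalerAl mul1r scalerA. Qed.

Lemma tens_scalarl m n p q r s (f : 'M[C]_(m, n)) (g : 'M[C]_(p, q))
    (u : 'M[A]_(n, r)) (v : 'M[A]_(q, s)) :
  scalar_to_alg A (f *t g) *m (u *t v) =
  (scalar_to_alg A f *m u) *t (scalar_to_alg A g *m v).
Proof.
apply/matrixP => x y.
case: (mxtens_indexP x) => i j; case: (mxtens_indexP y) => k l.
rewrite tensmxE !mxE sum_mxtens mulr_suml; apply: eq_bigr => a _.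
rewrite mulr_sumr; apply: eq_bigr => b _.
by rewrite tensmxE !mxE !mxtens_indexK /= -!scalerAl !mul1r -scalerAr scalerA.
Qed.

Lemma tens_scalarr m n p q r s (f : 'M[C]_(n, m)) (g : 'M[C]_(q, p))
    (u : 'M[A]_(r, n)) (v : 'M[A]_(s, q)) :
  (u *t v) *m scalar_to_alg A (f *t g) =
  (u *m scalar_to_alg A f) *t (v *m scalar_to_alg A g).
Proof.
apply/matrixP => x y.
case: (mxtens_indexP x) => i j; case: (mxtens_indexP y) => k l.
rewrite tensmxE !mxE sum_mxtens mulr_suml; apply: eq_bigr => a _.
rewrite mulr_sumr; apply: eq_bigr => b _.
by rewrite tensmxE !mxE !mxtens_indexK /= -!scalerAr !mulr1 -scalerAl scalerA mulrC.
Qed.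

Fact inter_tensP V V' W W' (f : inter V V') (g : inter W W') :
  scalar_to_alg A (f *t g) *m tens_corep V W ==
  tens_corep V' W' *m scalar_to_alg A (f *t g).
Proof. by rewrite tens_scalarl tens_scalarr (eqP (imxP f)) (eqP (imxP g)). Qed.
Definition inter_tens V V' W W' (f : inter V V') (g : inter W W') :
    inter (tens_corep V W) (tens_corep V' W') :=
  @Inter R A (tens_corep V W) (tens_corep V' W') _ (inter_tensP f g).

Lemma inter_castP V W (e : cdim V = cdim W) :
    (forall i j, V i j = W (cast_ord e i) (cast_ord e j)) ->
  scalar_to_alg A (castmx (e, erefl) 1%:M) *m V ==
  W *m scalar_to_alg A (castmx (e, erefl) 1%:M).
Proof.
case: V W e => m u u1 u2 u3 u4 [n v v1 v2 v3 v4] /= e; case: n / e v v1 v2 v3 v4.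
move=> v v1 v2 v3 v4 uv; rewrite castmx_id scalar_to_alg1 mul1mx mulmx1.
by apply/eqP/matrixP => i j; rewrite uv !cast_ord_id.
Qed.

Fact inter_assocP V W X :
  scalar_to_alg A (assoc R (cdim V) (cdim W) (cdim X)) *m
    tens_corep (tens_corep V W) X ==
  tens_corep V (tens_corep W X) *m
    scalar_to_alg A (assoc R (cdim V) (cdim W) (cdim X)).
Proof.
rewrite /assoc /scomp mul1mx.
apply: (@inter_castP (tens_corep (tens_corep V W) X)
                     (tens_corep V (tens_corep W X))) => /= x y.
case: (mxtens_indexP x) => ij k; case: (mxtens_indexP ij) => i j.
case: (mxtens_indexP y) => ij' k'; case: (mxtens_indexP ij') => i' j'.
have E (a : 'I_(cdim V)) (b : 'I_(cdim W)) (c : 'I_(cdim X)) e :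
    cast_ord e (mxtens_index (mxtens_index (a, b), c)) =
    mxtens_index (a, mxtens_index (b, c)).
  by apply: val_inj; rewrite /= mulnDl -addnA -mulnA.
by rewrite !E !tensmxE mulrA.
Qed.
Definition inter_assoc V W X :
    inter (tens_corep (tens_corep V W) X) (tens_corep V (tens_corep W X)) :=
  @Inter R A (tens_corep (tens_corep V W) X) (tens_corep V (tens_corep W X)) _
    (inter_assocP V W X).

Fact inter_lunitP V :
  scalar_to_alg A (lunit R (cdim V)) *m tens_corep unit_corep V ==
  V *m scalar_to_alg A (lunit R (cdim V)).
Proof.
rewrite /lunit /scomp mul1mx.
apply: (@inter_castP (tens_corep unit_corep V) V) => /= x y.
case: (mxtens_indexP x) => i j; case: (mxtens_indexP y) => k l.
rewrite tensmxE !ord1 mxE mul1r.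
by congr (V _ _); apply: val_inj.
Qed.
Definition inter_lunit V : inter (tens_corep unit_corep V) V :=
  @Inter R A (tens_corep unit_corep V) V _ (inter_lunitP V).

Fact inter_runitP V :
  scalar_to_alg A (runit R (cdim V)) *m tens_corep V unit_corep ==
  V *m scalar_to_alg A (runit R (cdim V)).
Proof.
rewrite /runit /scomp mul1mx.
apply: (@inter_castP (tens_corep V unit_corep) V) => /= x y.
case: (mxtens_indexP x) => i j; case: (mxtens_indexP y) => k l.
rewrite tensmxE !ord1 mxE mulr1.
by congr (V _ _); apply: val_inj; rewrite /= muln1 addn0.
Qed.
Definition inter_runit V : inter (tens_corep V unit_corep) V :=
  @Inter R A (tens_corep V unit_corep) V _ (inter_runitP V).

End RepG.

Section FibreFunctors.
Variable R : realType.
Local Notation C := R[i].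
Local Notation id_ n := (1%:M : 'M[C]_n).
Variable A : hopfStarAlg R.
Local Notation "V (x) W" := (tens_corep V W) (at level 40, left associativity).
Local Notation "1c" := (unit_corep A).

Record functorData := FunctorData {
  fob :> corep A -> nat;
  fmor : forall V W : corep A, inter V W -> 'M[C]_(fob W, fob V);
  fmul : forall V W : corep A, 'M[C]_(fob (V (x) W), fob V * fob W);
  funit : 'M[C]_(fob 1c, 1)
}.

Record is_fibre_functor (F : functorData) : Prop := IsFibreFunctor {
  fmor_id : forall V, fmor F (inter_id V) = 1%:M;
  fmor_comp : forall V W X (g : inter W X) (f : inter V W),
    fmor F (inter_comp g f) = fmor F g *m fmor F f;
  fmor_linear : forall V W (a : C) (f g : inter V W),
    fmor F (inter_lin a f g) = a *: fmor F f + fmor F g;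
  fmor_dag : forall V W (f : inter V W),
    fmor F (inter_dag f) = (fmor F f) ^t*;
  fmul_unitary : forall V W, unitary (fmul F V W);
  funit_unitary : unitary (funit F);
  fmul_natural : forall V V' W W' (f : inter V V') (g : inter W W'),
    fmul F V' W' *m (fmor F f *t fmor F g) =
    fmor F (inter_tens f g) *m fmul F V W;
  fmul_assoc : forall V W X,
    fmor F (inter_assoc V W X) *m fmul F (V (x) W) X *m
      (fmul F V W *t id_ (F X)) =
    fmul F V (W (x) X) *m (id_ (F V) *t fmul F W X) *m
      assoc R (F V) (F W) (F X);
  fmul_unitl : forall V,
    fmor F (inter_lunit V) *m fmul F 1c V *m (funit F *t id_ (F V)) =
    lunit R (F V);
  fmul_unitr : forall V,
    fmor F (inter_runit V) *m fmul F V 1c *m (id_ (F V) *t funit F) =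
    runit R (F V)
}.

Definition canonical_functor : functorData := {|
  fob := @cdim R A;
  fmor := @imx R A;
  fmul := fun V W => id_ (cdim V * cdim W);
  funit := id_ 1
|}.

Record uptData (F1 F2 : functorData) := UptData {
  udim :> nat;
  ucomp : forall X : corep A, 'M[C]_(udim * F2 X, F1 X * udim)
}.

Record is_upt (F1 F2 : functorData) (a : uptData F1 F2) : Prop := IsUpt {
  upt_dim : (0 < a)%N;
  upt_unitary : forall X, unitary (ucomp a X);
  upt_natural : forall X Y (f : inter X Y),
    (id_ a *t fmor F2 f) *m ucomp a X = ucomp a Y *m (fmor F1 f *t id_ a);
  upt_mul : forall X Y,
    ucomp a (X (x) Y) *m (fmul F1 X Y *t id_ a) =
    (id_ a *t fmul F2 X Y) \c (ucomp a X *t id_ (F2 Y))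
      \c (id_ (F1 X) *t ucomp a Y) \c id_ (F1 X * F1 Y * a);
  upt_unit :
    ucomp a 1c \c (funit F1 *t id_ a) \c id_ a =
    (id_ a *t funit F2) \c id_ a
}.

Definition is_modification (F1 F2 : functorData) (a b : uptData F1 F2)
    (f : 'M[C]_(b, a)) : Prop :=
  forall X, (f *t id_ (F2 X)) *m ucomp a X = ucomp b X *m (id_ (F1 X) *t f).

Definition upt_id (F : functorData) : uptData F F :=
  @UptData F F 1 (fun X => id_ (1 * F X) \c id_ (F X * 1)).

Definition upt_comp (F1 F2 F3 : functorData)
    (a : uptData F1 F2) (b : uptData F2 F3) : uptData F1 F3 :=
  @UptData F1 F3 (a * b) (fun X =>
    id_ (a * b * F3 X) \c (id_ a *t ucomp b X) \c (ucomp a X *t id_ b)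
      \c id_ (F1 X * (a * b))).

Definition upt_dual (F1 F2 : functorData) (b : uptData F1 F2) : uptData F2 F1 :=
  @UptData F2 F1 b (fun X =>
    id_ (b * F1 X) \c (id_ (b * F1 X) *t ev R b)
      \c (id_ b *t (ucomp b X) ^t* *t id_ b)
      \c (coev R b *t id_ (F2 X * b)) \c id_ (F2 X * b)).

Definition accessible (F' : functorData) : Prop :=
  is_fibre_functor F' /\
  exists a : uptData canonical_functor F', is_upt a.

Definition is_monoidal_iso (F1 F2 : functorData)
    (E : forall X : corep A, 'M[C]_(F2 X, F1 X)) : Prop :=
  [/\ forall X, unitary (E X),
      forall X Y (f : inter X Y), fmor F2 f *m E X = E Y *m fmor F1 f,
      forall X Y, E (X (x) Y) *m fmul F1 X Y = fmul F2 X Y *m (E X *t E Y)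
    & E 1c *m funit F1 = funit F2].

Definition monoidally_isomorphic (F1 F2 : functorData) : Prop :=
  exists E : forall X : corep A, 'M[C]_(F2 X, F1 X), is_monoidal_iso E.

Definition upt_of_iso (F1 F2 : functorData)
    (E : forall X : corep A, 'M[C]_(F2 X, F1 X)) : uptData F1 F2 :=
  @UptData F1 F2 1 (fun X => id_ (1 * F2 X) \c E X \c id_ (F1 X * 1)).

(* UPTs out of F with varying target. *)
Definition uptFrom (F : functorData) := {F' : functorData & uptData F F'}.

Definition is_upt_from (x : uptFrom canonical_functor) : Prop :=
  accessible (projT1 x) /\ is_upt (projT2 x).

Definition upt_equivalent (F : functorData) (x1 x2 : uptFrom F) : Prop :=
  exists E : forall X : corep A, 'M[C]_(projT1 x1 X, projT1 x2 X),
    is_monoidal_iso E /\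
  exists t : 'M[C]_(upt_comp (projT2 x2) (upt_of_iso E), projT2 x1),
    unitary t /\ is_modification t.

End FibreFunctors.

Section FrobeniusMonoids.
Variable R : realType.
Local Notation C := R[i].
Local Notation id_ n := (1%:M : 'M[C]_n).
Variable A : hopfStarAlg R.
Local Notation F := (canonical_functor A).
Local Notation "a (o) b" := (upt_comp a b) (at level 40, left associativity).

Record frobData := FrobData {
  frob_upt :> uptData F F;
  fr_mul : 'M[C]_(frob_upt, frob_upt * frob_upt);
  fr_unit : 'M[C]_(frob_upt, 1)
}.

(* A Frobenius monoid in the monoidal dagger category End(F).  Frobenius
   monoids in Rep(A_G) are the same thing, Rep(A_G) carrying the monoidal
   structure transported along the isomorphism Rep(A_G) = End(F) that sends a
   representation pi to |i> (x) h |-> sum_k pi(u_ki) h (x) |k>. *)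
Record is_frobenius (B : frobData) : Prop := IsFrobenius {
  frob_is_upt : is_upt (frob_upt B);
  fr_mul_mod : @is_modification R A F F (B (o) B) B (fr_mul B);
  fr_unit_mod : @is_modification R A F F (upt_id F) B (fr_unit B);
  fr_mulA :
    fr_mul B *m (fr_mul B *t id_ B) =
    fr_mul B \c (id_ B *t fr_mul B) \c id_ (B * B * B);
  fr_mul1l : fr_mul B \c (fr_unit B *t id_ B) \c id_ B = id_ B;
  fr_mul1r : fr_mul B \c (id_ B *t fr_unit B) \c id_ B = id_ B;
  fr_frobl :
    (fr_mul B *t id_ B) \c (id_ B *t (fr_mul B) ^t*) = (fr_mul B) ^t* *m fr_mul B;
  fr_frobr :
    (id_ B *t fr_mul B) \c ((fr_mul B) ^t* *t id_ B) = (fr_mul B) ^t* *m fr_mul B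
}.

(* f is a unitary *-isomorphism, in Hilb, from the underlying monoid of B to
   the normalised endomorphism algebra of C^d. *)
Definition is_end_iso (B : frobData) (d : nat) (f : 'M[C]_(d * d, B)) : Prop :=
  [/\ unitary f, f *m fr_mul B = end_mul R d *m (f *t f)
    & f *m fr_unit B = end_unit R d].

Definition is_simple_frobenius (B : frobData) : Prop :=
  is_frobenius B /\
  exists d, (0 < d)%N /\ exists f : 'M[C]_(d * d, B), is_end_iso f.

Definition star_isomorphic (B B' : frobData) : Prop :=
  exists f : 'M[C]_(B', B),
    [/\ unitary f, is_modification f,
        f *m fr_mul B = fr_mul B' *m (f *t f)
      & f *m fr_unit B = fr_unit B'].

Record bimodData (B1 B2 : frobData) := BimodData {
  bim_upt :> uptData F F;
  bim_act : 'M[C]_(bim_upt, B1 * bim_upt * B2)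
}.

Record is_bimodule (B1 B2 : frobData) (M : bimodData B1 B2) : Prop :=
  IsBimodule {
  bim_is_upt : is_upt (bim_upt M);
  bim_act_mod : @is_modification R A F F (B1 (o) M (o) B2) M (bim_act M);
  bim_act_mul :
    bim_act M *m (fr_mul B1 *t id_ M *t fr_mul B2) =
    bim_act M *m (id_ B1 *t bim_act M *t id_ B2)
      \c id_ (B1 * B1 * M * (B2 * B2));
  bim_act_unit :
    bim_act M *m (fr_unit B1 *t id_ M *t fr_unit B2) \c id_ M = id_ M;
  bim_act_dag :
    bim_act M =
    id_ M \c (((fr_unit B1) ^t* *m fr_mul B1) *t id_ M *t
              ((fr_unit B2) ^t* *m fr_mul B2))
      \c (id_ B1 *t (bim_act M) ^t* *t id_ B2)
}.

Definition bimod_isomorphic (B1 B2 : frobData) (M N : bimodData B1 B2) : Prop :=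
  exists f : 'M[C]_(N, M),
    [/\ unitary f, is_modification f
      & f *m bim_act M = bim_act N *m (id_ B1 *t f *t id_ B2)].

Definition left_act (B1 B2 : frobData) (M : bimodData B1 B2) :
    'M[C]_(M, B1 * M) :=
  bim_act M *m (id_ (B1 * M) *t fr_unit B2) \c id_ (B1 * M).
Definition right_act (B1 B2 : frobData) (M : bimodData B1 B2) :
    'M[C]_(M, M * B2) :=
  bim_act M *m (fr_unit B1 *t id_ M *t id_ B2) \c id_ (M * B2).

Definition rel_idem (B1 B2 B3 : frobData)
    (M : bimodData B1 B2) (N : bimodData B2 B3) : 'M[C]_(M * N) :=
  (right_act M *t left_act N)
    \c (id_ M *t ((fr_mul B2) ^t* *m fr_unit B2) *t id_ N) \c id_ (M * N).

(* T, with the isometry i, is the relative tensor product of M and N over B2. *)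
Definition is_rel_tensor (B1 B2 B3 : frobData)
    (M : bimodData B1 B2) (N : bimodData B2 B3) (T : bimodData B1 B3)
    (i : 'M[C]_(M * N, T)) : Prop :=
  [/\ is_upt (bim_upt T), @is_modification R A F F T (M (o) N) i,
      isometry i, i *m i ^t* = rel_idem M N
    & bim_act T = i ^t* *m (left_act M *t right_act N)
                  \c (id_ B1 *t i *t id_ B3)].

Definition regular_bimod (B : frobData) : bimodData B B :=
  @BimodData B B B (fr_mul B *m (fr_mul B *t id_ B)).

Definition morita_equivalent (B1 B2 : frobData) : Prop :=
  exists (M : bimodData B1 B2) (N : bimodData B2 B1),
    [/\ is_bimodule M, is_bimodule N,
        exists (T : bimodData B1 B1) (i : 'M[C]_(M * N, T)),
          is_rel_tensor i /\ bimod_isomorphic T (regular_bimod B1)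
      & exists (T : bimodData B2 B2) (i : 'M[C]_(N * M, T)),
          is_rel_tensor i /\ bimod_isomorphic T (regular_bimod B2)].

Definition frob_of_upt (x : uptFrom F) : frobData :=
  @FrobData (projT2 x (o) upt_dual (projT2 x))
    (end_mul R (projT2 x)) (end_unit R (projT2 x)).

(* The choices are d and f : B -> C^d (x) (C^d)^*, which brings B to standard
   form, and the isometries iota_V : F_alpha(V) -> H^* (x) F(V) (x) H, with
   F_alpha(V) = C^(n V) and H = C^d. *)
Section Split.
Variables (B : frobData) (d : nat) (f : 'M[C]_(d * d, B)).

Definition standard_comp (V : corep A) : 'M[C]_(d * d * F V, F V * (d * d)) :=
  (f *t id_ (F V)) *m ucomp B V *m (id_ (F V) *t f ^t*).

Definition split_proj (V : corep A) : 'M[C]_(d * F V * d) :=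
  d%:R^-1 *:
  (id_ (d * F V * d) \c (ev R d *t id_ (d * F V * d))
    \c (id_ d *t standard_comp V *t id_ d)
    \c (id_ (d * F V * d) *t coev R d) \c id_ (d * F V * d)).

Variables (n : corep A -> nat) (iota : forall V, 'M[C]_(d * F V * d, n V)).

Definition is_split : Prop :=
  forall V, isometry (iota V) /\ iota V *m (iota V) ^t* = split_proj V.

Definition split_functor : functorData A := {|
  fob := n;
  fmor := fun V W g =>
    (iota W) ^t* *m (id_ d *t fmor F g *t id_ d) *m iota V;
  fmul := fun V W =>
    sqrtd R d *:
    ((iota (tens_corep V W)) ^t* *m (id_ d *t fmul F V W *t id_ d)
      \c (id_ (d * F V) *t ev R d *t id_ (F W * d)) \c (iota V *t iota W));
  funit :=
    (sqrtd R d)^-1 *: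
    ((iota (unit_corep A)) ^t* *m (id_ d *t funit F *t id_ d) \c coev R d)
|}.

Definition split_upt : uptData F split_functor :=
  @UptData R A F split_functor d (fun V =>
    sqrtd R d *:
    ((id_ d *t (iota V) ^t*) \c (coev R d *t id_ (F V * d)) \c id_ (F V * d))).

End Split.

Definition upt_from_frob (B : frobData) (x : uptFrom F) : Prop :=
  exists (d : nat) (f : 'M[C]_(d * d, B)) (n : corep A -> nat)
      (iota : forall V, 'M[C]_(d * F V * d, n V)),
    [/\ (0 < d)%N, is_end_iso f, is_split f iota
      & x = existT _ (split_functor iota) (split_upt iota)].

End FrobeniusMonoids.

Local Open Scope classical_set_scope.

Definition equivalence_on (T : Type) (X : set T) (e : T -> T -> Prop) : Prop :=
  [/\ forall x, X x -> e x x,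
      forall x y, X x -> X y -> e x y -> e y x
    & forall x y z, X x -> X y -> X z -> e x y -> e y z -> e x z].

Definition eq_class (T : Type) (X : set T) (e : T -> T -> Prop) (x : T) : set T :=
  [set y | X y /\ e x y].

Definition eq_classes (T : Type) (X : set T) (e : T -> T -> Prop) : set (set T) :=
  eq_class X e @` X.

(* The relation c is a construction from X to Y which may involve choices:
   [c x y] says that y is a possible result for x. *)
Definition is_construction (T U : Type) (X : set T) (Y : set U)
    (c : T -> U -> Prop) : Prop :=
  forall x, X x -> (exists y, c x y) /\ (forall y, c x y -> Y y).

(* The constructions a and b are well defined on classes, and are mutually
   inverse bijections there. *)
Definition bijective_correspondence (T U : Type)
    (X : set T) (eX : T -> T -> Prop) (Y : set U) (eY : U -> U -> Prop)
    (a : T -> U -> Prop) (b : U -> T -> Prop) : Prop :=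
  [/\ equivalence_on X eX /\ equivalence_on Y eY,
      is_construction X Y a, is_construction Y X b &
      exists2 Phi : set T -> set U,
        set_bij (eq_classes X eX) (eq_classes Y eY) Phi &
        (forall x y, X x -> a x y -> Phi (eq_class X eX x) = eq_class Y eY y) /\
        (forall x y, Y y -> b y x -> Phi (eq_class X eX x) = eq_class Y eY y)].

(* Main.v *)
Require Import Defs.
From mathcomp Require Import all_boot all_order all_algebra.
From mathcomp Require Import sesquilinear spectral.
From mathcomp Require Import complex mxtens.
From mathcomp Require Import boolp classical_sets reals.
From mathcomp Require Import ring.

(** Write x^+ for the adjoint.  A transformation a from the canonical functor F to
F', with auxiliary space H = C^d, is a family of operators a_ki on H, one for
each object X and basis vectors e_i of F(X) and e_k of F'(X):

  a_X (e_i (x) h) = sum_k  (a_ki h) (x) e_k.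

In these terms the axioms say that (a_ki) is a unitary matrix of operators,
natural in X, and multiplicative up to the multiplicators of F'; composition
multiplies such matrices and the dual conjugates their entries ([uop],
[is_uptP], [uop_comp], [uop_dual]).  All arguments are made with the a_ki.

Two facts are used throughout.
 - The target of a transformation out of F is a fibre functor, because it is F
   transported along a unitary ([fibre_functor_of_upt]).
 - The matrix (a_ki^+) of adjoints is unitary too ([upt_conj_unitary]).  This
   is where the algebra has to be generated by unitary corepresentations.  It
   makes the coefficients of unitary corepresentations span the algebra, so the
   coefficients of the conjugate of V occur in some unitary W, and orthogonality
   with respect to the trace form produces intertwiners from the conjugate of V
   to W which are jointly injective ([conj_embedding]).  Naturality of a along
   them expresses the matrix of adjoints through the unitary matrix of W.

Construction (a).  The operators of the composite of a with its dual act on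
matrices by Y |-> sum_z a_zi Y a_zk^+.  By the two unitarity relations the
product and the unit of End(H) are compatible with this action
([frob_of_upt_simple]).

Construction (b).  A simple Frobenius monoid in standard form is a family of
maps b_ki on M_d with b_ki(YZ) = sum_j b_ji(Y) b_kj(Z) which preserve the trace,
and therefore the involution ([std_act_dag]).  The isometries iota_V amount to
Kraus decompositions b_ki(Y) = sum_v s_vi Y s_vk^+, and the s_vi are the
operators of the square root of the monoid ([kraus_act]).  The rule for
b_ki(YZ) and the linear independence of the s_v give the unitarity relations for
s ([kraus_adj_coiso]).  Since a Kraus decomposition is unique up to scalars
([kraus_scalars]), naturality and monoidality of b give those of s
([split_upt_is_upt]); the monoid of s is the one that s came from
([split_star_isomorphic]).

Part 2.  A *-isomorphism between the monoids of a1 and a2 is conjugation by a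
unitary of H ([end_iso_inner]).  After this conjugation a1 and a2 are two Kraus
decompositions of one map, and the scalars relating them form a monoidal natural
isomorphism ([equivalent_of_star_iso]).

Part 1.  A bimodule M between the monoids of a1 and a2 is a space with commuting
actions of M_d1 and of the opposite of M_d2, written L(X, Y), and operators M_ki
compatible with them.  If M is invertible, the trace of the idempotent defining
the relative tensor product shows that dim M = d1 d2 ([bimodule_dim]), so that M
is irreducible.  By Schur's lemma M_ki = sum_zy c_zy L(a1_yi, a2_zk^+) with
scalars c_zy, and c is a monoidal isomorphism F1 -> F2
([monoidal_iso_of_morita]).  Conversely, an isomorphism F1 -> F2 lets one assume
that a1 and a2 have the same target; then the composites of a1 with the dual of
a2, and of a2 with the dual of a1, are mutually inverse bimodules, all the
actions being matrix products ([morita_of_same_target]). *)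

Set Implicit Arguments.
Unset Strict Implicit.
Unset Printing Implicit Defensive.

Import Order.TTheory GRing.Theory Num.Theory.
Local Open Scope ring_scope.
Local Open Scope sesquilinear_scope.
Local Notation isometry := Defs.isometry.

(** * Adjoints, vectors of a tensor product, matrices as vectors *)

Section Kets.
Variable R : realType.
Local Notation C := R[i].

Lemma cjD (x y : C) : (x + y)^* = x^* + y^*. Proof. exact: rmorphD. Qed.
Lemma cjM (x y : C) : (x * y)^* = x^* * y^*. Proof. exact: rmorphM. Qed.
Lemma cj_sum (I : Type) (r : seq I) P (F : I -> C) :
  (\sum_(i <- r | P i) F i)^* = \sum_(i <- r | P i) (F i)^*.
Proof. exact: rmorph_sum. Qed.
Lemma cj_nat n : (n%:R : C)^* = n%:R. Proof. exact: rmorph_nat. Qed.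

Lemma dagE m n (f : 'M[C]_(m, n)) i j : (f ^t*) i j = (f j i)^*.
Proof. by rewrite !mxE. Qed.

Lemma dagM m n p (f : 'M[C]_(m, n)) (g : 'M[C]_(n, p)) :
  (f *m g) ^t* = g ^t* *m f ^t*.
Proof. by rewrite trmx_mul map_mxM. Qed.

Lemma dag1 n : (1%:M : 'M[C]_n) ^t* = 1%:M.
Proof. by rewrite trmx1 map_mx1. Qed.

Lemma dagB m n (f g : 'M[C]_(m, n)) : (f - g) ^t* = f ^t* - g ^t*.
Proof. by rewrite linearB map_mxB. Qed.

Lemma dagZ m n c (f : 'M[C]_(m, n)) : (c *: f) ^t* = c^* *: f ^t*.
Proof. by rewrite linearZ map_mxZ. Qed.

Lemma dag_scalar n (c : C) : (c%:M : 'M[C]_n) ^t* = (c^*)%:M.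
Proof. by rewrite tr_scalar_mx map_scalar_mx. Qed.

Lemma dag_sum m n (I : Type) (r : seq I) P (f : I -> 'M[C]_(m, n)) :
  (\sum_(i <- r | P i) f i) ^t* = \sum_(i <- r | P i) (f i) ^t*.
Proof. by rewrite linear_sum map_mx_sum. Qed.

Lemma dag_tens m n p q (f : 'M[C]_(m, n)) (g : 'M[C]_(p, q)) :
  (f *t g) ^t* = f ^t* *t g ^t*.
Proof. by rewrite trmx_tens map_mxT. Qed.

Lemma dag_eq0 m n (f : 'M[C]_(m, n)) : f ^t* = 0 -> f = 0.
Proof. by move=> f0; rewrite -[f]trmxCK f0 trmx0 map_mx0. Qed.

Definition ket n (i : 'I_n) : 'cV[C]_n := delta_mx i 0.

Lemma mulmx_ket m n (f : 'M[C]_(m, n)) i j : (f *m ket i) j 0 = f j i.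
Proof.
rewrite mxE (bigD1 i) //= big1 => [|k ki]; last by rewrite mxE (negPf ki) mulr0.
by rewrite mxE !eqxx mulr1 addr0.
Qed.

Lemma ketE n (i k : 'I_n) : ket i k 0 = (k == i)%:R.
Proof. by rewrite mxE eqxx andbT. Qed.

Lemma cV_ket n (v : 'cV[C]_n) : v = \sum_i v i 0 *: ket i.
Proof.
rewrite {1}[v]matrix_sum_delta; apply: eq_bigr => i _.
by rewrite big_ord1.
Qed.

(** The product [*t] of two columns has 1 * 1 columns; this version is again a
    column. *)
Definition tv m n (x : 'cV[C]_m) (y : 'cV[C]_n) : 'cV[C]_(m * n) :=
  \col_k (x (mxtens_unindex k).1 0 * y (mxtens_unindex k).2 0).
Local Notation "x *k y" := (tv x y) (at level 40, left associativity).

Lemma tvE m n (x : 'cV[C]_m) (y : 'cV[C]_n) i j :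
  (x *k y) (mxtens_index (i, j)) 0 = x i 0 * y j 0.
Proof. by rewrite mxE mxtens_indexK. Qed.

Lemma tensmx_tv m n p q (f : 'M[C]_(m, n)) (g : 'M[C]_(p, q)) x y :
  (f *t g) *m (x *k y) = (f *m x) *k (g *m y).
Proof.
apply/colP => k; case: (mxtens_indexP k) => i j; rewrite tvE !mxE sum_mxtens.
rewrite mulr_suml; apply: eq_bigr => a _; rewrite mulr_sumr.
by apply: eq_bigr => b _; rewrite tensmxE tvE mulrACA.
Qed.

Lemma tvDl m n (x y : 'cV[C]_m) (z : 'cV[C]_n) : (x + y) *k z = x *k z + y *k z.
Proof. by apply/colP => k; rewrite !mxE mulrDl. Qed.
Lemma tvDr m n (x : 'cV[C]_m) (y z : 'cV[C]_n) : x *k (y + z) = x *k y + x *k z.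
Proof. by apply/colP => k; rewrite !mxE mulrDr. Qed.
Lemma tvZl m n c (x : 'cV[C]_m) (z : 'cV[C]_n) : (c *: x) *k z = c *: (x *k z).
Proof. by apply/colP => k; rewrite !mxE mulrA. Qed.
Lemma tvZr m n c (x : 'cV[C]_m) (z : 'cV[C]_n) : x *k (c *: z) = c *: (x *k z).
Proof. by apply/colP => k; rewrite !mxE mulrCA. Qed.
Lemma tv0l m n (z : 'cV[C]_n) : (0 : 'cV[C]_m) *k z = 0.
Proof. by apply/colP => k; rewrite !mxE mul0r. Qed.
Lemma tv0r m n (x : 'cV[C]_m) : x *k (0 : 'cV[C]_n) = 0.
Proof. by apply/colP => k; rewrite !mxE mulr0. Qed.
Lemma tv_suml m n (I : Type) (r : seq I) P (f : I -> 'cV[C]_m) (y : 'cV[C]_n) :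
  (\sum_(i <- r | P i) f i) *k y = \sum_(i <- r | P i) f i *k y.
Proof. by elim/big_rec2: _ => [|i a b _ <-]; rewrite ?tv0l ?tvDl. Qed.
Lemma tv_sumr m n (I : Type) (r : seq I) P (f : I -> 'cV[C]_n) (x : 'cV[C]_m) :
  x *k (\sum_(i <- r | P i) f i) = \sum_(i <- r | P i) x *k f i.
Proof. by elim/big_rec2: _ => [|i a b _ <-]; rewrite ?tv0r ?tvDr. Qed.

Lemma eq_mxtens m n (i k : 'I_m) (j l : 'I_n) :
  (mxtens_index (i, j) == mxtens_index (k, l)) = (i == k) && (j == l).
Proof. by rewrite (can_eq (@mxtens_indexK _ _)) xpair_eqE. Qed.

Lemma ket_tv m n (i : 'I_m) (j : 'I_n) : ket (mxtens_index (i, j)) = ket i *k ket j.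
Proof.
apply/colP => k; case: (mxtens_indexP k) => a b.
by rewrite tvE !ketE (can_eq (@mxtens_indexK _ _)) xpair_eqE -natrM mulnb.
Qed.

Lemma mx_ket_ext m n (f g : 'M[C]_(m, n)) :
  (forall i, f *m ket i = g *m ket i) -> f = g.
Proof.
by move=> fg; apply/matrixP => i j; rewrite -(mulmx_ket f) -(mulmx_ket g) fg.
Qed.

Lemma mx_cV_ext m n (f g : 'M[C]_(m, n)) :
  (forall x : 'cV_n, f *m x = g *m x) -> f = g.
Proof. by move=> fg; apply: mx_ket_ext => i. Qed.

Lemma mx_tv_ext m n p (f g : 'M[C]_(p, m * n)) :
  (forall x y, f *m (x *k y) = g *m (x *k y)) -> f = g.
Proof.
by move=> fg; apply: mx_ket_ext => k; case: (mxtens_indexP k) => i j; rewrite ket_tv.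
Qed.

Lemma mx_tv3_ext m n p q (f g : 'M[C]_(q, m * n * p)) :
  (forall x y z, f *m (x *k y *k z) = g *m (x *k y *k z)) -> f = g.
Proof.
move=> fg; apply: mx_ket_ext => k; case: (mxtens_indexP k) => i j; rewrite ket_tv.
by case: (mxtens_indexP i) => a b; rewrite ket_tv.
Qed.

Lemma scompE m n n' p (g : 'M[C]_(p, n')) (f : 'M[C]_(n, m)) e q (x : 'M_(m, q)) :
  scomp g f e *m x = g *m castmx (e, erefl) (f *m x).
Proof. by rewrite /scomp; case: n' / e g => g; rewrite !castmx_id mulmxA. Qed.

(** On product vectors a change of bracketing of the dimensions is a change of
    bracketing of the factors.  All composites [\c] below are computed by evaluating
    them on product vectors, where the casts disappear by this lemma and its
    relatives. *)
Lemma cast_tvA m n p (x : 'cV[C]_m) (y : 'cV[C]_n) (z : 'cV[C]_p)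
    (e : (m * n * p = m * (n * p))%N) :
  castmx (e, erefl) (x *k y *k z) = x *k (y *k z).
Proof.
apply/colP => k; case: (mxtens_indexP k) => i jl; case: (mxtens_indexP jl) => j l.
rewrite castmxE /= !tvE cast_ord_id.
have -> : cast_ord (esym e) (mxtens_index (i, mxtens_index (j, l))) =
          mxtens_index (mxtens_index (i, j), l).
  by apply: val_inj; rewrite /= mulnDl -addnA -mulnA.
by rewrite !tvE mulrA.
Qed.

Lemma cast_tvA' m n p (x : 'cV[C]_m) (y : 'cV[C]_n) (z : 'cV[C]_p)
    (e : (m * (n * p) = m * n * p)%N) :
  castmx (e, erefl) (x *k (y *k z)) = x *k y *k z.
Proof.
rewrite -(cast_tvA _ _ _ (esym e)) castmx_comp castmx_id //.
Qed.

Lemma cast_tv1l n (x : 'cV[C]_1) (y : 'cV[C]_n) (e : (1 * n = n)%N) :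
  castmx (e, erefl) (x *k y) = x 0 0 *: y.
Proof.
apply/colP => j; rewrite castmxE cast_ord_id [RHS]mxE.
have -> : cast_ord (esym e) j = mxtens_index (0, j).
  by apply: val_inj.
by rewrite tvE.
Qed.

Lemma cast_tv1r n (x : 'cV[C]_1) (y : 'cV[C]_n) (e : (n * 1 = n)%N) :
  castmx (e, erefl) (y *k x) = x 0 0 *: y.
Proof.
apply/colP => j; rewrite castmxE cast_ord_id [RHS]mxE mulrC.
have -> : cast_ord (esym e) j = mxtens_index (j, 0).
  by apply: val_inj; rewrite /= muln1 addn0.
by rewrite tvE.
Qed.

Lemma cast_1tvl n (y : 'cV[C]_n) (e : (n = 1 * n)%N) :
  castmx (e, erefl) y = (1%:M : 'cV_1) *k y.
Proof.
apply: (canLR (castmxKV _ _)) => /=; rewrite cast_tv1l.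
by rewrite mxE scale1r.
Qed.

Lemma cast_1tvr n (y : 'cV[C]_n) (e : (n = n * 1)%N) :
  castmx (e, erefl) y = y *k (1%:M : 'cV_1).
Proof.
apply: (canLR (castmxKV _ _)) => /=; rewrite cast_tv1r.
by rewrite mxE scale1r.
Qed.

Lemma castcast m m' m'' n (f : 'M[C]_(m, n)) (e : m = m') (e' : m' = m'') :
  castmx (e', erefl) (castmx (e, erefl) f) = castmx (etrans e e', erefl) f.
Proof. by rewrite castmx_comp. Qed.

Lemma cast_tv_swap1 n (x : 'cV[C]_n) (y : 'cV[C]_1) (e : (n * 1 = 1 * n)%N) :
  castmx (e, erefl) (x *k y) = y *k x.
Proof.
have e1 : (n * 1 = n)%N by rewrite muln1.
have e2 : (n = 1 * n)%N by rewrite mul1n.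
have -> : e = etrans e1 e2 by exact: nat_irrelevance.
rewrite -castcast cast_tv1r cast_1tvl tvZr -tvZl; congr (_ *k _).
by apply/colP => i; rewrite !ord1 !mxE mulr1.
Qed.

Lemma cast_tv_in m m' n n' (x : 'cV[C]_m) (y : 'cV[C]_n) (e1 : m = m') (e2 : n = n')
    (e : (m * n = m' * n')%N) :
  castmx (e, erefl) (x *k y) = castmx (e1, erefl) x *k castmx (e2, erefl) y.
Proof.
by case: m' / e1 e; case: n' / e2 => e; rewrite !castmx_id.
Qed.

Lemma cast_tv_mid m n p q (x : 'cV[C]_m) (y : 'cV[C]_n) (z : 'cV[C]_p) (w : 'cV[C]_q)
    (e : (m * n * (p * q) = m * (n * p) * q)%N) :
  castmx (e, erefl) (x *k y *k (z *k w)) = x *k (y *k z) *k w.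
Proof.
have e1 : (m * n * (p * q) = m * n * p * q)%N by rewrite mulnA.
have e2 : (m * n * p = m * (n * p))%N by rewrite mulnA.
have e3 : (m * n * p * q = m * (n * p) * q)%N by rewrite e2.
have -> : e = etrans e1 e3 by exact: nat_irrelevance.
by rewrite -castcast cast_tvA'
  (cast_tv_in _ _ e2 erefl) cast_tvA castmx_id.
Qed.

Lemma cast_tv_mid' m n p q (x : 'cV[C]_m) (y : 'cV[C]_n) (z : 'cV[C]_p) (w : 'cV[C]_q)
    (e : (m * (n * p) * q = m * n * (p * q))%N) :
  castmx (e, erefl) (x *k (y *k z) *k w) = x *k y *k (z *k w).
Proof. by rewrite -(cast_tv_mid _ _ _ _ (esym e)) castmx_comp castmx_id. Qed.

Lemma castZ m n m' c (f : 'M[C]_(m, n)) (e : m = m') :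
  castmx (e, erefl) (c *: f) = c *: castmx (e, erefl) f.
Proof. by case: m' / e; rewrite !castmx_id. Qed.

Lemma cast_sum m n m' (I : Type) (r : seq I) P (f : I -> 'M[C]_(m, n)) (e : m = m') :
  castmx (e, erefl) (\sum_(i <- r | P i) f i) =
  \sum_(i <- r | P i) castmx (e, erefl) (f i).
Proof. by case: m' / e; rewrite castmx_id; apply: eq_bigr => i _; rewrite castmx_id. Qed.


Lemma ev_tv d (x y : 'cV[C]_d) : ev R d *m (x *k y) = (\sum_i x i 0 * y i 0)%:M.
Proof.
apply/colP => i; rewrite !ord1 mxE sum_mxtens mxE mulr1n.
apply: eq_bigr => a _; rewrite (bigD1 a) //= big1 => [|b ba].
  by rewrite !mxE !mxtens_indexK eqxx mul1r addr0.
by rewrite !mxE !mxtens_indexK eq_sym (negPf ba) mul0r.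
Qed.

Lemma coev_ket d : coev R d = \sum_i ket i *k ket i.
Proof.
apply/colP => k; case: (mxtens_indexP k) => i j; rewrite summxE mxE mxtens_indexK /=.
rewrite (bigD1 i) //= big1 => [|a ai].
  by rewrite tvE !ketE eqxx mul1r addr0 eq_sym.
by rewrite tvE ketE eq_sym (negPf ai) mul0r.
Qed.

Lemma coevE d c : coev R d *m (c : 'cV_1) = c 0 0 *: \sum_i ket i *k ket i.
Proof. by rewrite [c]mx11_scalar mul_mx_scalar coev_ket !mxE. Qed.

(** Matrices m x n are the vectors of C^m (x) (C^n)^*, with f (x) g acting as
    X |-> f X g^T. *)
Definition vec m n (X : 'M[C]_(m, n)) : 'cV[C]_(m * n) :=
  \col_k X (mxtens_unindex k).1 (mxtens_unindex k).2.
Definition unvec m n (v : 'cV[C]_(m * n)) : 'M[C]_(m, n) :=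
  \matrix_(i, j) v (mxtens_index (i, j)) 0.

Lemma vecE m n (X : 'M[C]_(m, n)) i j : vec X (mxtens_index (i, j)) 0 = X i j.
Proof. by rewrite mxE mxtens_indexK. Qed.
Lemma vecK m n : cancel (@vec m n) (@unvec m n).
Proof. by move=> X; apply/matrixP => i j; rewrite mxE vecE. Qed.
Lemma unvecK m n : cancel (@unvec m n) (@vec m n).
Proof. by move=> v; apply/colP => k; case: (mxtens_indexP k) => i j; rewrite vecE mxE. Qed.

Lemma vecD m n (X Y : 'M[C]_(m, n)) : vec (X + Y) = vec X + vec Y.
Proof. by apply/colP => k; rewrite !mxE. Qed.
Lemma vecZ m n c (X : 'M[C]_(m, n)) : vec (c *: X) = c *: vec X.
Proof. by apply/colP => k; rewrite !mxE. Qed.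
Lemma vec0 m n : vec (0 : 'M[C]_(m, n)) = 0.
Proof. by apply/colP => k; rewrite !mxE. Qed.
Lemma vec_sum m n (I : Type) (r : seq I) P (X : I -> 'M[C]_(m, n)) :
  vec (\sum_(i <- r | P i) X i) = \sum_(i <- r | P i) vec (X i).
Proof. by elim/big_rec2: _ => [|i a b _ <-]; rewrite ?vec0 ?vecD. Qed.
Lemma unvecZ m n c (X : 'cV[C]_(m * n)) : unvec (c *: X) = c *: unvec X.
Proof. by apply/matrixP => k l; rewrite !mxE. Qed.
Lemma tens_vec m n p q (f : 'M[C]_(p, m)) (g : 'M[C]_(q, n)) X :
  (f *t g) *m vec X = vec (f *m X *m g^T).
Proof.
apply/colP => k; case: (mxtens_indexP k) => i j; rewrite vecE !mxE sum_mxtens.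
under [RHS]eq_bigr => b _ do rewrite mxE mulr_suml.
rewrite exchange_big /=; apply: eq_bigr => a _; apply: eq_bigr => b _.
by rewrite tensmxE vecE mxE mulrAC.
Qed.

Lemma mx_vec_ext m n p (f g : 'M[C]_(p, m * n)) :
  (forall X, f *m vec X = g *m vec X) -> f = g.
Proof. by move=> fg; apply: mx_cV_ext => v; rewrite -[v]unvecK fg. Qed.

Lemma trmx_conj m n (f : 'M[C]_(m, n)) : (map_mx Num.conj f)^T = f ^t*.
Proof. by rewrite map_trmx. Qed.

Lemma tens_conj_vec m n p q (f : 'M[C]_(p, m)) (g : 'M[C]_(q, n)) X :
  (f *t map_mx Num.conj g) *m vec X = vec (f *m X *m g ^t*).
Proof. by rewrite tens_vec trmx_conj. Qed.

Lemma trmul_ge0 m n (X : 'M[C]_(m, n)) : 0 <= \tr (X ^t* *m X).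
Proof.
apply: sumr_ge0 => i _; rewrite mxE; apply: sumr_ge0 => j _.
by rewrite dagE mulrC mul_conjC_ge0.
Qed.

Lemma tr_adj_mul m n (X Y : 'M[C]_(m, n)) :
  \tr (X ^t* *m Y) = \sum_i \sum_j (X i j)^* * Y i j.
Proof.
rewrite /mxtrace exchange_big /=; apply: eq_bigr => j _.
by rewrite mxE; apply: eq_bigr => i _; rewrite dagE.
Qed.

Lemma tr_eq0 m n (X : 'M[C]_(m, n)) : \tr (X ^t* *m X) = 0 -> X = 0.
Proof.
rewrite tr_adj_mul => /eqP; rewrite psumr_eq0 => [/allP X0|i _]; last first.
  by apply: sumr_ge0 => j _; rewrite mulrC mul_conjC_ge0.
apply/matrixP => i j; have := X0 i (mem_index_enum _); rewrite psumr_eq0 => [/allP Xi|k _].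
  have := Xi j (mem_index_enum _); rewrite mulrC mul_conjC_eq0 mxE => /eqP.
  by [].
by rewrite mulrC mul_conjC_ge0.
Qed.

Lemma mxtrace_dag n (X : 'M[C]_n) : \tr (X ^t*) = (\tr X)^*.
Proof. by rewrite /mxtrace rmorph_sum; apply: eq_bigr => i _; rewrite dagE. Qed.

Lemma mxtrace_sum n (I : Type) (r : seq I) P (F : I -> 'M[C]_n) :
  \tr (\sum_(i <- r | P i) F i) = \sum_(i <- r | P i) \tr (F i).
Proof. exact: raddf_sum. Qed.

Lemma mxtraceB n (X Y : 'M[C]_n) : \tr (X - Y) = \tr X - \tr Y.
Proof. exact: raddfB. Qed.

Lemma isometry_dim m n (f : 'M[C]_(n, m)) : f ^t* *m f = 1%:M -> m = n ->
  f *m f ^t* = 1%:M.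
Proof. by move=> ff e; case: n / e f ff => f; exact: mulmx1C. Qed.

Lemma unitary_dim m n (f : 'M[C]_(n, m)) : unitary f -> m = n.
Proof.
case=> f1 f2; have := mxtrace_mulC f (f ^t*); rewrite f1 f2 !mxtrace1 => /eqP.
by rewrite eqr_nat => /eqP.
Qed.

(** The choice X = 1 gives a = b, and a central matrix is scalar. *)
Lemma central_scalar d (a b : 'M[C]_d) :
  (forall X, X *m a = b *m X) -> exists c : C, a = c%:M /\ b = c%:M.
Proof.
move=> ab; have eab : a = b by have := ab 1%:M; rewrite mul1mx mulmx1.
move: d a b ab eab => [|d] a b ab eab.
  by exists 0; split; apply/matrixP => -[].
exists (a 0 0); rewrite -eab; suff -> : a = (a 0 0)%:M by rewrite mxE eqxx.
apply/matrixP => i j; rewrite mxE.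
have /matrixP/(_ 0 j) := ab (delta_mx 0 i).
rewrite -eab !mxE (bigD1 i) //= big1 => [|k ki]; last first.
  by rewrite !mxE (negPf ki) andbF mul0r.
rewrite (bigD1 0) //= big1 => [|k k0]; last by rewrite !mxE (negPf k0) mulr0.
by rewrite !mxE !eqxx mul1r /= !addr0 eq_sym => ->; rewrite mulr_natr.
Qed.

End Kets.
Notation "x *k y" := (tv x y) (at level 40, left associativity) : ring_scope.

(** * Transformations as matrices of operators *)

Section Operators.
Variable R : realType.
Local Notation C := R[i].

(** The map sending e_i (x) h to the sum over k of (f k i h) (x) e_k. *)
Definition umat d n1 n2 (f : 'I_n2 -> 'I_n1 -> 'M[C]_d) : 'M[C]_(d * n2, n1 * d) :=
  \matrix_(x, y) f (mxtens_unindex x).2 (mxtens_unindex y).1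
                   (mxtens_unindex x).1 (mxtens_unindex y).2.

Lemma umatE d n1 n2 (f : 'I_n2 -> 'I_n1 -> 'M[C]_d) i h :
  umat f *m (ket R i *k h) = \sum_k (f k i *m h) *k ket R k.
Proof.
apply/colP => x; case: (mxtens_indexP x) => p k; rewrite summxE mxE sum_mxtens.
rewrite (bigD1 i) //= [X in _ + X]big1 => [|j ji]; last first.
  by apply: big1 => q _; rewrite tvE ketE (negPf ji) mul0r mulr0.
rewrite (bigD1 k) //= [X in _ = _ + X]big1 => [|l lk]; last first.
  by rewrite tvE ketE eq_sym (negPf lk) mulr0.
rewrite !addr0 tvE ketE eqxx mulr1 mxE; apply: eq_bigr => q _.
by rewrite tvE ketE eqxx mul1r mxE !mxtens_indexK.
Qed.

Lemma umat_dagE d n1 n2 (f : 'I_n2 -> 'I_n1 -> 'M[C]_d) k h :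
  (umat f) ^t* *m (h *k ket R k) = \sum_i ket R i *k ((f k i) ^t* *m h).
Proof.
apply/colP => x; case: (mxtens_indexP x) => i p; rewrite summxE mxE sum_mxtens exchange_big.
rewrite (bigD1 k) //= [X in _ + X]big1 => [|j ji]; last first.
  by apply: big1 => q _; rewrite tvE ketE (negPf ji) !mulr0.
rewrite (bigD1 i) //= [X in _ = _ + X]big1 => [|l lk]; last first.
  by rewrite tvE ketE eq_sym (negPf lk) mul0r.
rewrite !addr0 tvE ketE eqxx mul1r mxE; apply: eq_bigr => q _.
by rewrite tvE ketE eqxx mulr1 !mxE !mxtens_indexK.
Qed.

Lemma umat_inj d n1 n2 (f g : 'I_n2 -> 'I_n1 -> 'M[C]_d) :
  umat f = umat g -> forall k i, f k i = g k i.
Proof.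
move=> fg k i; apply/matrixP => p q.
have /matrixP/(_ (mxtens_index (p, k)) (mxtens_index (i, q))) := fg.
by rewrite !mxE !mxtens_indexK.
Qed.

Lemma sum_tvket_inj d n (f g : 'I_n -> 'cV[C]_d) :
  \sum_k f k *k ket R k = \sum_k g k *k ket R k -> f =1 g.
Proof.
move=> fg k; apply/colP => p.
have E (h : 'I_n -> 'cV[C]_d) :
    (\sum_k h k *k ket R k) (mxtens_index (p, k)) 0 = h k p 0.
  rewrite summxE (bigD1 k) //= big1 => [|l lk]; last first.
    by rewrite tvE ketE eq_sym (negPf lk) mulr0.
  by rewrite tvE ketE eqxx mulr1 addr0.
by rewrite -E fg E.
Qed.

Lemma sum_kettv_inj d n (f g : 'I_n -> 'cV[C]_d) :
  \sum_k ket R k *k f k = \sum_k ket R k *k g k -> f =1 g.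
Proof.
move=> fg k; apply/colP => p.
have E (h : 'I_n -> 'cV[C]_d) :
    (\sum_k ket R k *k h k) (mxtens_index (k, p)) 0 = h k p 0.
  rewrite summxE (bigD1 k) //= big1 => [|l lk]; last first.
    by rewrite tvE ketE eq_sym (negPf lk) mul0r.
  by rewrite tvE ketE eqxx mul1r addr0.
by rewrite -E fg E.
Qed.

Lemma delta_sum n (i : 'I_n) d m (f : 'I_n -> 'M[C]_(d, m)) :
  \sum_j (j == i)%:R *: f j = f i.
Proof.
by rewrite (bigD1 i) //= big1 => [|j /negPf->]; rewrite ?eqxx ?scale0r // scale1r addr0.
Qed.

Lemma delta_sum' n (i : 'I_n) d m (f : 'I_n -> 'M[C]_(d, m)) :
  \sum_j (i == j)%:R *: f j = f i.
Proof. by rewrite -[RHS]delta_sum; apply: eq_bigr => j _; rewrite eq_sym. Qed.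

Lemma umat_isometry d n1 n2 (f : 'I_n2 -> 'I_n1 -> 'M[C]_d) :
  (umat f) ^t* *m umat f = 1%:M <->
  forall i j, \sum_k (f k i) ^t* *m f k j = (i == j)%:R%:M.
Proof.
have E j h : (umat f) ^t* *m umat f *m (ket R j *k h) =
    \sum_i ket R i *k ((\sum_k (f k i) ^t* *m f k j) *m h).
  rewrite -mulmxA umatE mulmx_sumr.
  under eq_bigr => k _ do rewrite umat_dagE.
  rewrite [LHS]exchange_big; apply: eq_bigr => i _ /=.
  by rewrite mulmx_suml tv_sumr; apply: eq_bigr => k _; rewrite mulmxA.
split=> [f1 i j|f1].
  apply: mx_cV_ext => h; have := E j h; rewrite f1 mul1mx.
  have -> : ket R j *k h = \sum_i ket R i *k ((i == j)%:R%:M *m h).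
    under eq_bigr => k _ do rewrite mul_scalar_mx tvZr.
    by rewrite delta_sum.
  by move/sum_kettv_inj => <-.
apply: mx_tv_ext => x h; rewrite [x]cV_ket tv_suml !mulmx_sumr.
apply: eq_bigr => j _; rewrite tvZl -!scalemxAr E mul1mx; congr (_ *: _).
by under eq_bigr => k _ do rewrite f1 mul_scalar_mx tvZr; rewrite delta_sum.
Qed.

Lemma umat_coisometry d n1 n2 (f : 'I_n2 -> 'I_n1 -> 'M[C]_d) :
  umat f *m (umat f) ^t* = 1%:M <->
  forall k l, \sum_i f k i *m (f l i) ^t* = (k == l)%:R%:M.
Proof.
have E l h : umat f *m (umat f) ^t* *m (h *k ket R l) =
    \sum_k ((\sum_i f k i *m (f l i) ^t*) *m h) *k ket R k.
  rewrite -mulmxA umat_dagE mulmx_sumr.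
  under eq_bigr => k _ do rewrite umatE.
  rewrite [LHS]exchange_big; apply: eq_bigr => i _ /=.
  by rewrite mulmx_suml tv_suml; apply: eq_bigr => k _; rewrite mulmxA.
split=> [f1 i j|f1].
  apply: mx_cV_ext => h; have := E j h; rewrite f1 mul1mx.
  have -> : h *k ket R j = \sum_i ((i == j)%:R%:M *m h) *k ket R i.
    under eq_bigr => k _ do rewrite mul_scalar_mx tvZl.
    by rewrite delta_sum.
  by move/sum_tvket_inj => <-.
apply: mx_tv_ext => h x; rewrite [x]cV_ket tv_sumr !mulmx_sumr.
apply: eq_bigr => j _; rewrite tvZr -!scalemxAr E mul1mx; congr (_ *: _).
by under eq_bigr => k _ do rewrite f1 mul_scalar_mx tvZl; rewrite delta_sum.
Qed.

End Operators.

Section UptOperators.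
Variable R : realType.
Local Notation C := R[i].
Variable A : hopfStarAlg R.

Definition uop (F1 F2 : functorData A) (a : uptData F1 F2) (X : corep A)
    (k : 'I_(F2 X)) (i : 'I_(F1 X)) : 'M[C]_a :=
  \matrix_(p, q) ucomp a X (mxtens_index (p, k)) (mxtens_index (i, q)).

Lemma ucomp_umat (F1 F2 : functorData A) (a : uptData F1 F2) X : ucomp a X = umat (@uop F1 F2 a X).
Proof.
apply/matrixP => x y; rewrite !mxE.
by case: (mxtens_indexP x) => p k; case: (mxtens_indexP y) => i q; rewrite !mxtens_indexK.
Qed.

Lemma uop_eq (F1 F2 : functorData A) (a : uptData F1 F2) X f :
  ucomp a X = umat f -> forall k i, uop a k i = f k i.
Proof. by rewrite ucomp_umat => /umat_inj. Qed.

(** The axioms of a transformation as identities between its operators, in which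
    neither bracketings nor casts occur. *)
Record upt_spec (F1 F2 : functorData A) (a : uptData F1 F2) : Prop := UptSpec {
  us_dim : (0 < a)%N;
  us_iso : forall X i j,
    \sum_k (@uop _ _ a X k i) ^t* *m uop a k j = (i == j)%:R%:M;
  us_coiso : forall X k l,
    \sum_i @uop _ _ a X k i *m (uop a l i) ^t* = (k == l)%:R%:M;
  us_nat : forall X Y (f : inter X Y) l i,
    \sum_k fmor F2 f l k *: @uop _ _ a X k i = \sum_j fmor F1 f j i *: @uop _ _ a Y l j;
  us_mul : forall X Y K i j,
    \sum_I fmul F1 X Y I (mxtens_index (i, j)) *: @uop _ _ a (tens_corep X Y) K I =
    \sum_k \sum_l fmul F2 X Y K (mxtens_index (k, l)) *: (uop a k i *m uop a l j);
  us_unit : forall K,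
    \sum_I funit F1 I 0 *: @uop _ _ a (unit_corep A) K I = (funit F2 K 0)%:M }.

Lemma is_uptP (F1 F2 : functorData A) (a : uptData F1 F2) : is_upt a <-> upt_spec a.
Proof.
have EN X Y (f : inter X Y) i h :
    (1%:M *t fmor F2 f) *m ucomp a X *m (ket R i *k h) =
    \sum_l ((\sum_k fmor F2 f l k *: uop a k i) *m h) *k ket R l.
  rewrite -mulmxA ucomp_umat umatE mulmx_sumr.
  under eq_bigr => k _ do rewrite tensmx_tv mul1mx [fmor F2 f *m _]cV_ket tv_sumr.
  rewrite [LHS]exchange_big; apply: eq_bigr => l _ /=.
  rewrite mulmx_suml tv_suml; apply: eq_bigr => k _.
  by rewrite mulmx_ket tvZr -scalemxAl tvZl.
have EN' X Y (f : inter X Y) i h :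
    ucomp a Y *m (fmor F1 f *t 1%:M) *m (ket R i *k h) =
    \sum_l ((\sum_j fmor F1 f j i *: uop a l j) *m h) *k ket R l.
  rewrite -mulmxA tensmx_tv mul1mx [fmor F1 f *m _]cV_ket tv_suml mulmx_sumr.
  under eq_bigr => k _ do rewrite mulmx_ket tvZl -scalemxAr ucomp_umat umatE scaler_sumr.
  rewrite [LHS]exchange_big; apply: eq_bigr => l _ /=.
  rewrite mulmx_suml tv_suml; apply: eq_bigr => k _.
  by rewrite -scalemxAl tvZl.
have EM X Y i j h : ucomp a (tens_corep X Y) *m (fmul F1 X Y *t 1%:M) *m
      (ket R i *k ket R j *k h) =
    \sum_K ((\sum_I fmul F1 X Y I (mxtens_index (i, j)) *: uop a K I) *m h) *k ket R K.
  rewrite -mulmxA tensmx_tv mul1mx -ket_tv [fmul F1 X Y *m _]cV_ket tv_suml mulmx_sumr.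
  under eq_bigr => I _ do rewrite mulmx_ket tvZl -scalemxAr ucomp_umat umatE scaler_sumr.
  rewrite [LHS]exchange_big; apply: eq_bigr => K _ /=.
  rewrite mulmx_suml tv_suml; apply: eq_bigr => k _.
  by rewrite -scalemxAl tvZl.
have EM' X Y (i : 'I_(F1 X)) (j : 'I_(F1 Y)) (h : 'cV_a) :
     (((1%:M : 'M[C]_a) *t fmul F2 X Y) \c (ucomp a X *t (1%:M : 'M[C]_(F2 Y)))
      \c ((1%:M : 'M[C]_(F1 X)) *t ucomp a Y) \c (1%:M : 'M[C]_(F1 X * F1 Y * a))) *m
       (ket R i *k ket R j *k h) =
    \sum_K ((\sum_k \sum_l fmul F2 X Y K (mxtens_index (k, l)) *:
        (uop a k i *m uop a l j)) *m h) *k ket R K.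
  rewrite !scompE mul1mx cast_tvA tensmx_tv mul1mx (ucomp_umat a Y) umatE tv_sumr cast_sum.
  under eq_bigr => l _ do rewrite cast_tvA'.
  rewrite mulmx_sumr.
  under eq_bigr => l _ do rewrite tensmx_tv mul1mx ucomp_umat umatE tv_suml.
  rewrite exchange_big /= cast_sum mulmx_sumr.
  transitivity (\sum_k \sum_l \sum_K fmul F2 X Y K (mxtens_index (k, l)) *:
      (uop a k i *m uop a l j *m h *k ket R K)).
    apply: eq_bigr => k _; rewrite cast_sum mulmx_sumr; apply: eq_bigr => l _.
    rewrite cast_tvA tensmx_tv mul1mx -ket_tv [fmul F2 X Y *m _]cV_ket tv_sumr.
    by apply: eq_bigr => K _; rewrite mulmx_ket tvZr mulmxA.
  under [LHS]eq_bigr => k _ do rewrite exchange_big.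
  rewrite [LHS]exchange_big; apply: eq_bigr => K _ /=.
  rewrite mulmx_suml tv_suml; apply: eq_bigr => k _.
  rewrite mulmx_suml tv_suml; apply: eq_bigr => l _.
  by rewrite -scalemxAl tvZl.
have EE (h : 'cV_a) : (ucomp a (unit_corep A) \c (funit F1 *t (1%:M : 'M[C]_a)) \c (1%:M : 'M[C]_a)) *m h =
    \sum_K ((\sum_I funit F1 I 0 *: @uop _ _ a (unit_corep A) K I) *m h) *k ket R K.
  rewrite !scompE mul1mx cast_1tvl tensmx_tv mul1mx mulmx1.
  rewrite castmx_id [funit F1]cV_ket tv_suml mulmx_sumr.
  under eq_bigr => k _ do rewrite tvZl -scalemxAr ucomp_umat umatE scaler_sumr.
  rewrite [LHS]exchange_big; apply: eq_bigr => l _ /=.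
  rewrite mulmx_suml tv_suml; apply: eq_bigr => k _.
  by rewrite -scalemxAl tvZl -cV_ket.
have EE' (h : 'cV_a) : (((1%:M : 'M[C]_a) *t funit F2) \c (1%:M : 'M[C]_a)) *m h =
    \sum_K ((funit F2 K 0)%:M *m h) *k ket R K.
  rewrite !scompE mul1mx cast_1tvr tensmx_tv mul1mx mulmx1 {1}[funit F2]cV_ket tv_sumr.
  by apply: eq_bigr => K _; rewrite tvZr mul_scalar_mx tvZl.
split=> [[d0 U N M E]|[d0 U1 U2 N M E]].
  split=> //.
  - by move=> X; apply/umat_isometry; rewrite -ucomp_umat; case: (U X).
  - by move=> X; apply/umat_coisometry; rewrite -ucomp_umat; case: (U X).
  - move=> X Y f l i; apply: mx_cV_ext => h.
    by have /(congr1 (mulmx^~ (ket R i *k h))) := N X Y f; rewrite EN EN' => /sum_tvket_inj.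
  - move=> X Y K i j; apply: mx_cV_ext => h.
    have /(congr1 (mulmx^~ (ket R i *k ket R j *k h))) := M X Y.
    by rewrite EM EM' => /sum_tvket_inj.
  - move=> K; apply: mx_cV_ext => h.
    by have /(congr1 (mulmx^~ h)) := E; rewrite EE EE' => /sum_tvket_inj.
have kext m n p (f g : 'M[C]_(p, m * n)) :
    (forall i h, f *m (ket R i *k h) = g *m (ket R i *k h)) -> f = g.
  by move=> fg; apply: mx_ket_ext => k; case: (mxtens_indexP k) => i j; rewrite ket_tv.
split=> //.
- by move=> X; rewrite ucomp_umat; split; [apply/umat_isometry|apply/umat_coisometry].
- by move=> X Y f; apply: kext => i h; rewrite EN EN'; apply: eq_bigr => l _; rewrite N.
- move=> X Y; apply: kext => ij h; case: (mxtens_indexP ij) => i j.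
  by rewrite ket_tv EM EM'; apply: eq_bigr => l _; rewrite M.
- by apply: mx_cV_ext => h; rewrite EE EE'; apply: eq_bigr => l _; rewrite E.
Qed.

Lemma is_modificationP (F1 F2 : functorData A) (a b : uptData F1 F2) (f : 'M[C]_(b, a)) :
  is_modification f <->
  forall X k i, f *m @uop _ _ a X k i = @uop _ _ b X k i *m f.
Proof.
have E X i h : (f *t (1%:M : 'M[C]_(F2 X))) *m ucomp a X *m (ket R i *k h) =
    \sum_k (f *m uop a k i *m h) *k ket R k.
  rewrite -mulmxA ucomp_umat umatE mulmx_sumr.
  by apply: eq_bigr => k _; rewrite tensmx_tv mul1mx mulmxA.
have E' X i h : ucomp b X *m ((1%:M : 'M[C]_(F1 X)) *t f) *m (ket R i *k h) =
    \sum_k (uop b k i *m f *m h) *k ket R k.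
  rewrite -mulmxA tensmx_tv mul1mx ucomp_umat umatE.
  by apply: eq_bigr => k _; rewrite mulmxA.
split=> fm X.
  move=> k i; apply: mx_cV_ext => h.
  by have /(congr1 (mulmx^~ (ket R i *k h))) := fm X; rewrite E E' => /sum_tvket_inj.
apply: mx_ket_ext => k; case: (mxtens_indexP k) => i j; rewrite ket_tv E E'.
by apply: eq_bigr => l _; rewrite fm.
Qed.

Lemma uop_comp (F1 F2 F3 : functorData A) (a : uptData F1 F2) (b : uptData F2 F3) X k i :
  @uop _ _ (upt_comp a b) X k i = \sum_j @uop _ _ a X j i *t @uop _ _ b X k j.
Proof.
apply: (@uop_eq _ _ (upt_comp a b) X (fun k i => \sum_j uop a j i *t uop b k j)) => {k i}.
apply: mx_ket_ext => ij; case: (mxtens_indexP ij) => i pq.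
case: (mxtens_indexP pq) => p q; rewrite !ket_tv umatE /= !scompE !mul1mx.
rewrite cast_tvA' tensmx_tv mul1mx (ucomp_umat a) umatE tv_suml cast_sum mulmx_sumr cast_sum.
under [RHS]eq_bigr => k _ do rewrite mulmx_suml tv_suml.
rewrite [RHS]exchange_big; apply: eq_bigr => j _ /=.
rewrite cast_tvA tensmx_tv mul1mx ucomp_umat umatE tv_sumr cast_sum.
by apply: eq_bigr => k _; rewrite cast_tvA' tensmx_tv.
Qed.

(** The cup and the cap transpose, and the adjoint transposes and conjugates; what
    is left is the entrywise conjugate. *)
Lemma uop_dual (F1 F2 : functorData A) (b : uptData F1 F2) X i k :
  @uop _ _ (upt_dual b) X i k = map_mx Num.conj (@uop _ _ b X k i).
Proof.
apply: (@uop_eq _ _ (upt_dual b) X (fun i k => map_mx Num.conj (uop b k i))) => {k i}.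
apply: mx_ket_ext => ij; case: (mxtens_indexP ij) => k q.
rewrite !ket_tv umatE /= !scompE !mul1mx cast_1tvl tensmx_tv mul1mx coevE.
rewrite mxE scale1r tv_suml cast_sum.
under [in LHS]eq_bigr => c _ do rewrite cast_tv_mid.
rewrite mulmx_sumr cast_sum mulmx_sumr cast_sum.
transitivity (\sum_c \sum_i (uop b k i c q)^* *: (ket R c *k ket R i)).
  apply: eq_bigr => c _.
  rewrite !tensmx_tv !mul1mx ucomp_umat umat_dagE tv_sumr tv_suml cast_sum mulmx_sumr cast_sum.
  apply: eq_bigr => i _.
  rewrite cast_tv_mid' tensmx_tv mul1mx ev_tv cast_tv1r mxE eqxx mulr1n; congr (_ *: _).
  rewrite (bigD1 q) //= big1 => [|p /negPf pq]; last by rewrite ketE pq mulr0.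
  by rewrite ketE eqxx mulr1 addr0 mulmx_ket dagE.
rewrite exchange_big; apply: eq_bigr => i _ /=.
rewrite [map_mx _ _ *m _]cV_ket tv_suml; apply: eq_bigr => c _.
by rewrite tvZl mulmx_ket; congr (_ *: _); rewrite [RHS]mxE.

Qed.

Lemma uop_id (F0 : functorData A) X k i :
  @uop _ _ (upt_id F0) X k i = (k == i)%:R%:M.
Proof.
apply: (@uop_eq _ _ (upt_id F0) X (fun k i => (k == i)%:R%:M)) => {k i}.
apply: mx_ket_ext => ij; case: (mxtens_indexP ij) => k q.
rewrite !ket_tv umatE /= !scompE !mul1mx cast_tv_swap1 !ord1.
under [in RHS]eq_bigr => i _ do rewrite mul_scalar_mx tvZl.
by rewrite delta_sum.
Qed.

Lemma uop_iso (F1 F2 : functorData A) (E : forall X, 'M[C]_(F2 X, F1 X)) X k i :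
  @uop _ _ (upt_of_iso E) X k i = (E X k i)%:M.
Proof.
apply: (@uop_eq _ _ (upt_of_iso E) X (fun k i => (E X k i)%:M)) => {k i}.
apply: mx_ket_ext => ij; case: (mxtens_indexP ij) => k q.
rewrite !ket_tv umatE /= !scompE !mul1mx cast_tv1r cast_1tvl !ord1.
rewrite ketE eqxx scale1r [E X *m _]cV_ket tv_sumr.
apply: eq_bigr => i _; rewrite mul_scalar_mx tvZl tvZr mulmx_ket; congr (_ *: (_ *k _)).
by apply/colP => j; rewrite !ord1 !mxE.
Qed.

Lemma mod_comp (F1 F2 : functorData A) (a b c : uptData F1 F2) (f : 'M[C]_(b, a)) (g : 'M[C]_(c, b)) :
  is_modification f -> is_modification g -> @is_modification _ _ _ _ a c (g *m f).
Proof.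
move=> /is_modificationP fM /is_modificationP gM; apply/is_modificationP => X k i.
by rewrite -mulmxA fM !mulmxA gM.
Qed.

Lemma mod_scale (F1 F2 : functorData A) (a b : uptData F1 F2) (f : 'M[C]_(b, a)) c :
  is_modification f -> @is_modification _ _ _ _ a b (c *: f).
Proof.
move=> /is_modificationP fM; apply/is_modificationP => X k i.
by rewrite -scalemxAl fM scalemxAr.
Qed.

Lemma mod_id (F1 F2 : functorData A) (a : uptData F1 F2) : @is_modification _ _ _ _ a a 1%:M.
Proof. by apply/is_modificationP => X k i; rewrite mulmx1 mul1mx. Qed.

Lemma mod_tens (F1 F2 F3 : functorData A) (a b : uptData F1 F2) (c d : uptData F2 F3)
    (f : 'M[C]_(b, a)) (g : 'M[C]_(d, c)) :
  is_modification f -> is_modification g ->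
  @is_modification _ _ _ _ (upt_comp a c) (upt_comp b d) (f *t g).
Proof.
move=> /is_modificationP fM /is_modificationP gM; apply/is_modificationP => X k i.
rewrite !uop_comp mulmx_sumr mulmx_suml; apply: eq_bigr => j _.
by rewrite !tensmx_mul fM gM.
Qed.

(** As the components are unitary, the intertwining relation can be turned around. *)
Lemma mod_dag (F1 F2 : functorData A) (a b : uptData F1 F2) (f : 'M[C]_(b, a)) :
  (forall X, unitary (ucomp a X)) -> (forall X, unitary (ucomp b X)) ->
  is_modification f -> @is_modification _ _ _ _ b a (f ^t*).
Proof.
move=> Ua Ub fm X; have /(congr1 (fun M => M ^t*)) := fm X.
rewrite !dagM !dag_tens !dag1 => E.
rewrite -[LHS]mul1mx -(proj2 (Ua X)) -!mulmxA [(ucomp a X)^t* *m _]mulmxA E.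
by rewrite -!mulmxA (proj1 (Ub X)) mulmx1.
Qed.

End UptOperators.

(** * Linear functionals and the trace form *)

Section Separation.
Variables (K : fieldType) (V : lmodType K).

Definition lin_fun (w : V -> K) := forall a x y, w (a *: x + y) = a * w x + w y.

Definition lin_closed (M : V -> Prop) :=
  M 0 /\ forall (a : K) x y, M x -> M y -> M (a *: x + y).

(** Zorn's lemma gives a maximal subspace avoiding x.  Modulo that subspace every
    vector is a unique multiple of x, and w reads off the multiple. *)
Lemma exists_separating (x : V) : x != 0 -> exists2 w, lin_fun w & w x = 1.
Proof.
move=> x0.
(* 0 is added by hand so that the union of the empty chain is admissible *)
pose P (S : set V) := lin_closed (fun v => v = 0 \/ S v) /\ ~ S x.
have [F FP Ftot|S [[[S0 Slin] Sx] Smax]] := @Zorn_bigcup V P.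
  split; last by case=> X FX; exact: (FP X FX).2.
  split=> [|a u v]; first by left.
  case=> [->|[X FX Xu]]; case=> [->|[Y FY Yv]].
  - by left; rewrite scaler0 addr0.
  - by right; exists Y => //; rewrite scaler0 add0r.
  - case: ((FP X FX).1.2 a u 0 (or_intror Xu) (or_introl erefl)) => [->|?]; first by left.
    by right; exists X.
  have [XY|YX] := Ftot X Y FX FY.
    case: ((FP Y FY).1.2 a u v (or_intror (XY _ Xu)) (or_intror Yv)) => [->|?]; first by left.
    by right; exists Y.
  case: ((FP X FX).1.2 a u v (or_intror Xu) (or_intror (YX _ Yv))) => [->|?]; first by left.
  by right; exists X.
pose M v := v = 0 \/ S v.
have Mlin a u v : M u -> M v -> M (a *: u + v) by exact: Slin.
have M0 : M 0 by left.
have MZ a u : M u -> M (a *: u) by move=> Mu; rewrite -[_ *: _]addr0; exact: Mlin.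
have MD u v : M u -> M v -> M (u + v) by move=> Mu Mv; rewrite -[u]scale1r; exact: Mlin.
have MB u v : M u -> M v -> M (u - v).
  by move=> Mu Mv; rewrite -scaleN1r addrC; exact: Mlin.
have Mx : ~ M x by case=> [/eqP|//]; rewrite (negPf x0).
have ex y : exists c, M (y - c *: x).
  have [My|nMy] := pselect (M y); first by exists 0; rewrite scale0r subr0.
  pose S' := [set v | exists c u, M u /\ v = u + c *: y]%classic.
  have SS' : (S `<` S')%classic.
    split=> [v Sv|sub]; first by exists 0, v; split; [right|rewrite scale0r addr0].
    by apply: nMy; right; apply: sub; exists 1, 0; split => //; rewrite add0r scale1r.
  have S'x : S' x.
    apply: contrapT => nS'x; apply: (Smax _ SS'); split => //; split=> [|a u v]; first by left.
    have S'0 u' : u' = 0 \/ S' u' -> S' u'.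
      by case=> // ->; exists 0, 0; split => //; rewrite scale0r addr0.
    move=> /S'0[c [u' [Mu' ->]]] /S'0[d [v' [Mv' ->]]]; right.
    exists (a * c + d), (a *: u' + v'); split; first exact: Mlin.
    by rewrite scalerDl scalerDr scalerA addrACA.
  case: S'x => c [u [Mu xE]].
  have c0 : c != 0.
    by apply: contra_notN Mx => /eqP c0; rewrite xE c0 scale0r addr0.
  exists c^-1; rewrite {1}xE scalerDr scalerA mulVf // scale1r.
  rewrite opprD addrA addrAC subrr.
  by apply: MB => //; exact: MZ.
have [w wP] := choice ex.
have wu y c : M (y - c *: x) -> w y = c.
  move=> Mc; apply/eqP; apply: contraPT (wP y) => wc Mw.
  apply: Mx; have := MB _ _ Mc Mw.
  rewrite opprB addrC addrA subrK -scalerBl => /(MZ (w y - c)^-1).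
  by rewrite scalerA mulVf ?subr_eq0 // scale1r.
exists w => [a u v|]; last by apply: wu; rewrite scale1r subrr.
apply: wu; have := Mlin a _ _ (wP u) (wP v).
by rewrite scalerBr scalerA addrACA -opprD -scalerDl.
Qed.

Lemma lin_fun_sep (x y : V) : (forall w, lin_fun w -> w x = w y) -> x = y.
Proof.
move=> xy; apply/eqP; rewrite -subr_eq0; apply: contraT => /exists_separating[w wl].
have -> : x - y = (-1) *: y + x by rewrite scaleN1r addrC.
by rewrite wl (xy w wl) mulN1r addNr => /esym/eqP; rewrite oner_eq0.
Qed.

Lemma lin_fun0 w : lin_fun w -> w 0 = 0.
Proof.
move=> wl; have := wl 1 0 0; rewrite scaler0 addr0 mul1r => /eqP.
by rewrite -subr_eq subrr eq_sym => /eqP.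
Qed.

Lemma lin_funD w x y : lin_fun w -> w (x + y) = w x + w y.
Proof. by move=> wl; rewrite -[x]scale1r wl mul1r scale1r. Qed.

Lemma lin_funZ w a x : lin_fun w -> w (a *: x) = a * w x.
Proof. by move=> wl; rewrite -[a *: x]addr0 wl lin_fun0 // addr0. Qed.

Lemma lin_fun_sum w (I : Type) (r : seq I) P f : lin_fun w ->
  w (\sum_(i <- r | P i) f i) = \sum_(i <- r | P i) w (f i).
Proof. by move=> wl; elim/big_rec2: _ => [|i a b _ <-]; rewrite ?lin_fun0 ?lin_funD. Qed.

End Separation.

Section Riesz.
Variable R : realType.
Local Notation C := R[i].

(** A subspace of row vectors that is only given as a predicate is spanned by a
    maximal independent family in it. *)
Lemma subspace_rows N (B : 'rV[C]_N -> Prop) :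
  (forall (a : C) x y, B x -> B y -> B (a *: x + y)) -> B 0 ->
  exists k (G : 'M[C]_(k, N)), (forall i, B (row i G)) /\
    forall b, B b -> (b <= G)%MS.
Proof.
move=> Blin B0.
pose Q k := `[< exists G : 'M[C]_(k, N), row_free G /\ forall i, B (row i G) >].
have Q0 : exists k, Q k.
  exists 0%N; apply/asboolP; exists 0; split; last by case.
  by rewrite /row_free mxrank0.
have Qb k : Q k -> (k <= N)%N.
  by move=> /asboolP[G [/eqP rG _]]; rewrite -rG rank_leq_col.
case: (ex_maxnP Q0 Qb) => k /asboolP[G [Gf GB]] kmax.
exists k, G; split=> // b Bb; apply: contraT => bG.
have : Q (k + 1)%N.
  apply/asboolP; exists (col_mx G b); split=> [|i].
    have lt : (G < G + b)%MS.
      by rewrite ltmxE addsmxSl /= addsmx_sub submx_refl.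
    rewrite /row_free -addsmxE eqn_leq; apply/andP; split.
      by rewrite addsmxE rank_leq_row.
    by have := rank_ltmx lt; rewrite addn1 (eqP Gf).
  case: (splitP i) => j ij.
    by have -> : i = lshift 1 j; [exact: val_inj|rewrite rowKu].
  have -> : i = rshift k j; first exact: val_inj.
  by rewrite rowKd row_id.
by move/kmax; rewrite addn1 ltnn.
Qed.

Lemma mxtrace_vec m (g b : 'M[C]_m) : \tr (g *m b) = (mxvec b *m (mxvec (g ^t*)) ^t*) 0 0.
Proof.
rewrite mxE (reindex _ (curry_mxvec_bij _ _)) /= /mxtrace.
transitivity (\sum_i \sum_j b i j * g j i).
  rewrite exchange_big; apply: eq_bigr => i _; rewrite mxE.
  by apply: eq_bigr => j _; rewrite mulrC.
rewrite pair_big; apply: eq_bigr => -[i j] _ /=.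
by rewrite !mxvecE dagE mxvecE dagE conjCK.
Qed.

(** Project the functional orthogonally onto B for the trace form; stability under
    adjoints puts the representing matrix in B. *)
Lemma riesz m (B : 'M[C]_m -> Prop) (h : 'M[C]_m) :
  (forall (a : C) x y, B x -> B y -> B (a *: x + y)) -> B 0 ->
  (forall x, B x -> B (x ^t*)) ->
  exists2 g, B g & forall b, B b -> \tr (g *m b) = \tr (h *m b).
Proof.
move=> Blin B0 Bdag.
have [||k [G [GB Gb]]] := @subspace_rows (m * m) (fun v => B (vec_mx v)).
- by move=> a x y Bx By; rewrite linearP; exact: Blin.
- by rewrite linear0.
pose y := mxvec (h ^t*); pose y1 := y *m proj_ortho G.
have By1 : B (vec_mx y1).
  have /submxP[D ->] : (y1 <= G)%MS by exact: proj_ortho_sub.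
  rewrite mulmx_sum_row linear_sum; elim/big_rec: _ => // i x _ Bx.
  by rewrite linearZ; apply: Blin => //; exact: GB.
exists ((vec_mx y1)^t*); first exact: Bdag.
move=> b Bb; rewrite !mxtrace_vec trmxCK vec_mxK -/y.
have /submxP[D ->] : (mxvec b <= G)%MS by apply: Gb; rewrite mxvecK.
have /orthomx1P := proj_ortho_compl_sub G y.
rewrite -/y1 => /(congr1 (fun M => M ^t*)); rewrite dagM trmxCK dagB mulmxBr.
rewrite trmx0 map_mx0 => /eqP; rewrite subr_eq0 => /eqP E.
by rewrite -!mulmxA E.
Qed.

End Riesz.

(** * Conjugates of unitary corepresentations *)

Section DirectSum.
Variable R : realType.
Local Notation C := R[i].
Variable A : hopfStarAlg R.
Implicit Types V W : corep A.

Lemma linear_0 (U L : lmodType C) (f : U -> L) : linear f -> f 0 = 0.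
Proof.
move=> fl; have := fl 1 0 0; rewrite scaler0 addr0 scale1r => /eqP.
by rewrite -subr_eq subrr eq_sym => /eqP.
Qed.

Lemma comul0 : tensor2_eq (comul (0 : A)) [::].
Proof.
move=> L b linr linl; have := @comul_linear _ A 1 0 0 L b linr linl.
rewrite scaler0 addr0 big_cat big_map /= big_nil.
have -> : \sum_(p <- comul (0 : A)) b (1 *: p.1) p.2 = \sum_(p <- comul (0 : A)) b p.1 p.2.
  by apply: eq_bigr => p _; rewrite scale1r.
by move/eqP; rewrite -subr_eq subrr eq_sym => /eqP.
Qed.

(** Direct sums put the coefficients of two corepresentations into the coefficient
    space of one. *)
Definition dsum_mx V W : 'M[A]_(cdim V + cdim W) := block_mx V 0 0 W.

Lemma star_mx0 m n : star_mx (0 : 'M[A]_(m, n)) = 0.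
Proof. by apply/matrixP => i j; rewrite !mxE star0. Qed.

Lemma star_dsum V W :
  star_mx (dsum_mx V W) = block_mx (star_mx V) 0 0 (star_mx W).
Proof.
by rewrite /star_mx map_block_mx tr_block_mx -!/(star_mx _) !star_mx0.
Qed.

Fact dsum_comul V W i j :
  tensor2_eq (comul (dsum_mx V W i j))
    [seq (dsum_mx V W i k, dsum_mx V W k j) | k <- enum 'I_(cdim V + cdim W)].
Proof.
move=> L b linr linl; rewrite big_map big_enum big_split_ord /=.
have b0 x : b x 0 = 0 by exact: linear_0.
have b0' x : b 0 x = 0 by apply: (linear_0 (f := b^~ x)).
case: (split_ordP i) => i' ->; case: (split_ordP j) => j' ->.
- rewrite block_mxEul (cmx_comul _ _ linr linl) big_map big_enum /=.
  rewrite [X in _ = _ + X]big1 ?addr0 => [|k _]; last by rewrite block_mxEur mxE b0'.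
  by apply: eq_bigr => k _; rewrite !block_mxEul.
- rewrite block_mxEur mxE (comul0 linr linl) big_nil !big1 ?addr0 // => k _.
    by rewrite block_mxEur mxE b0'.
  by rewrite block_mxEur block_mxEul !mxE b0.
- rewrite block_mxEdl mxE (comul0 linr linl) big_nil !big1 ?addr0 // => k _.
    by rewrite block_mxEdl block_mxEdr !mxE b0.
  by rewrite block_mxEdl mxE b0'.
- rewrite block_mxEdr (cmx_comul _ _ linr linl) big_map big_enum /=.
  rewrite [X in _ = X + _]big1 ?add0r => [|k _]; last by rewrite block_mxEdl mxE b0'.
  by apply: eq_bigr => k _; rewrite !block_mxEdr.
Qed.

Fact dsum_counit V W i j : counit A (dsum_mx V W i j) = (i == j)%:R.
Proof.
case: (split_ordP i) => i' ->; case: (split_ordP j) => j' ->.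
- by rewrite block_mxEul cmx_counit (inj_eq (@lshift_inj _ _)).
- by rewrite block_mxEur mxE raddf0 eq_lrshift.
- by rewrite block_mxEdl mxE raddf0 eq_rlshift.
- by rewrite block_mxEdr cmx_counit (inj_eq (@rshift_inj _ _)).
Qed.

Fact dsum_unitaryl V W : star_mx (dsum_mx V W) *m dsum_mx V W = 1%:M.
Proof.
rewrite star_dsum mulmx_block !mul0mx !mulmx0 !addr0 !add0r.
by rewrite !cmx_unitaryl -scalar_mx_block.
Qed.

Fact dsum_unitaryr V W : dsum_mx V W *m star_mx (dsum_mx V W) = 1%:M.
Proof.
rewrite star_dsum mulmx_block !mul0mx !mulmx0 !addr0 !add0r.
by rewrite !cmx_unitaryr -scalar_mx_block.
Qed.

Definition dsum_corep V W : corep A :=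
  Corep (@dsum_comul V W) (@dsum_counit V W) (dsum_unitaryl V W) (dsum_unitaryr V W).

Definition coef_of W (x : A) := exists f : 'M[C]_(cdim W), x = \sum_i \sum_j f i j *: W i j.

Lemma coef_dsuml V W x : coef_of V x -> coef_of (dsum_corep V W) x.
Proof.
case=> f ->; exists (block_mx f 0 0 0); rewrite big_split_ord /= [X in _ + X]big1 ?addr0.
  apply: eq_bigr => i _; rewrite big_split_ord /= [X in _ + X]big1 ?addr0.
    by apply: eq_bigr => j _; rewrite !block_mxEul.
  by move=> j _; rewrite !block_mxEur mxE scale0r.
move=> i _; rewrite big_split_ord /= !big1 ?addr0 // => j _.
  by rewrite block_mxEdr mxE scale0r.
by rewrite block_mxEdl mxE scale0r.
Qed.

Lemma coef_dsumr V W x : coef_of W x -> coef_of (dsum_corep V W) x.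
Proof.
case=> f ->; exists (block_mx 0 0 0 f); rewrite big_split_ord /= [X in X + _]big1 ?add0r.
  apply: eq_bigr => i _; rewrite big_split_ord /= [X in X + _]big1 ?add0r.
    by apply: eq_bigr => j _; rewrite !block_mxEdr.
  by move=> j _; rewrite !block_mxEdl mxE scale0r.
move=> i _; rewrite big_split_ord /= !big1 ?addr0 // => j _.
  by rewrite block_mxEur mxE scale0r.
by rewrite block_mxEul mxE scale0r.
Qed.

Lemma coef_lin W a x y : coef_of W x -> coef_of W y -> coef_of W (a *: x + y).
Proof.
case=> f -> [g ->]; exists (a *: f + g); rewrite scaler_sumr -big_split.
apply: eq_bigr => i _ /=; rewrite scaler_sumr -big_split.
by apply: eq_bigr => j _ /=; rewrite !mxE scalerDl scalerA.
Qed.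

Lemma coef_tens V W x y : coef_of V x -> coef_of W y -> coef_of (tens_corep V W) (x * y).
Proof.
case=> f -> [g ->]; exists (f *t g); rewrite [RHS]sum_mxtens mulr_suml.
apply: eq_bigr => i _; rewrite mulr_sumr; apply: eq_bigr => k _.
rewrite [RHS]sum_mxtens mulr_suml; apply: eq_bigr => j _; rewrite mulr_sumr.
by apply: eq_bigr => l _; rewrite !tensmxE -scalerAl -scalerAr scalerA.
Qed.

Lemma coef_entry V i j : coef_of V (V i j).
Proof.
exists (delta_mx i j); rewrite (bigD1 i) //= [X in _ + X]big1 => [|k /negPf ki]; last first.
  by apply: big1 => l _; rewrite mxE ki scale0r.
rewrite (bigD1 j) //= [X in _ + X + _]big1 => [|k /negPf ki]; last first.
  by rewrite mxE ki andbF scale0r.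
by rewrite mxE !eqxx scale1r !addr0.
Qed.

(** Direct sums and tensor products turn sums and products of coefficients into
    coefficients, so that the coefficients already form a subalgebra. *)
Lemma cqg_coef (hA : is_cqg A) x : exists W, coef_of W x.
Proof.
apply: (hA (fun x => exists W, coef_of W x)) => {x}.
- exists (unit_corep A), 1%:M; rewrite !big_ord1.
  by rewrite !mxE scale1r.
- move=> a x y [V Vx] [W Wy]; exists (dsum_corep V W); apply: coef_lin.
    exact: coef_dsuml.
  exact: coef_dsumr.
- by move=> x y [V Vx] [W Wy]; exists (tens_corep V W); exact: coef_tens.
- by move=> V i j; exists V; exact: coef_entry.
Qed.

Lemma cqg_coefs (hA : is_cqg A) (I : finType) (x : I -> A) :
  exists W, forall i, coef_of W (x i).
Proof.
have [W Wx] : exists W, forall i, i \in enum I -> coef_of W (x i).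
  elim: (enum I) => [|i s [W Ws]]; first by exists (unit_corep A).
  have [V Vi] := cqg_coef hA (x i); exists (dsum_corep V W) => j.
  rewrite inE => /predU1P[->|/Ws]; [exact: coef_dsuml|exact: coef_dsumr].
by exists W => i; apply: Wx; rewrite mem_enum.
Qed.

End DirectSum.

Section Conjugate.
Variable R : realType.
Local Notation C := R[i].
Variable A : hopfStarAlg R.
Implicit Types V W : corep A.

Definition conv (w w' : A -> C) (x : A) : C := \sum_(p <- comul x) w p.1 * w' p.2.

Lemma conv_lin w w' : lin_fun w -> lin_fun w' -> lin_fun (conv w w').
Proof.
move=> wl wl' a x y; rewrite /conv.
have := @comul_linear _ A a x y C^o (fun s t => w s * w' t).
rewrite big_cat big_map /= => -> => [|s b u v|t b u v].
- rewrite mulr_sumr; congr (_ + _); apply: eq_bigr => p _.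
  by rewrite (lin_funZ _ _ wl) mulrA.
- by rewrite wl' mulrDr mulrCA.
- by rewrite wl mulrDl -mulrA.
Qed.

Lemma conv_cmx w w' W : lin_fun w -> lin_fun w' -> forall i j,
  conv w w' (W i j) = \sum_k w (W i k) * w' (W k j).
Proof.
move=> wl wl' i j; rewrite /conv.
have := @cmx_comul _ A W i j C^o (fun s t => w s * w' t).
rewrite big_map big_enum /= => -> // => [s b u v|t b u v].
- by rewrite wl' mulrDr mulrCA.
- by rewrite wl mulrDl -mulrA.
Qed.

Definition stfun (w : A -> C) (x : A) : C := (w (star x))^*.

Lemma stfun_lin w : lin_fun w -> lin_fun (stfun w).
Proof.
by move=> wl a x y; rewrite /stfun star_antilinear wl cjD cjM conjCK.
Qed.

(** Apply [conv_cmx] to the functionals [stfun w] and [stfun w']. *)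
Lemma conv_star w w' V : lin_fun w -> lin_fun w' -> forall i j,
  conv w w' (star (V i j)) = \sum_k w (star (V i k)) * w' (star (V k j)).
Proof.
move=> wl wl' i j; rewrite /conv.
have := @comul_star _ A (V i j) C^o (fun s t => w s * w' t).
rewrite big_map /= => -> => [|s b u v|t b u v].
- have := @conv_cmx _ _ V (stfun_lin wl) (stfun_lin wl') i j; rewrite /conv /stfun.
  move=> /(congr1 Num.conj); rewrite !cj_sum => E.
  transitivity (\sum_(p <- comul (V i j)) ((w (star p.1))^* * (w' (star p.2))^*)^*).
    by apply: eq_bigr => p _; rewrite cjM !conjCK.
  by rewrite E; apply: eq_bigr => k _; rewrite cjM !conjCK.
- by rewrite wl' mulrDr mulrCA.
- by rewrite wl mulrDl -mulrA.
Qed.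

Lemma counit_lin : lin_fun (fun x : A => counit A x : C).
Proof. by move=> a x y; rewrite linearP. Qed.

(** The antipode makes (S(W_ij)) a left inverse of W, and the two-sided inverse of
    the unitary W is its adjoint. *)
Lemma antipode_cmx W i j : antipode A (W i j) = star (W j i).
Proof.
pose SW := map_mx (antipode A) W.
have SWl : SW *m W = 1%:M.
  apply/matrixP => a b; rewrite !mxE.
  have E : \sum_(p <- comul (W a b)) antipode A p.1 * p.2 =
           \sum_k antipode A (W a k) * W k b.
    have := @cmx_comul _ A W a b A (fun s t => antipode A s * t).
    rewrite big_map big_enum /=; apply => [s c u v|t c u v].
      by rewrite mulrDr -scalerAr.
    by rewrite linearP mulrDl -scalerAl.
  transitivity (\sum_k antipode A (W a k) * W k b).
    by apply: eq_bigr => k _; rewrite mxE.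
  rewrite -E antipode_l cmx_counit.
  by case: eqP => _; rewrite ?scale1r ?scale0r.
have : SW = star_mx W.
  by rewrite -[LHS]mulmx1 -(cmx_unitaryr W) mulmxA SWl mul1mx.
by move/matrixP/(_ i j); rewrite !mxE.
Qed.

(** The involution of the convolution algebra: its value on a unitary W is the
    adjoint of the value of w on W. *)
Definition dagfun (w : A -> C) (x : A) : C := (w (star (antipode A x)))^*.

Lemma dagfun_lin w : lin_fun w -> lin_fun (dagfun w).
Proof.
by move=> wl a x y; rewrite /dagfun linearP star_antilinear wl cjD cjM conjCK.
Qed.

Lemma dagfun_cmx w W i j : dagfun w (W i j) = (w (W j i))^*.
Proof. by rewrite /dagfun antipode_cmx starK. Qed.

Definition conj_corep_mx V : 'M[A]_(cdim V) := map_mx (@star R A) V.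

Lemma counit_star V i j : counit A (star (V i j)) = (i == j)%:R :> C.
Proof.
have /matrixP/(_ j i) := cmx_unitaryr V; rewrite !mxE => /(congr1 (counit A)).
rewrite raddf_sum (bigD1 j) //= big1 => [|k /negPf kj].
  rewrite !mxE addr0 rmorphM /= cmx_counit eqxx mul1r => ->.
  by rewrite eq_sym; case: eqP => _; rewrite ?rmorph1 ?raddf0.
by rewrite rmorphM /= cmx_counit eq_sym kj mul0r.
Qed.

(** The images w(W) of the functionals w form a unital *-subalgebra B of the
    matrices, and w(W) |-> w(conj V) is a well defined representation of B once W
    contains the coefficients of conj V.  Its matrix coefficients are trace forms
    against elements g_ij of B, and the columns of the g_ij are the intertwiners. *)
Lemma conj_embedding (hA : is_cqg A) V :
  exists (W : corep A) (I : finType) (J : I -> 'M[C]_(cdim W, cdim V)),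
    (forall c, W *m scalar_to_alg A (J c) =
               scalar_to_alg A (J c) *m conj_corep_mx V) /\
    (forall x : 'cV_(cdim V), (forall c, J c *m x = 0) -> x = 0).
Proof.
have [W cW] := cqg_coefs hA (fun ij : 'I_(cdim V) * 'I_(cdim V) => star (V ij.1 ij.2)).
have [f fE] := choice cW.
set n := cdim V in f fE *; set m := cdim W in f fE *.
(* f expresses the coefficients of the conjugate of V through those of W *)
pose img w : 'M[C]_m := \matrix_(a, b) w (W a b).
pose B (b : 'M[C]_m) := exists2 w, lin_fun w & b = img w.
pose rho (b : 'M[C]_m) : 'M[C]_n := \matrix_(i, j) \sum_k \sum_l f (i, j) k l * b k l.
have rhoE w : lin_fun w -> forall i j, rho (img w) i j = w (star (V i j)).
  move=> wl i j; rewrite mxE (fE (i, j)) (lin_fun_sum _ _ _ wl).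
  apply: eq_bigr => k _; rewrite (lin_fun_sum _ _ _ wl); apply: eq_bigr => l _.
  by rewrite (lin_funZ _ _ wl) mxE.
have Blin (a : C) x y : B x -> B y -> B (a *: x + y).
  move=> [w wl ->] [w' wl' ->]; exists (fun z => a * w z + w' z).
    by move=> c u v; rewrite wl wl' !mulrDr addrACA mulrCA.
  by apply/matrixP => i j; rewrite !mxE.
have B0 : B 0.
  exists (fun=> 0) => [a x y|]; first by rewrite mulr0 addr0.
  by apply/matrixP => i j; rewrite !mxE.
have Bdag x : B x -> B (x ^t*).
  move=> [w wl ->]; exists (dagfun w); first exact: dagfun_lin.
  by apply/matrixP => i j; rewrite [RHS]mxE dagfun_cmx !mxE.
have B1 : B 1%:M.
  exists (fun x => counit A x : C); first exact: counit_lin.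
  by apply/matrixP => i j; rewrite !mxE cmx_counit.
have BM x y : B x -> B y -> B (x *m y) /\ rho (x *m y) = rho x *m rho y.
  move=> [w wl ->] [w' wl' ->]; have cl := conv_lin wl wl'.
  have E : img w *m img w' = img (conv w w').
    apply/matrixP => i j; rewrite !mxE conv_cmx //.
    by apply: eq_bigr => k _; rewrite !mxE.
  split; first by exists (conv w w').
  apply/matrixP => i j; rewrite E rhoE // conv_star // mxE.
  by apply: eq_bigr => k _; rewrite !rhoE.
have gP (ij : 'I_n * 'I_n) : exists g, B g /\
    forall b, B b -> \tr (g *m b) = rho b ij.1 ij.2.
  have [g Bg gE] := riesz (f ij)^T Blin B0 Bdag.
  exists g; split=> // b Bb; rewrite gE // mxE /mxtrace exchange_big.
  apply: eq_bigr => l _; rewrite mxE; apply: eq_bigr => k _.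
  by rewrite mxE; case: (ij) => i j.
have [g gP'] := choice gP.
(* the columns with index a of g_i1, ..., g_in form one intertwiner *)
pose J (ia : 'I_n * 'I_m) : 'M[C]_(m, n) := \matrix_(b, j) g (ia.1, j) b ia.2.
exists W, ('I_n * 'I_m)%type, J; split=> [[i a]|x xJ]; last first.
  apply/colP => i; rewrite [RHS]mxE.
  have E : \sum_j x j 0 *: g (i, j) = 0.
    apply/matrixP => b a; have /colP/(_ b) := xJ (i, a); rewrite !mxE => E.
    by rewrite summxE -[RHS]E; apply: eq_bigr => j _; rewrite !mxE mulrC.
  have /(congr1 (fun M => \tr (M *m 1%:M))) := E.
  rewrite mul0mx mxtrace0 mulmx_suml raddf_sum /= => <-.
  rewrite (bigD1 i) //= big1 => [|j /negPf ji].
    rewrite -scalemxAl mxtraceZ (gP' (i, i)).2 // -[1%:M](_ : img (counit A) = _).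
      by rewrite rhoE ?counit_star ?eqxx ?mulr1 ?addr0 //; exact: counit_lin.
    by apply/matrixP => k l; rewrite !mxE cmx_counit.
  rewrite -scalemxAl mxtraceZ (gP' (i, j)).2 // -[1%:M](_ : img (counit A) = _).
    by rewrite rhoE ?counit_star 1?eq_sym ?ji ?mulr0 //; exact: counit_lin.
  by apply/matrixP => k l; rewrite !mxE cmx_counit.
apply/matrixP => b j; apply: lin_fun_sep => w wl.
rewrite !mxE !(lin_fun_sum _ _ _ wl).
have Bw : B (img w) by exists w.
(* both sides are in B and have the same pairing with B *)
have key : img w *m g (i, j) = \sum_k rho (img w) k j *: g (i, k).
  set h1 := LHS; set h2 := RHS.
  have Bh : B (h1 - h2).
    rewrite -scaleN1r addrC; apply: (Blin); last exact: (BM _ _ Bw (gP' (i, j)).1).1.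
    rewrite /h2; elim/big_rec: _ => // k y _ By; apply: Blin => //.
    exact: (gP' (i, k)).1.
  have h0 c : B c -> \tr ((h1 - h2) *m c) = 0.
    move=> Bc; rewrite mulmxBl raddfB /= /h1 -mulmxA mxtrace_mulC -mulmxA.
    have [BcM rcM] := BM _ _ Bc Bw.
    rewrite (gP' (i, j)).2 // rcM /h2 mulmx_suml mxtrace_sum.
    have -> : (rho c *m rho (img w)) i j = \sum_k rho c i k * rho (img w) k j.
      by rewrite mxE.
    apply/eqP; rewrite subr_eq0; apply/eqP; apply: eq_bigr => k _.
    by rewrite -scalemxAl mxtraceZ (gP' (i, k)).2 // mulrC.
  apply/eqP; rewrite -subr_eq0; apply/eqP.
  rewrite -[LHS]trmxCK (@tr_eq0 _ _ _ ((h1 - h2) ^t*)) ?trmx0 ?map_mx0 //.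
  by rewrite trmxCK; apply: h0; exact: Bdag.
have /matrixP/(_ b a) := key; rewrite mxE summxE => E.
transitivity (\sum_k img w b k * g (i, j) k a).
  apply: eq_bigr => k _; rewrite !mxE -scalerAr mulr1 (lin_funZ _ _ wl) mulrC //.
rewrite E; apply: eq_bigr => k _.
by rewrite !mxE -scalerAl mul1r (lin_funZ _ _ wl) -rhoE // !mxE mulrC.
Qed.

End Conjugate.

(** * Block matrices of operators *)

Section BlockMatrices.
Variable R : realType.
Local Notation C := R[i].
Local Notation id_ n := (1%:M : 'M[C]_n).

(** The block matrix of a matrix of operators; products of matrices of operators
    become products of matrices. *)
Definition bmx d n m (f : 'I_n -> 'I_m -> 'M[C]_d) : 'M[C]_(n * d, m * d) :=
  \matrix_(x, y) f (mxtens_unindex x).1 (mxtens_unindex y).1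
                   (mxtens_unindex x).2 (mxtens_unindex y).2.

Lemma bmxE d n m (f : 'I_n -> 'I_m -> 'M[C]_d) k i p q :
  bmx f (mxtens_index (k, p)) (mxtens_index (i, q)) = f k i p q.
Proof. by rewrite mxE !mxtens_indexK. Qed.

Lemma bmx_inj d n m (f g : 'I_n -> 'I_m -> 'M[C]_d) :
  bmx f = bmx g -> forall k i, f k i = g k i.
Proof. by move=> fg k i; apply/matrixP => p q; rewrite -!bmxE fg. Qed.

Lemma bmx_ext d n m (f g : 'I_n -> 'I_m -> 'M[C]_d) :
  (forall k i, f k i = g k i) -> bmx f = bmx g.
Proof. by move=> fg; apply/matrixP => x y; rewrite !mxE fg. Qed.

Lemma bmxM d n m r (f : 'I_n -> 'I_m -> 'M[C]_d) (g : 'I_m -> 'I_r -> 'M[C]_d) :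
  bmx f *m bmx g = bmx (fun k i => \sum_j f k j *m g j i).
Proof.
apply/matrixP => x y; case: (mxtens_indexP x) => k p; case: (mxtens_indexP y) => i q.
rewrite bmxE mxE sum_mxtens summxE; apply: eq_bigr => j _; rewrite mxE.
by apply: eq_bigr => s _; rewrite !bmxE.
Qed.

Lemma bmx_dag d n m (f : 'I_n -> 'I_m -> 'M[C]_d) :
  (bmx f) ^t* = bmx (fun i k => (f k i) ^t*).
Proof. by apply/matrixP => x y; rewrite !mxE. Qed.

Lemma bmx_scalar d n m (P : 'M[C]_(n, m)) :
  P *t id_ d = bmx (fun k i => (P k i)%:M).
Proof. by apply/matrixP => x y; rewrite !mxE mulr_natr. Qed.

Lemma bmx1 d n : bmx (fun i j : 'I_n => (i == j)%:R%:M : 'M[C]_d) = 1%:M.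
Proof.
apply/matrixP => x y; case: (mxtens_indexP x) => k p; case: (mxtens_indexP y) => i q.
by rewrite bmxE one_tensE !mxE mulr_natr.
Qed.

Lemma mxtrace_bmx d n (f : 'I_n -> 'I_n -> 'M[C]_d) : \tr (bmx f) = \sum_k \tr (f k k).
Proof.
rewrite /mxtrace sum_mxtens; apply: eq_bigr => k _; apply: eq_bigr => p _.
by rewrite bmxE.
Qed.

Lemma mxtrace_tens n m (f : 'M[C]_n) (g : 'M[C]_m) : \tr (f *t g) = \tr f * \tr g.
Proof.
rewrite /mxtrace sum_mxtens mulr_suml; apply: eq_bigr => i _; rewrite mulr_sumr.
by apply: eq_bigr => j _; rewrite tensmxE.
Qed.

Lemma dag_tens1 d n m (P : 'M[C]_(n, m)) : (P *t id_ d) ^t* = P ^t* *t id_ d.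
Proof. by rewrite dag_tens dag1. Qed.

Lemma tens1M d n m r (P : 'M[C]_(n, m)) (Q : 'M[C]_(m, r)) :
  (P *t id_ d) *m (Q *t id_ d) = (P *m Q) *t id_ d.
Proof. by rewrite tensmx_mul mul1mx. Qed.

Section Twist.
Variables (d n m : nat) (a : 'I_n -> 'I_m -> 'M[C]_d).
Let ab := bmx (fun k i => (a k i) ^t*).

Lemma twist_tracer (X : 'M[C]_m) :
  (forall i j, \sum_k (a k i) ^t* *m a k j = (i == j)%:R%:M) ->
  \tr (ab *m (X *t id_ d) *m ab ^t*) = d%:R * \tr X.
Proof.
move=> a1; rewrite bmx_scalar !bmx_dag !bmxM mxtrace_bmx.
transitivity (\sum_i \sum_j X i j * \tr (\sum_k (a k i) ^t* *m a k j)).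
  transitivity (\sum_k \sum_i \sum_j X i j * \tr ((a k i) ^t* *m a k j)).
    apply: eq_bigr => k _; rewrite mxtrace_sum [RHS]exchange_big; apply: eq_bigr => j _ /=.
    rewrite mulmx_suml mxtrace_sum; apply: eq_bigr => i _.
    by rewrite trmxCK mul_mx_scalar -scalemxAl mxtraceZ.
  rewrite exchange_big; apply: eq_bigr => i _; rewrite exchange_big; apply: eq_bigr => j _ /=.
  by rewrite mxtrace_sum mulr_sumr.
rewrite mulr_sumr; apply: eq_bigr => i _.
rewrite (bigD1 i) //= [X in _ + X]big1 => [|j /negPf ji].
  by rewrite a1 eqxx mxtrace1 addr0 mulrC.
by rewrite a1 eq_sym ji mxtrace_scalar mul0rn mulr0.
Qed.

Lemma twist_tracel (Y : 'M[C]_n) :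
  (forall k l, \sum_i a k i *m (a l i) ^t* = (k == l)%:R%:M) ->
  \tr ((Y *t id_ d) *m ab *m ab ^t*) = d%:R * \tr Y.
Proof.
move=> a2; rewrite bmx_scalar !bmx_dag !bmxM mxtrace_bmx.
transitivity (\sum_k \sum_l Y k l * \tr (\sum_i a k i *m (a l i) ^t*)).
  apply: eq_bigr => k _; rewrite mxtrace_sum.
  under [RHS]eq_bigr do rewrite mxtrace_sum mulr_sumr.
  rewrite [RHS]exchange_big; apply: eq_bigr => i _ /=.
  rewrite mulmx_suml mxtrace_sum; apply: eq_bigr => l _.
  by rewrite trmxCK mul_scalar_mx -scalemxAl mxtraceZ mxtrace_mulC.
rewrite mulr_sumr; apply: eq_bigr => i _.
rewrite (bigD1 i) //= [X in _ + X]big1 => [|j /negPf ji].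
  by rewrite a2 eqxx mxtrace1 addr0 mulrC.
by rewrite a2 eq_sym ji mxtrace_scalar mul0rn mulr0.
Qed.

(** For intertwiners between unitary corepresentations adjoints are intertwiners,
    although the matrix ab of blockwise adjoints is not yet known to be unitary: the
    squared Hilbert-Schmidt norm of the difference of the two sides expands into four
    terms, all equal to d tr(P^+ P). *)
Lemma twist_intertwine m' n' (v : 'M[C]_(n' * d, m' * d)) (J : 'M[C]_(m', m))
    (P : 'M[C]_(n', n)) :
  (forall i j, \sum_k (a k i) ^t* *m a k j = (i == j)%:R%:M) ->
  (forall k l, \sum_i a k i *m (a l i) ^t* = (k == l)%:R%:M) ->
  v ^t* *m v = 1%:M -> v *m v ^t* = 1%:M ->
  v *m (J *t id_ d) = (P *t id_ d) *m ab ->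
  (P ^t* *t id_ d) *m v = ab *m (J ^t* *t id_ d).
Proof.
move=> a1 a2 v1 v2 vJ; apply/eqP; rewrite -subr_eq0 -[X in X == _]trmxCK.
rewrite -(inj_eq (@trmx_inj _ _ _)) trmx0 -map_trmx trmxK map_mx_eq0; apply/eqP.
set Z := _ - _; apply: tr_eq0; rewrite trmxCK {}/Z.
rewrite !dagB !dagM !dag_tens1 !trmxCK mulmxBl !mulmxBr.
have tJ : \tr ((J ^t* *m J) *t id_ d) = d%:R * \tr (J ^t* *m J).
  by rewrite mxtrace_tens mxtrace1 mulrC.
have tP : \tr ((P ^t* *m P) *t id_ d) = d%:R * \tr (P ^t* *m P).
  by rewrite mxtrace_tens mxtrace1 mulrC.
have E1 : P ^t* *t id_ d *m v *m (v ^t* *m (P *t id_ d)) = (P ^t* *m P) *t id_ d.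
  by rewrite mulmxA -(mulmxA _ v) v2 mulmx1 tens1M.
have E4 : ab *m (J ^t* *t id_ d) *m (J *t id_ d *m ab ^t*) =
          ab *m ((J ^t* *m J) *t id_ d) *m ab ^t*.
  by rewrite !mulmxA -(mulmxA ab) tens1M.
have E2 : P ^t* *t id_ d *m v *m (J *t id_ d *m ab ^t*) =
          ((P ^t* *m P) *t id_ d) *m ab *m ab ^t*.
  by rewrite !mulmxA -(mulmxA _ v (J *t id_ d)) vJ mulmxA tens1M.
have E3 : ab *m (J ^t* *t id_ d) *m (v ^t* *m (P *t id_ d)) =
    (P ^t* *t id_ d *m v *m (J *t id_ d *m ab ^t*)) ^t*.
  by rewrite !dagM !dag_tens1 !trmxCK !mulmxA.
have JP : d%:R * \tr (J ^t* *m J) = d%:R * \tr (P ^t* *m P).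
  rewrite -(twist_tracel _ a2) -tJ -!tens1M -!dag_tens1.
  rewrite -!mulmxA [RHS]mxtrace_mulC !mulmxA -vJ -[X in _ = \tr X]mulmxA -dagM -vJ dagM.
  by rewrite mulmxA [RHS]mxtrace_mulC !mulmxA v1 mul1mx mxtrace_mulC.
have tE2 : \tr (P ^t* *t id_ d *m v *m (J *t id_ d *m ab ^t*)) = d%:R * \tr (P ^t* *m P).
  by rewrite E2 twist_tracel.
have tE1 := congr1 mxtrace E1; rewrite tP in tE1.
have tE3 := congr1 mxtrace E3; rewrite mxtrace_dag tE2 in tE3.
have tE4 := congr1 mxtrace E4; rewrite twist_tracer // JP in tE4.
move: tE1 tE2 tE3 tE4; clear E1 E2 E3 E4.
move: (_ *m (v ^t* *m (P *t id_ d))) (_ *m (J *t id_ d *m ab ^t*)).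
move=> X1 X2; move: (_ *m (v ^t* *m (P *t id_ d))) (_ *m (J *t id_ d *m ab ^t*)).
move=> X3 X4; rewrite !mxtraceB => -> -> -> ->.
by rewrite cjM cj_nat -mxtrace_dag dagM trmxCK !subrr.
Qed.
End Twist.

End BlockMatrices.

(** * Transformations out of the canonical functor *)

Section OutOfCanonical.
Variable R : realType.
Local Notation C := R[i].
Variable A : hopfStarAlg R.
Local Notation F := (canonical_functor A).

Lemma scale_delta_sum n (i : 'I_n) d m (f : 'I_n -> 'M[C]_(d, m)) :
  \sum_j (1%:M : 'M[C]_n) j i *: f j = f i.
Proof. by under eq_bigr do rewrite mxE; rewrite delta_sum. Qed.

Section FromCanonical.
Variables (F' : functorData A) (a : uptData F F').
Hypothesis ua : upt_spec a.

(** The multiplicators of the canonical functor are identities. *)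
Lemma uop_tens X Y K (i : 'I_(F X)) (j : 'I_(F Y)) :
  @uop _ _ _ _ a (tens_corep X Y) K (mxtens_index (i, j)) =
  \sum_k \sum_l fmul F' X Y K (mxtens_index (k, l)) *: (uop a k i *m uop a l j).
Proof. by rewrite -(us_mul ua) scale_delta_sum. Qed.

Lemma uop_unit K : @uop _ _ _ _ a (unit_corep A) K (0 : 'I_1) = (funit F' K 0)%:M.
Proof. by rewrite -(us_unit ua) /= (scale_delta_sum (0 : 'I_1) (fun j => uop a K j)). Qed.

End FromCanonical.

End OutOfCanonical.

Section Families.
Variable R : realType.
Local Notation C := R[i].
Local Notation id_ n := (1%:M : 'M[C]_n).

Definition fam_iso d n m (f : 'I_n -> 'I_m -> 'M[C]_d) :=
  forall i j, \sum_k (f k i) ^t* *m f k j = (i == j)%:R%:M.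
Definition fam_coiso d n m (f : 'I_n -> 'I_m -> 'M[C]_d) :=
  forall k l, \sum_i f k i *m (f l i) ^t* = (k == l)%:R%:M.

Lemma fam_isoP d n m (f : 'I_n -> 'I_m -> 'M[C]_d) :
  fam_iso f <-> (bmx f) ^t* *m bmx f = 1%:M.
Proof.
rewrite bmx_dag bmxM -bmx1; split=> [f1|/bmx_inj//].
exact: bmx_ext.
Qed.

Lemma fam_coisoP d n m (f : 'I_n -> 'I_m -> 'M[C]_d) :
  fam_coiso f <-> bmx f *m (bmx f) ^t* = 1%:M.
Proof.
rewrite bmx_dag bmxM -bmx1; split=> [f1|/bmx_inj//].
exact: bmx_ext.
Qed.

(** The operators of a tensor product, before the multiplicator is applied. *)
Definition pfam d n m n' m' (f : 'I_n -> 'I_m -> 'M[C]_d) (g : 'I_n' -> 'I_m' -> 'M[C]_d)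
    (K : 'I_(n * n')) (I : 'I_(m * m')) : 'M[C]_d :=
  f (mxtens_unindex K).1 (mxtens_unindex I).1 *m
  g (mxtens_unindex K).2 (mxtens_unindex I).2.

Lemma pfamE d n m n' m' (f : 'I_n -> 'I_m -> 'M[C]_d) (g : 'I_n' -> 'I_m' -> 'M[C]_d)
    k l i j :
  pfam f g (mxtens_index (k, l)) (mxtens_index (i, j)) = f k i *m g l j.
Proof. by rewrite /pfam !mxtens_indexK. Qed.

Lemma pfam_coiso d n m n' m' (f : 'I_n -> 'I_m -> 'M[C]_d) (g : 'I_n' -> 'I_m' -> 'M[C]_d) :
  fam_coiso f -> fam_coiso g -> fam_coiso (pfam f g).
Proof.
move=> f1 g1 K L; case: (mxtens_indexP K) => k k'; case: (mxtens_indexP L) => l l'.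
rewrite sum_mxtens eq_mxtens.
transitivity (\sum_i f k i *m (\sum_j g k' j *m (g l' j)^t*) *m (f l i)^t*).
  apply: eq_bigr => i _; rewrite mulmx_sumr mulmx_suml; apply: eq_bigr => j _.
  by rewrite !pfamE dagM !mulmxA.
under eq_bigr do rewrite g1 mul_mx_scalar -scalemxAl.
by rewrite -scaler_sumr f1 scale_scalar_mx -natrM mulnb andbC.
Qed.

Lemma pfam_iso d n m n' m' (f : 'I_n -> 'I_m -> 'M[C]_d) (g : 'I_n' -> 'I_m' -> 'M[C]_d) :
  fam_iso f -> fam_iso g -> fam_iso (pfam f g).
Proof.
move=> f1 g1 K L; case: (mxtens_indexP K) => k k'; case: (mxtens_indexP L) => l l'.
rewrite sum_mxtens eq_mxtens exchange_big.
transitivity (\sum_j (g j k')^t* *m (\sum_i (f i k)^t* *m f i l) *m g j l').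
  apply: eq_bigr => j _; rewrite mulmx_sumr mulmx_suml; apply: eq_bigr => i _.
  by rewrite !pfamE dagM !mulmxA.
under eq_bigr do rewrite f1 mul_mx_scalar -scalemxAl.
by rewrite -scaler_sumr g1 scale_scalar_mx -natrM mulnb.
Qed.

Lemma tens1_inj d n m (M M' : 'M[C]_(n, m)) : (0 < d)%N ->
  M *t id_ d = M' *t id_ d -> M = M'.
Proof.
rewrite !bmx_scalar => d0 /bmx_inj MM'; apply/matrixP => i j.
by case: d d0 MM' => // d _ /(_ i j)/matrixP/(_ 0 0); rewrite !mxE.
Qed.

End Families.

Section FunctorOfUpt.
Variable R : realType.
Local Notation C := R[i].
Variable A : hopfStarAlg R.
Local Notation F := (canonical_functor A).
Local Notation id_ n := (1%:M : 'M[C]_n).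

Lemma assoc_ket m n p (i : 'I_m) (j : 'I_n) (k : 'I_p) x :
  assoc R m n p x (mxtens_index (mxtens_index (i, j), k)) =
  (x == mxtens_index (i, mxtens_index (j, k)))%:R.
Proof.
rewrite -mulmx_ket !ket_tv /assoc scompE !mul1mx cast_tvA -!ket_tv.
by rewrite ketE.
Qed.

Lemma lunit_ket n (i : 'I_1) (j : 'I_n) x :
  lunit R n x (mxtens_index (i, j)) = (x == j)%:R.
Proof.
by rewrite -mulmx_ket ket_tv /lunit scompE !mul1mx cast_tv1l ord1 ketE eqxx scale1r ketE.
Qed.

Lemma runit_ket n (i : 'I_1) (j : 'I_n) x :
  runit R n x (mxtens_index (j, i)) = (x == j)%:R.
Proof.
by rewrite -mulmx_ket ket_tv /runit scompE !mul1mx cast_tv1r ord1 ketE eqxx scale1r ketE.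
Qed.

(** The product of operators is associative. *)
Lemma assoc_mul m n p q r s d (f : 'I_q -> 'I_m -> 'M[C]_d) (g : 'I_r -> 'I_n -> 'M[C]_d)
    (h : 'I_s -> 'I_p -> 'M[C]_d) :
  (assoc R q r s *t id_ d) *m bmx (pfam (pfam f g) h) =
  bmx (pfam f (pfam g h)) *m (assoc R m n p *t id_ d).
Proof.
rewrite !bmx_scalar !bmxM; apply: bmx_ext => x y.
case: (mxtens_indexP x) => a bc; case: (mxtens_indexP bc) => b c {x bc}.
case: (mxtens_indexP y) => ij k; case: (mxtens_indexP ij) => i j {y ij}.
transitivity (f a i *m g b j *m h c k).
  rewrite sum_mxtens (bigD1 (mxtens_index (a, b))) //= [X in _ + X]big1 => [|ab'].
    rewrite (bigD1 c) //= [X in _ + X + _]big1 => [|c' /negPf cc'].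
      by rewrite assoc_ket eqxx mul1mx !pfamE !addr0.
    rewrite assoc_ket !eq_mxtens.
    by rewrite [c == c']eq_sym cc' !andbF mul_scalar_mx scale0r.
  case: (mxtens_indexP ab') => a' b'; rewrite eq_mxtens => ab'E.
  apply: big1 => c' _; rewrite assoc_ket !eq_mxtens.
  rewrite [a == a']eq_sym [b == b']eq_sym andbA (negPf ab'E) /=.
  by rewrite mul_scalar_mx scale0r.
under eq_bigr do rewrite assoc_ket mul_mx_scalar.
by rewrite delta_sum !pfamE mulmxA.
Qed.

Lemma fam_of_nat (F' : functorData A) (a : uptData F F') (us : upt_spec a) X Y (f : inter X Y) :
  (fmor F' f *t id_ a) *m bmx (@uop _ _ _ _ a X) = bmx (@uop _ _ _ _ a Y) *m (imx f *t id_ a).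
Proof.
rewrite !bmx_scalar !bmxM; apply: bmx_ext => l i.
under eq_bigr do rewrite mul_scalar_mx.
rewrite (us_nat us); apply: eq_bigr => j _.
by rewrite mul_mx_scalar.
Qed.

Lemma fam_of_mul (F' : functorData A) (a : uptData F F') (us : upt_spec a) X Y :
  (fmul F' X Y *t id_ a) *m bmx (pfam (@uop _ _ _ _ a X) (@uop _ _ _ _ a Y)) =
  bmx (@uop _ _ _ _ a (tens_corep X Y)).
Proof.
rewrite !bmx_scalar !bmxM; apply: bmx_ext => K I; case: (mxtens_indexP I) => i j.
rewrite (uop_tens us) sum_mxtens; apply: eq_bigr => k _; apply: eq_bigr => l _.
by rewrite pfamE mul_scalar_mx.
Qed.

Lemma pfam_mulmx d n m n' m' p q (f : 'I_n -> 'I_m -> 'M[C]_d) (g : 'I_n' -> 'I_m' -> 'M[C]_d)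
   (P : 'M[C]_(p, n)) (Q : 'M[C]_(q, n')) :
  ((P *t Q) *t id_ d) *m bmx (pfam f g) =
  bmx (pfam (fun k i => \sum_j P k j *: f j i) (fun k i => \sum_j Q k j *: g j i)).
Proof.
rewrite !bmx_scalar !bmxM; apply: bmx_ext => K I.
case: (mxtens_indexP K) => k l; case: (mxtens_indexP I) => i j.
rewrite pfamE sum_mxtens mulmx_suml; apply: eq_bigr => a _; rewrite mulmx_sumr.
by apply: eq_bigr => b _; rewrite tensmxE pfamE mul_scalar_mx -scalemxAl -scalemxAr scalerA.
Qed.

Lemma pfam_mulmxr d n m n' m' p q (f : 'I_n -> 'I_m -> 'M[C]_d) (g : 'I_n' -> 'I_m' -> 'M[C]_d)
   (P : 'M[C]_(m, p)) (Q : 'M[C]_(m', q)) :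
  bmx (pfam f g) *m ((P *t Q) *t id_ d) =
  bmx (pfam (fun k i => \sum_j P j i *: f k j) (fun k i => \sum_j Q j i *: g k j)).
Proof.
rewrite !bmx_scalar !bmxM; apply: bmx_ext => K I.
case: (mxtens_indexP K) => k l; case: (mxtens_indexP I) => i j.
rewrite pfamE sum_mxtens mulmx_suml; apply: eq_bigr => a _; rewrite mulmx_sumr.
by apply: eq_bigr => b _; rewrite tensmxE pfamE mul_mx_scalar -scalemxAl -scalemxAr scalerA.
Qed.

Lemma pfam_ext d n m n' m' (f f' : 'I_n -> 'I_m -> 'M[C]_d) (g g' : 'I_n' -> 'I_m' -> 'M[C]_d) :
  (forall k i, f k i = f' k i) -> (forall k i, g k i = g' k i) ->
  bmx (pfam f g) = bmx (pfam f' g').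
Proof. by move=> ff gg; apply: bmx_ext => K I; rewrite /pfam ff gg. Qed.

Definition fam1 d (i j : 'I_1) : 'M[C]_d := 1%:M.

Lemma fam1_coiso d : fam_coiso (@fam1 d).
Proof. by move=> i j; rewrite big_ord1 !ord1 eqxx /fam1 dag1 mulmx1. Qed.

Lemma lunit_mul d m n (f : 'I_n -> 'I_m -> 'M[C]_d) :
  (lunit R n *t id_ d) *m bmx (pfam (@fam1 d) f) = bmx f *m (lunit R m *t id_ d).
Proof.
rewrite !bmx_scalar !bmxM; apply: bmx_ext => k y; case: (mxtens_indexP y) => i j {y}.
rewrite sum_mxtens big_ord1.
under eq_bigr do rewrite lunit_ket mul_scalar_mx.
under [RHS]eq_bigr do rewrite lunit_ket mul_mx_scalar.
by rewrite delta_sum delta_sum' pfamE mul1mx.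
Qed.

Lemma runit_mul d m n (f : 'I_n -> 'I_m -> 'M[C]_d) :
  (runit R n *t id_ d) *m bmx (pfam f (@fam1 d)) = bmx f *m (runit R m *t id_ d).
Proof.
rewrite !bmx_scalar !bmxM; apply: bmx_ext => k y; case: (mxtens_indexP y) => j i {y}.
rewrite sum_mxtens; under eq_bigr do rewrite big_ord1.
under eq_bigr do rewrite runit_ket mul_scalar_mx.
under [RHS]eq_bigr do rewrite runit_ket mul_mx_scalar.
by rewrite delta_sum delta_sum' pfamE mulmx1.
Qed.

Lemma bmx_cancel d n m p (f : 'I_n -> 'I_m -> 'M[C]_d) (M M' : 'M[C]_(p, n)) :
  (0 < d)%N -> fam_coiso f -> (M *t id_ d) *m bmx f = (M' *t id_ d) *m bmx f -> M = M'.
Proof.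
move=> d0 /fam_coisoP f1 E; apply: (tens1_inj d0).
by rewrite -[LHS]mulmx1 -f1 mulmxA E -mulmxA f1 mulmx1.
Qed.

(** Tensored with H and composed with the unitary family of operators, each axiom
    for the target becomes the same axiom for the canonical functor.  Unitary families
    and the factor H can be cancelled ([bmx_cancel]). *)
Theorem fibre_functor_of_upt (F' : functorData A) (a : uptData F F') :
  is_upt a -> is_fibre_functor F'.
Proof.
move=> ua; have us := (is_uptP a).1 ua.
pose al X := bmx (@uop _ _ _ _ a X).
have al1 X : (al X) ^t* *m al X = 1%:M by apply/fam_isoP; exact: us_iso us X.
have al2 X : al X *m (al X) ^t* = 1%:M by apply/fam_coisoP; exact: us_coiso us X.
have d0 := us_dim us.
have canc X m (M M' : 'M[C]_(m, F' X)) :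
    (M *t id_ a) *m al X = (M' *t id_ a) *m al X -> M = M'.
  move=> E; apply: (tens1_inj d0); rewrite -[LHS]mulmx1 -(al2 X) mulmxA E.
  by rewrite -mulmxA al2 mulmx1.
have nat X Y (f : inter X Y) : (fmor F' f *t id_ a) *m al X = al Y *m (imx f *t id_ a).
  exact: fam_of_nat.
pose pal X Y := bmx (pfam (@uop _ _ _ _ a X) (@uop _ _ _ _ a Y)).
have mul X Y : (fmul F' X Y *t id_ a) *m pal X Y = al (tens_corep X Y).
  exact: fam_of_mul.
have pal1 X Y : (pal X Y) ^t* *m pal X Y = 1%:M.
  by apply/fam_isoP; apply: pfam_iso; [exact: us_iso us X|exact: us_iso us Y].
have pal2 X Y : pal X Y *m (pal X Y) ^t* = 1%:M.
  by apply/fam_coisoP; apply: pfam_coiso; [exact: us_coiso us X|exact: us_coiso us Y].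
have pcanc X Y m (M M' : 'M[C]_(m, F' X * F' Y)) :
    (M *t id_ a) *m pal X Y = (M' *t id_ a) *m pal X Y -> M = M'.
  move=> E; apply: (tens1_inj d0); rewrite -[LHS]mulmx1 -(pal2 X Y) mulmxA E.
  by rewrite -mulmxA pal2 mulmx1.
have tens11 n : id_ n *t id_ a = 1%:M.
  by rewrite bmx_scalar -bmx1; apply: bmx_ext => i j; rewrite mxE.
split.
- by move=> V; apply: canc; rewrite nat /= !tens11 mul1mx mulmx1.
- move=> V W X g f; apply: canc; rewrite nat /= -!tens1M mulmxA.
  by rewrite -(nat _ _ g) -[RHS]mulmxA (nat _ _ f) mulmxA.
- move=> V W c f g; apply: canc; rewrite nat /al /= !bmx_scalar !bmxM.
  have Nf := nat _ _ f; have Ng := nat _ _ g.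
  rewrite /al !bmx_scalar !bmxM in Nf Ng; apply: bmx_ext => k i.
  have {}Nf := bmx_inj Nf k i; have {}Ng := bmx_inj Ng k i.
  transitivity (c *: \sum_j uop a k j *m (imx f j i)%:M + \sum_j uop a k j *m (imx g j i)%:M).
    rewrite scaler_sumr -big_split; apply: eq_bigr => j _ /=.
    by rewrite !mxE !mul_mx_scalar scalerDl scalerA.
  rewrite -Nf -Ng scaler_sumr -big_split; apply: eq_bigr => j _ /=.
  by rewrite !mxE !mul_scalar_mx scalerDl scalerA.
- move=> V W f; apply: canc; rewrite nat /=.
  have E : imx f *t id_ a = (al W)^t* *m ((fmor F' f *t id_ a) *m al V).
    by rewrite nat mulmxA al1 mul1mx.
  by rewrite -!dag_tens1 E !dagM trmxCK !mulmxA al2 mul1mx.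
- move=> V W; have E : fmul F' V W *t id_ a = al (tens_corep V W) *m (pal V W) ^t*.
    by rewrite -mul -mulmxA pal2 mulmx1.
  split; apply: (tens1_inj d0); rewrite -tens1M -dag_tens1 E dagM trmxCK tens11.
    by rewrite -mulmxA (mulmxA _ (al _)) al1 mul1mx pal2.
  by rewrite -mulmxA (mulmxA _ (pal _ _)) pal1 mul1mx al2.
- have E : funit F' *t id_ a = al (unit_corep A).
    rewrite bmx_scalar; apply: bmx_ext => k i; rewrite (ord1 (i : 'I_1)).
    by rewrite (uop_unit us) /= .
  split; apply: (tens1_inj d0); rewrite -tens1M -dag_tens1 E tens11; first exact: (al1 (unit_corep A)).
  exact: (al2 (unit_corep A)).
- move=> V V' W W' f g; apply: pcanc; rewrite -!tens1M -!mulmxA mul nat /= -mul -mulmxA.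
  congr (_ *m _); rewrite /pal pfam_mulmx pfam_mulmxr; apply: pfam_ext => k i.
    by rewrite (us_nat us).
  by rewrite (us_nat us).
- move=> V W X; pose tp := pfam (pfam (@uop _ _ _ _ a V) (@uop _ _ _ _ a W)) (@uop _ _ _ _ a X).
  have tp1 : fam_coiso tp.
    by do 2?[apply: pfam_coiso]; first [exact: us_coiso us V|exact: us_coiso us W|exact: us_coiso us X].
  apply: (bmx_cancel d0 tp1); rewrite -[in LHS]tens1M -[in LHS]tens1M -[in RHS]tens1M -[in RHS]tens1M.
  rewrite -!mulmxA /tp pfam_mulmx assoc_mul.
  have -> : bmx (pfam (fun k i => \sum_j fmul F' V W k j *: pfam (@uop _ _ _ _ a V) (@uop _ _ _ _ a W) j i)
      (fun k i => \sum_j id_ (F' X) k j *: @uop _ _ _ _ a X j i)) = pal (tens_corep V W) X.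
    apply: pfam_ext => k i; last by under eq_bigr do rewrite mxE; rewrite delta_sum'.
    have := mul V W; rewrite bmx_scalar bmxM => /bmx_inj/(_ k i) <-.
    by apply: eq_bigr => j _; rewrite mul_scalar_mx.
  rewrite mul nat /= [X in _ = _ *m X]mulmxA pfam_mulmx.
  have -> : bmx (pfam (fun k i => \sum_j id_ (F' V) k j *: @uop _ _ _ _ a V j i)
    (fun k i => \sum_j fmul F' W X k j *: pfam (@uop _ _ _ _ a W) (@uop _ _ _ _ a X) j i))
     = pal V (tens_corep W X).
    apply: pfam_ext => k i; first by under eq_bigr do rewrite mxE; rewrite delta_sum'.
    have := mul W X; rewrite bmx_scalar bmxM => /bmx_inj/(_ k i) <-.
    by apply: eq_bigr => j _; rewrite mul_scalar_mx.
  by rewrite mulmxA mul.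
- move=> V.
  apply: (bmx_cancel d0 (pfam_coiso (@fam1_coiso a) (@us_coiso _ _ _ _ _ us V))).
  rewrite lunit_mul -[in LHS]tens1M -[in LHS]tens1M -!mulmxA pfam_mulmx.
  have -> : bmx (pfam (fun k i => \sum_j funit F' k j *: fam1 a j i)
     (fun k i => \sum_j id_ (F' V) k j *: @uop _ _ _ _ a V j i)) = pal (unit_corep A) V.
    apply: pfam_ext => k i; last by under eq_bigr do rewrite mxE; rewrite delta_sum'.
    by rewrite big_ord1 (ord1 (i : 'I_1)) (uop_unit us) scale_scalar_mx mulr1.
  by rewrite mul nat.
- move=> V.
  apply: (bmx_cancel d0 (pfam_coiso (@us_coiso _ _ _ _ _ us V) (@fam1_coiso a))).
  rewrite runit_mul -[in LHS]tens1M -[in LHS]tens1M -!mulmxA pfam_mulmx.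
  have -> : bmx (pfam (fun k i => \sum_j id_ (F' V) k j *: @uop _ _ _ _ a V j i)
     (fun k i => \sum_j funit F' k j *: fam1 a j i)) = pal V (unit_corep A).
    apply: pfam_ext => k i; first by under eq_bigr do rewrite mxE; rewrite delta_sum'.
    by rewrite big_ord1 (ord1 (i : 'I_1)) (uop_unit us) scale_scalar_mx mulr1.
  by rewrite mul nat.
Qed.

End FunctorOfUpt.

Section ConjugateUnitarity.
Variable R : realType.
Local Notation C := R[i].
Variable A : hopfStarAlg R.
Local Notation F := (canonical_functor A).

(** An intertwiner from conj V to W, as an invariant vector of V (x) W. *)
Definition conj_inter_mx (V W : corep A) (J : 'M[C]_(cdim W, cdim V)) :
    'M[C]_(cdim V * cdim W, 1) :=
  \col_x J (mxtens_unindex x).2 (mxtens_unindex x).1.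

Lemma conj_interP (V W : corep A) (J : 'M[C]_(cdim W, cdim V)) :
  W *m scalar_to_alg A J = scalar_to_alg A J *m conj_corep_mx V ->
  scalar_to_alg A (conj_inter_mx J) *m unit_corep A ==
    tens_corep V W *m scalar_to_alg A (conj_inter_mx J).
Proof.
move=> WJ; set s := conj_inter_mx J; rewrite mulmx1; apply/eqP/matrixP => x i; case: (mxtens_indexP x) => y w.
rewrite [LHS]mxE [RHS]mxE sum_mxtens.
have -> : s (mxtens_index (y, w)) i = J w y by rewrite mxE mxtens_indexK.
transitivity (\sum_b V y b * (W *m scalar_to_alg A J) w b); last first.
  apply: eq_bigr => b _; rewrite mxE mulr_sumr; apply: eq_bigr => c _.
  by rewrite tensmxE !mxE mxtens_indexK mulrA.
rewrite WJ; transitivity (\sum_b V y b * \sum_c J w c *: star (V c b)); last first.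
  apply: eq_bigr => b _; rewrite mxE; congr (_ * _); apply: eq_bigr => c _.
  by rewrite !mxE -scalerAl mul1r.
under eq_bigr do rewrite mulr_sumr; rewrite exchange_big /=.
transitivity (\sum_c J w c *: (V *m star_mx V) y c); last first.
  apply: eq_bigr => c _; rewrite mxE scaler_sumr; apply: eq_bigr => b _.
  by rewrite !mxE scalerAr.
rewrite cmx_unitaryr (bigD1 y) //= big1 => [|c /negPf cy].
  by rewrite mxE eqxx addr0.
by rewrite mxE eq_sym cy scaler0.
Qed.

(** Naturality along the invariant vector of V (x) W makes
    sum_bc J_cb a^V_yb a^W_xc a scalar P_xy; multiplying by the adjoints of the a^V
    moves them to the other side. *)
Lemma upt_conj_rel (F' : functorData A) (a : uptData F F') :
  is_upt a -> forall (V W : corep A) (J : 'M[C]_(cdim W, cdim V)),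
  W *m scalar_to_alg A J = scalar_to_alg A J *m conj_corep_mx V ->
  exists P : 'M[C]_(F' W, F' V), forall x b,
    \sum_c J c b *: @uop _ _ _ _ a W x c = \sum_y P x y *: (@uop _ _ _ _ a V y b) ^t*.
Proof.
move=> ua0 V W J WJ; have fF' := fibre_functor_of_upt ua0; have ua := (is_uptP a).1 ua0.
pose s := @Inter R A (unit_corep A) (tens_corep V W) _ (conj_interP WJ).
pose t : 'cV[C]_(F' (tens_corep V W)) := fmor F' s *m funit F'.
have E1 K : \sum_b \sum_c J c b *: @uop _ _ _ _ a (tens_corep V W) K (mxtens_index (b, c)) =
            (t K 0)%:M.
  have := us_nat ua s K (0 : 'I_1).
  under eq_bigr do rewrite (uop_unit ua) scale_scalar_mx.
  rewrite -raddf_sum /= [\sum_(i < F' _) _](_ : _ = t K 0); last by rewrite mxE.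
  move=> ->; rewrite sum_mxtens; apply: eq_bigr => b _; apply: eq_bigr => c _.
  by rewrite mxE mxtens_indexK.
have [m1 _] := fmul_unitary fF' V W.
pose t' := (fmul F' V W) ^t* *m t.
have E2 y x : \sum_b \sum_c J c b *: (@uop _ _ _ _ a V y b *m @uop _ _ _ _ a W x c) =
              (t' (mxtens_index (y, x)) 0)%:M.
  rewrite mxE raddf_sum /=.
  under [RHS]eq_bigr do rewrite -scale_scalar_mx -E1 scaler_sumr.
  rewrite [RHS]exchange_big; apply: eq_bigr => b _ /=.
  under [RHS]eq_bigr do rewrite scaler_sumr.
  rewrite [RHS]exchange_big; apply: eq_bigr => c _ /=.
  under [RHS]eq_bigr do rewrite scalerA mulrC -scalerA.
  rewrite -scaler_sumr; congr (_ *: _).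
  under eq_bigr do rewrite (uop_tens ua) scaler_sumr.
  rewrite exchange_big /=.
  under eq_bigr do (under eq_bigr do rewrite scaler_sumr; rewrite exchange_big /=).
  transitivity (\sum_k \sum_l ((fmul F' V W)^t* *m fmul F' V W) (mxtens_index (y, x))
      (mxtens_index (k, l)) *: (uop a k b *m uop a l c)); last first.
    apply: eq_bigr => k _; apply: eq_bigr => l _; rewrite mxE scaler_suml.
    by apply: eq_bigr => K _; rewrite scalerA.
  rewrite m1 (bigD1 y) //= [X in _ + X]big1 ?addr0 => [|k /negPf ky]; last first.
    by apply: big1 => l _; rewrite one_tensE mxE eq_sym ky mul0r scale0r.
  rewrite (bigD1 x) //= [X in _ + X]big1 ?addr0 => [|l /negPf lx]; last first.
    by rewrite one_tensE !mxE eqxx [x == l]eq_sym lx mulr0 scale0r.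
  by rewrite one_tensE !mxE !eqxx mulr1 scale1r.
exists (\matrix_(x, y) t' (mxtens_index (y, x)) 0) => x b.
transitivity (\sum_y (uop a y b)^t* *m (t' (mxtens_index (y, x)) 0)%:M); last first.
  by apply: eq_bigr => y _; rewrite mul_mx_scalar; congr (_ *: _); rewrite [RHS]mxE.
under [RHS]eq_bigr do rewrite -E2 mulmx_sumr.
rewrite exchange_big /=.
transitivity (\sum_b' (b == b')%:R *: \sum_c J c b' *: uop a x c).
  by rewrite delta_sum'.
apply: eq_bigr => b' _; rewrite -mul_scalar_mx -(us_iso ua) mulmx_suml.
apply: eq_bigr => y _; rewrite !mulmx_sumr; apply: eq_bigr => c _.
by rewrite -!scalemxAr mulmxA.
Qed.

(** With W and the J_c of [conj_embedding], the matrix ab of adjoints satisfies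
    v (J_c (x) 1) = (P_c (x) 1) ab with v the unitary matrix of operators of W.  By
    [twist_intertwine] also (P_c^+ (x) 1) v = ab (J_c^+ (x) 1), so ab^+ ab - 1 kills
    the ranges of all J_c^+ (x) 1, which together span. *)
Theorem upt_conj_unitary (hA : is_cqg A) (F' : functorData A) (a : uptData F F') :
  is_upt a -> forall X,
  (forall i j, \sum_k @uop _ _ _ _ a X k i *m (uop a k j) ^t* = (i == j)%:R%:M) /\
  (forall k l, \sum_i (@uop _ _ _ _ a X k i) ^t* *m uop a l i = (k == l)%:R%:M).
Proof.
move=> ua V; have us := (is_uptP a).1 ua.
have [W [I [J [WJ Jinj]]]] := conj_embedding hA V.
pose al k i := @uop _ _ _ _ a V k i.
pose ab : 'M[C]_(F' V * a, cdim V * a) := bmx (fun k i => (al k i) ^t*).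
pose v : 'M[C]_(F' W * a, cdim W * a) := bmx (fun k i => @uop _ _ _ _ a W k i).
have v1 : v ^t* *m v = 1%:M.
  by rewrite /v bmx_dag bmxM -bmx1; apply: bmx_ext => i j; rewrite (us_iso us).
have v2 : v *m v ^t* = 1%:M.
  by rewrite /v bmx_dag bmxM -bmx1; apply: bmx_ext => i j; rewrite (us_coiso us).
have H0 : ab ^t* *m ab - 1%:M = 0.
  set H := _ - _.
  have HJ c : H *m ((J c) ^t* *t 1%:M) = 0.
    have [P PE] := upt_conj_rel ua (WJ c).
    have vJ : v *m (J c *t 1%:M) = (P *t 1%:M) *m ab.
      rewrite !bmx_scalar !bmxM; apply: bmx_ext => x b.
      under eq_bigr do rewrite mul_mx_scalar; rewrite PE.
      by apply: eq_bigr => y _; rewrite mul_scalar_mx.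
    have E := twist_intertwine (@us_iso _ _ _ _ _ us V) (@us_coiso _ _ _ _ _ us V) v1 v2 vJ.
    apply: dag_eq0; rewrite dagM dag_tens1 trmxCK.
    apply: tr_eq0; rewrite dagM trmxCK dag_tens1.
    rewrite -mulmxA (mulmxA _ _ (H^t*)) tens1M.
    suff HJ : H *m ((J c) ^t* *m J c *t 1%:M) = 0.
      by rewrite mulmxA HJ mul0mx mxtrace0.
    rewrite -tens1M mulmxA mulmxBl mul1mx -mulmxA -E.
    rewrite mulmxBl -!mulmxA vJ mulmxA -dag_tens1 -dagM -vJ dagM dag_tens1.
    by rewrite -!mulmxA (mulmxA _ v) v1 mul1mx subrr.
  apply: dag_eq0; apply: mx_cV_ext => h; rewrite mul0mx.
  rewrite -[_ *m h]unvecK; set Y := unvec _.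
  suff -> : Y = 0 by rewrite vec0.
  apply/matrixP => i j; rewrite [RHS]mxE.
  have /colP/(_ i) : col j Y = 0.
    apply: Jinj => c; rewrite colE mulmxA.
    suff -> : J c *m Y = 0 by rewrite mul0mx.
    apply: (can_inj (@vecK _ _ _)); rewrite vec0.
    rewrite -[J c *m Y]mulmx1 -trmx1 -tens_vec unvecK.
    have := congr1 (fun M => M ^t*) (HJ c); rewrite dagM dag_tens1 trmxCK trmx0 map_mx0 => E.
    by rewrite mulmxA E mul0mx.
  by rewrite !mxE.
have ab1 : ab ^t* *m ab = 1%:M by apply/eqP; rewrite -subr_eq0 H0.
have dims : (cdim V * a = F' V * a)%N.
  by case: ua => _ /(_ V)/unitary_dim E _ _ _; rewrite E mulnC.
have ab2 := isometry_dim ab1 dims.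
split=> [i j|k l].
  have : bmx (fun i j => \sum_k al k i *m (al k j) ^t*) = bmx (fun i j => (i == j)%:R%:M).
    rewrite bmx1 -ab1 /ab bmx_dag bmxM; apply: bmx_ext => i' j'.
    by apply: eq_bigr => k _; rewrite trmxCK.
  by move/bmx_inj => ->.
have : bmx (fun i j => \sum_k (al i k) ^t* *m al j k) = bmx (fun i j => (i == j)%:R%:M).
  rewrite bmx1 -ab2 /ab bmx_dag bmxM; apply: bmx_ext => i' j'.
  by apply: eq_bigr => k' _; rewrite trmxCK.
by move/bmx_inj => ->.
Qed.

End ConjugateUnitarity.

(** * From a transformation to a simple Frobenius monoid *)

Section TensorSums.
Variable R : realType.
Local Notation C := R[i].
Local Notation id_ n := (1%:M : 'M[C]_n).

Lemma tensDl m n p q (f g : 'M[C]_(m, n)) (h : 'M[C]_(p, q)) :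
  (f + g) *t h = f *t h + g *t h.
Proof. by apply/matrixP => x y; rewrite !mxE mulrDl. Qed.
Lemma tensDr m n p q (f g : 'M[C]_(m, n)) (h : 'M[C]_(p, q)) :
  h *t (f + g) = h *t f + h *t g.
Proof. by apply/matrixP => x y; rewrite !mxE mulrDr. Qed.
Lemma tensZl m n p q c (f : 'M[C]_(m, n)) (h : 'M[C]_(p, q)) :
  (c *: f) *t h = c *: (f *t h).
Proof. by apply/matrixP => x y; rewrite !mxE mulrA. Qed.
Lemma tensZr m n p q c (f : 'M[C]_(m, n)) (h : 'M[C]_(p, q)) :
  h *t (c *: f) = c *: (h *t f).
Proof. by apply/matrixP => x y; rewrite !mxE mulrCA. Qed.
Lemma tens_suml m n p q (I : Type) (r : seq I) P (f : I -> 'M[C]_(m, n)) (h : 'M[C]_(p, q)) :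
  (\sum_(i <- r | P i) f i) *t h = \sum_(i <- r | P i) f i *t h.
Proof. by elim/big_rec2: _ => [|i a b _ <-]; rewrite ?tens0mx ?tensDl. Qed.
Lemma tens_sumr m n p q (I : Type) (r : seq I) P (f : I -> 'M[C]_(m, n)) (h : 'M[C]_(p, q)) :
  h *t (\sum_(i <- r | P i) f i) = \sum_(i <- r | P i) h *t f i.
Proof. by elim/big_rec2: _ => [|i a b _ <-]; rewrite ?tensmx0 ?tensDr. Qed.

Lemma tens11 m n : id_ m *t id_ n = id_ (m * n).
Proof. by rewrite bmx_scalar -bmx1; apply: bmx_ext => i j; rewrite mxE. Qed.

Definition cmx m n (f : 'M[C]_(m, n)) : 'M[C]_(m, n) := map_mx Num.conj f.

Lemma cmxM m n p (f : 'M[C]_(m, n)) (g : 'M[C]_(n, p)) : cmx (f *m g) = cmx f *m cmx g.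
Proof. exact: map_mxM. Qed.
Lemma cmxZ m n c (f : 'M[C]_(m, n)) : cmx (c *: f) = c^* *: cmx f.
Proof. exact: map_mxZ. Qed.
Lemma cmx_sum m n (I : Type) (r : seq I) P (f : I -> 'M[C]_(m, n)) :
  cmx (\sum_(i <- r | P i) f i) = \sum_(i <- r | P i) cmx (f i).
Proof. exact: map_mx_sum. Qed.
Lemma cmx_scalar n (c : C) : cmx (c%:M : 'M_n) = (c^*)%:M.
Proof. exact: map_scalar_mx. Qed.
Lemma cmx_dag m n (f : 'M[C]_(m, n)) : (cmx f)^t* = cmx (f^t*).
Proof. by apply/matrixP => i j; rewrite !mxE. Qed.
Lemma tens_scalar m n (c d : C) : (c%:M : 'M_m) *t (d%:M : 'M_n) = (c * d)%:M.
Proof. by rewrite -[c%:M]scalemx1 -[d%:M]scalemx1 tensZl tensZr tens11 scalerA scalemx1. Qed.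

Lemma mx_vec2_ext m n p q r (f g : 'M[C]_(r, m * n * (p * q))) :
  (forall X Y, f *m (vec X *k vec Y) = g *m (vec X *k vec Y)) -> f = g.
Proof. by move=> fg; apply: mx_tv_ext => x y; rewrite -[x]unvecK -[y]unvecK fg. Qed.

Lemma vec_ket m n (X : 'M[C]_(m, n)) : vec X = \sum_i \sum_j X i j *: (ket R i *k ket R j).
Proof.
rewrite [vec X]cV_ket sum_mxtens; apply: eq_bigr => i _; apply: eq_bigr => j _.
by rewrite vecE ket_tv.
Qed.

Lemma sqrtd_conj d : (sqrtd R d)^* = sqrtd R d.
Proof. by apply: CrealP; rewrite ger0_real // sqrtC_ge0 ler0n. Qed.

Lemma sqrtd_neq0 d : (0 < d)%N -> sqrtd R d != 0.
Proof. by move=> d0; rewrite sqrtC_eq0 pnatr_eq0 -lt0n. Qed.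

Lemma sqrtd2 d : sqrtd R d * sqrtd R d = d%:R.
Proof. by rewrite -expr2 sqrtCK. Qed.

Lemma sqrtdV_conj d : ((sqrtd R d)^-1)^* = (sqrtd R d)^-1.
Proof. by rewrite fmorphV /= sqrtd_conj. Qed.

Lemma sqrtdV2 d : (sqrtd R d)^-1 * (sqrtd R d)^-1 = d%:R^-1.
Proof. by rewrite -invfM sqrtd2. Qed.

(** Composition of linear maps, as a map on Hom(K, H) (x) Hom(L, K). *)
Definition mxprod m n p : 'M[C]_(m * p, m * n * (n * p)) :=
  \matrix_(x, q) let u := mxtens_unindex (mxtens_unindex q).1 in
                 let w := mxtens_unindex (mxtens_unindex q).2 in
    ((u.2 == w.1) && (x == mxtens_index (u.1, w.2)))%:R.

Lemma mxprod_ket m n p (i : 'I_m) (j k : 'I_n) (l : 'I_p) :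
  mxprod m n p *m (ket R i *k ket R j *k (ket R k *k ket R l)) =
  (j == k)%:R *: (ket R i *k ket R l).
Proof.
rewrite -!ket_tv; apply/colP => x; rewrite mulmx_ket !mxE !mxtens_indexK /= eqxx andbT.
by case: eqP => _; rewrite ?mul1r ?mul0r.
Qed.

Lemma mxprod_vec m n p (X : 'M[C]_(m, n)) (Y : 'M[C]_(n, p)) :
  mxprod m n p *m (vec X *k vec Y) = vec (X *m Y).
Proof.
rewrite (vec_ket X) (vec_ket Y) (vec_ket (X *m Y)) tv_suml mulmx_sumr.
apply: eq_bigr => i _; rewrite tv_suml mulmx_sumr.
transitivity (\sum_j \sum_l (X i j * Y j l) *: (ket R i *k ket R l)).
  apply: eq_bigr => j _; rewrite tvZl tv_sumr -scalemxAr mulmx_sumr scaler_sumr.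
  rewrite (bigD1 j) //= [X in _ + X]big1 => [|k /negPf kj].
    rewrite addr0 tv_sumr mulmx_sumr scaler_sumr; apply: eq_bigr => l _.
    by rewrite tvZr -scalemxAr mxprod_ket eqxx scale1r scalerA.
  rewrite tv_sumr mulmx_sumr scaler_sumr big1 // => l _.
  by rewrite tvZr -scalemxAr mxprod_ket eq_sym kj scale0r !scaler0.
rewrite exchange_big; apply: eq_bigr => l _ /=.
by rewrite mxE scaler_suml.
Qed.

Lemma mxprod_dag_ket m n p (i : 'I_m) (l : 'I_p) :
  (mxprod m n p)^t* *m (ket R i *k ket R l) =
  \sum_b ket R i *k ket R b *k (ket R b *k ket R l).
Proof.
apply/colP => x; case: (mxtens_indexP x) => ab ce.
case: (mxtens_indexP ab) => a b; case: (mxtens_indexP ce) => c e.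
rewrite -ket_tv mulmx_ket dagE mxE !mxtens_indexK /= cj_nat eq_mxtens summxE.
rewrite (bigD1 b) //= [X in _ + X]big1 => [|k /negPf kb].
  by rewrite addr0 !tvE !ketE eqxx mulr1 [c == b]eq_sym -!natrM !mulnb; congr (_%:R); congr nat_of_bool; rewrite [i == a]eq_sym [l == e]eq_sym; case: eqP; case: eqP; case: eqP.
by rewrite !tvE !ketE [b == k]eq_sym kb mulr0 mul0r.
Qed.

Lemma mxprod_coiso m n p : mxprod m n p *m (mxprod m n p)^t* = n%:R%:M.
Proof.
apply: mx_ket_ext => x; case: (mxtens_indexP x) => i l; rewrite ket_tv -mulmxA mxprod_dag_ket.
rewrite mulmx_sumr; under eq_bigr do rewrite mxprod_ket eqxx scale1r.
by rewrite sumr_const card_ord mul_scalar_mx scaler_nat.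
Qed.

Lemma mxprod_bilinear m n p (X : 'M[C]_m) (Z : 'M[C]_p) :
  mxprod m n p *m ((X *t id_ n) *t (id_ n *t Z^T)) = (X *t Z^T) *m mxprod m n p.
Proof.
apply: mx_vec2_ext => P Q; rewrite -!mulmxA mxprod_vec tensmx_tv !tens_vec mxprod_vec.
by rewrite trmx1 trmxK mulmx1 mul1mx !mulmxA.
Qed.

Lemma end_mulE d : end_mul R d = (sqrtd R d)^-1 *: mxprod d d d.
Proof.
apply: mx_ket_ext => q; case: (mxtens_indexP q) => ij kl.
case: (mxtens_indexP ij) => i j; case: (mxtens_indexP kl) => k l; rewrite !ket_tv.
rewrite /end_mul -!scalemxAl mxprod_ket; congr (_ *: _).
rewrite !scompE !mul1mx cast_tv_mid !tensmx_tv !mul1mx ev_tv.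
have e1 : (d * 1 = d)%N by rewrite muln1.
rewrite (cast_tv_in _ _ e1 erefl) cast_tv1r castmx_id tvZl.
rewrite mxE eqxx mulr1n (bigD1 k) //= big1 => [|l' /negPf lk].
  by rewrite !ketE eqxx mulr1 addr0 eq_sym.
by rewrite [X in _ * X]ketE lk mulr0.
Qed.

Lemma end_mul_ket d (i j k l : 'I_d) :
  end_mul R d *m (ket R i *k ket R j *k (ket R k *k ket R l)) =
  ((sqrtd R d)^-1 * (j == k)%:R) *: (ket R i *k ket R l).
Proof. by rewrite end_mulE -scalemxAl mxprod_ket scalerA. Qed.

Lemma end_mul_vec d (X Y : 'M[C]_d) :
  end_mul R d *m (vec X *k vec Y) = (sqrtd R d)^-1 *: vec (X *m Y).
Proof. by rewrite end_mulE -scalemxAl mxprod_vec. Qed.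

Lemma end_unit_vec d : end_unit R d = sqrtd R d *: vec (1%:M : 'M_d).
Proof.
rewrite /end_unit; congr (_ *: _); apply/colP => k.
by case: (mxtens_indexP k) => i j; rewrite vecE !mxE mxtens_indexK.
Qed.

Lemma end_mul_dag_ket d (i l : 'I_d) :
  (end_mul R d)^t* *m (ket R i *k ket R l) =
  (sqrtd R d)^-1 *: \sum_b ket R i *k ket R b *k (ket R b *k ket R l).
Proof. by rewrite end_mulE dagZ sqrtdV_conj -scalemxAl mxprod_dag_ket. Qed.

End TensorSums.

Section Mix.
Variable R : realType.
Local Notation C := R[i].
Variable A : hopfStarAlg R.
Hypothesis hA : is_cqg A.
Local Notation F := (canonical_functor A).
Local Notation id_ n := (1%:M : 'M[C]_n).
Local Notation op a := (@uop _ _ _ _ a _).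

(** For a and b with the same target; on matrices its operators are
    Y |-> sum_z a_zi Y b_zk^+. *)
Definition upt_mix (F' : functorData A) (a b : uptData F F') : uptData F F :=
  upt_comp a (upt_dual b).

Lemma uop_mix F' (a b : uptData F F') X k i :
  @uop _ _ _ _ (upt_mix a b) X k i = \sum_z op a z i *t cmx (op b z k).
Proof.
by rewrite uop_comp; apply: eq_bigr => z _; rewrite uop_dual.
Qed.

Lemma uop_mix_vec F' (a b : uptData F F') X k i Y :
  @uop _ _ _ _ (upt_mix a b) X k i *m vec Y = vec (\sum_z op a z i *m Y *m (op b z k)^t*).
Proof.
rewrite uop_mix mulmx_suml vec_sum; apply: eq_bigr => z _.
exact: tens_conj_vec.
Qed.

(** The unitarity of the operators of a combines with the unitarity of the adjoints
    for b, and multiplicativity holds because the multiplicators of the common target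
    are unitary. *)
Lemma upt_mix_is_upt F' (a b : uptData F F') :
  is_upt a -> is_upt b -> is_upt (upt_mix a b).
Proof.
move=> ua ub; have fF' := fibre_functor_of_upt ua; have usa := (is_uptP a).1 ua; have usb := (is_uptP b).1 ub.
apply/is_uptP; split.
- by rewrite /= muln_gt0 (us_dim usa) (us_dim usb).
- move=> X i j; have [_ K2] := upt_conj_unitary hA ub X.
  transitivity (\sum_z \sum_z' ((op a z i)^t* *m op a z' j) *t
      cmx (\sum_k (op b z k)^t* *m @uop _ _ _ _ b X z' k)).
    under eq_bigr do rewrite !uop_mix dag_sum mulmx_suml.
    rewrite exchange_big; apply: eq_bigr => z _ /=.
    under eq_bigr do rewrite mulmx_sumr; rewrite exchange_big; apply: eq_bigr => z' _ /=.
    rewrite cmx_sum tens_sumr; apply: eq_bigr => k _.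
    by rewrite dag_tens tensmx_mul cmx_dag cmxM.
  transitivity (\sum_z ((op a z i)^t* *m @uop _ _ _ _ a X z j) *t id_ b).
    apply: eq_bigr => z _; rewrite -[RHS](delta_sum' z
      (fun z' => ((op a z i)^t* *m @uop _ _ _ _ a X z' j) *t id_ b)).
    apply: eq_bigr => z' _; rewrite K2 cmx_scalar cj_nat.
    by rewrite -[_%:M]scalemx1 tensZr.
  by rewrite -tens_suml (us_iso usa) tens_scalar mulr1.
- move=> X k l; have [K1 _] := upt_conj_unitary hA ub X.
  transitivity (\sum_z \sum_z' (\sum_i op a z i *m (@uop _ _ _ _ a X z' i)^t*) *t
      cmx (op b z k *m (@uop _ _ _ _ b X z' l)^t*)).
    under eq_bigr do rewrite !uop_mix dag_sum mulmx_suml.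
    rewrite exchange_big; apply: eq_bigr => z _ /=.
    under eq_bigr do rewrite mulmx_sumr; rewrite exchange_big; apply: eq_bigr => z' _ /=.
    rewrite tens_suml; apply: eq_bigr => i _.
    by rewrite dag_tens tensmx_mul cmx_dag cmxM.
  transitivity (\sum_z id_ a *t cmx (op b z k *m (@uop _ _ _ _ b X z l)^t*)).
    apply: eq_bigr => z _; rewrite -[RHS](delta_sum' z
      (fun z' => id_ a *t cmx (op b z k *m (@uop _ _ _ _ b X z' l)^t*))).
    apply: eq_bigr => z' _; rewrite (us_coiso usa).
    by rewrite -[_%:M]scalemx1 tensZl.
  by rewrite -tens_sumr -cmx_sum K1 cmx_scalar cj_nat tens_scalar mul1r.
- move=> X Y f l i /=.
  transitivity (\sum_z \sum_z' fmor F' f z' z *: (op a z i *t cmx (op b z' l))).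
    under eq_bigr do rewrite uop_mix scaler_sumr.
    rewrite exchange_big; apply: eq_bigr => z _ /=.
    transitivity (op a z i *t cmx (\sum_k (imx (inter_dag f)) k l *: @uop _ _ _ _ b X z k)).
      rewrite cmx_sum tens_sumr; apply: eq_bigr => k _.
      by rewrite cmxZ tensZr /= dagE conjCK.
    rewrite -(us_nat usb (inter_dag f)) fmor_dag // cmx_sum tens_sumr.
    by apply: eq_bigr => z' _; rewrite cmxZ dagE conjCK tensZr.
  rewrite exchange_big /=.
  transitivity (\sum_z' (\sum_j imx f j i *: op a z' j) *t cmx (op b z' l)).
    apply: eq_bigr => z' _; rewrite -(us_nat usa) tens_suml.
    by apply: eq_bigr => z _; rewrite tensZl.
  under [RHS]eq_bigr do rewrite uop_mix scaler_sumr.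
  rewrite [RHS]exchange_big; apply: eq_bigr => z' _ /=.
  by rewrite tens_suml; apply: eq_bigr => z _; rewrite tensZl.
- move=> X Y K i j; case: (mxtens_indexP K) => k l {K} /=.
  rewrite scale_delta_sum.
  have [m1 _] := fmul_unitary fF' X Y.
  pose P I J := (op a (mxtens_unindex I).1 i *m op a (mxtens_unindex I).2 j) *t
    cmx (op b (mxtens_unindex J).1 k *m op b (mxtens_unindex J).2 l) : 'M[C]_(a * b).
  transitivity (\sum_I \sum_J ((fmul F' X Y)^t* *m fmul F' X Y) J I *: P I J).
    rewrite uop_mix.
    under eq_bigr do rewrite !(uop_tens usa) (uop_tens usb).
    transitivity (\sum_u \sum_I \sum_J ((fmul F' X Y u J)^* * fmul F' X Y u I) *: P I J).
      apply: eq_bigr => u _; rewrite sum_mxtens tens_suml; apply: eq_bigr => v _.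
      rewrite tens_suml; apply: eq_bigr => w _; rewrite sum_mxtens cmx_sum tens_sumr.
      apply: eq_bigr => v' _; rewrite cmx_sum tens_sumr; apply: eq_bigr => w' _.
      by rewrite cmxZ tensZl tensZr scalerA mulrC /P !mxtens_indexK.
    rewrite exchange_big; apply: eq_bigr => I _ /=; rewrite exchange_big.
    apply: eq_bigr => J _ /=; rewrite mxE scaler_suml; apply: eq_bigr => u _.
    by rewrite dagE.
  transitivity (\sum_I P I I).
    apply: eq_bigr => I _; rewrite m1.
    by under eq_bigr do rewrite mxE; rewrite delta_sum.
  transitivity (@uop _ _ _ _ (upt_mix a b) X k i *m @uop _ _ _ _ (upt_mix a b) Y l j).
    rewrite !uop_mix mulmx_suml sum_mxtens; apply: eq_bigr => v _.
    rewrite mulmx_sumr; apply: eq_bigr => w _.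
    by rewrite tensmx_mul -cmxM /P !mxtens_indexK.
  rewrite (bigD1 k) //= [X in _ + X]big1 => [|k' /negPf kk]; last first.
    by apply: big1 => l' _; rewrite mxE eq_mxtens eq_sym kk scale0r.
  rewrite (bigD1 l) //= [X in _ + X + _]big1 => [|l' /negPf ll]; last first.
    by rewrite mxE eq_mxtens [l == l']eq_sym ll andbF scale0r.
  by rewrite mxE eqxx scale1r !addr0.
- move=> K; rewrite (ord1 (K : 'I_1)) /=.
  rewrite (scale_delta_sum (0 : 'I_1) (fun I : 'I_1 => @uop _ _ _ _ (upt_mix a b) (unit_corep A) (0 : 'I_1) I)) uop_mix.
  have [u1 _] := funit_unitary fF'.
  under eq_bigr do rewrite (uop_unit usa) (uop_unit usb) cmx_scalar tens_scalar.
  rewrite -raddf_sum /=; congr _%:M.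
  have /matrixP/(_ 0 0) := u1; rewrite mxE => <-.
  by apply: eq_bigr => z _; rewrite dagE mulrC.
Qed.

End Mix.

Section FrobOfUpt.
Variable R : realType.
Local Notation C := R[i].
Variable A : hopfStarAlg R.
Hypothesis hA : is_cqg A.
Local Notation F := (canonical_functor A).
Local Notation id_ n := (1%:M : 'M[C]_n).
Local Notation op a := (@uop _ _ _ _ a _).

Lemma ket4_ext d r (f g : 'M[C]_(r, d * d * (d * d))) :
  (forall i j k l, f *m (ket R i *k ket R j *k (ket R k *k ket R l)) =
                   g *m (ket R i *k ket R j *k (ket R k *k ket R l))) -> f = g.
Proof.
move=> fg; apply: mx_ket_ext => x; case: (mxtens_indexP x) => ij kl.
case: (mxtens_indexP ij) => i j; case: (mxtens_indexP kl) => k l.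
by rewrite !ket_tv.
Qed.

(** In the product of sum_z a_zi P b_zj^+ and sum_w b_wj Q c_wk^+, summed over j,
    the adjoints of b give the Kronecker delta of z and w. *)
Lemma mxprod_mod (F' : functorData A) (a b c : uptData F F') : is_upt b ->
  @is_modification _ _ _ _ (upt_comp (upt_mix a b) (upt_mix b c)) (upt_mix a c)
    (mxprod R a b c).
Proof.
move=> ub; apply/is_modificationP => X k i; apply: mx_vec2_ext => P Q.
rewrite -!mulmxA mxprod_vec uop_mix_vec uop_comp mulmx_suml mulmx_sumr.
transitivity (\sum_j mxprod R a b c *m
   (vec (\sum_z op a z i *m P *m (op b z j)^t*) *k vec (\sum_w op b w j *m Q *m (op c w k)^t*))).
  by apply: eq_bigr => j _; rewrite tensmx_tv !uop_mix_vec.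
under eq_bigr do rewrite mxprod_vec; rewrite -vec_sum; congr vec.
have kb := (upt_conj_unitary hA ub X).2.
transitivity (\sum_z \sum_w op a z i *m P *m (\sum_j (@uop _ _ _ _ b X z j)^t* *m op b w j) *m
    Q *m (op c w k)^t*).
  under eq_bigr do rewrite mulmx_suml.
  rewrite exchange_big; apply: eq_bigr => z _ /=.
  under eq_bigr do rewrite mulmx_sumr.
  rewrite exchange_big; apply: eq_bigr => w _ /=.
  rewrite mulmx_sumr !mulmx_suml; apply: eq_bigr => j _.
  by rewrite !mulmxA.
apply: eq_bigr => z _; rewrite (bigD1 z) //= [X in _ + X]big1 => [|w /negPf wz].
  by rewrite kb eqxx mulmx1 addr0 !mulmxA.
by rewrite kb eq_sym wz raddf0 mulmx0 !mul0mx.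
Qed.

Lemma frob_unit_mod (F' : functorData A) (a : uptData F F') X k i :
  is_upt a ->
  end_unit R a *m @uop _ _ _ _ (upt_id F) X k i =
  @uop _ _ _ _ (upt_mix a a) X k i *m end_unit R a.
Proof.
move=> ua; have [K1 _] := upt_conj_unitary hA ua X.
rewrite uop_id mul_mx_scalar end_unit_vec -scalemxAr uop_mix_vec.
under [in RHS]eq_bigr do rewrite mulmx1.
rewrite K1 scalerA mulrC -scalerA -vecZ scalemx1 eq_sym //.
Qed.

Lemma end_mulA d e1 e2 :
  end_mul R d *m (end_mul R d *t id_ (d * d)) =
  scomp (scomp (end_mul R d) (id_ (d * d) *t end_mul R d) e1)
    (id_ (d * d * (d * d) * (d * d))) e2.
Proof.
apply: mx_tv3_ext => x y z; rewrite -[x]unvecK -[y]unvecK -[z]unvecK.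
rewrite !scompE mul1mx cast_tvA castmx_id -mulmxA !tensmx_tv !mul1mx !end_mul_vec.
by rewrite tvZl tvZr -!scalemxAr !end_mul_vec mulmxA.
Qed.

Lemma end_mul1l d e1 e2 : (0 < d)%N ->
  scomp (scomp (end_mul R d) (end_unit R d *t id_ (d * d)) e1) (id_ (d * d)) e2 =
  id_ (d * d).
Proof.
move=> d0; apply: mx_cV_ext => x; rewrite -[x]unvecK.
rewrite !scompE mul1mx cast_1tvl castmx_id tensmx_tv mulmx1 mul1mx end_unit_vec tvZl.
by rewrite -scalemxAr end_mul_vec mul1mx scalerA divff ?scale1r ?mul1mx ?sqrtd_neq0.
Qed.

Lemma end_mul1r d e1 e2 : (0 < d)%N ->
  scomp (scomp (end_mul R d) (id_ (d * d) *t end_unit R d) e1) (id_ (d * d)) e2 =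
  id_ (d * d).
Proof.
move=> d0; apply: mx_cV_ext => x; rewrite -[x]unvecK.
rewrite !scompE mul1mx cast_1tvr castmx_id tensmx_tv mulmx1 mul1mx end_unit_vec tvZr.
by rewrite -scalemxAr end_mul_vec mulmx1 scalerA divff ?scale1r ?mul1mx ?sqrtd_neq0.
Qed.

Lemma end_frobl d e :
  scomp (end_mul R d *t id_ (d * d)) (id_ (d * d) *t (end_mul R d)^t*) e =
  (end_mul R d)^t* *m end_mul R d.
Proof.
apply: ket4_ext => i j k l; rewrite scompE -mulmxA end_mul_ket -scalemxAr end_mul_dag_ket.
rewrite tensmx_tv mul1mx end_mul_dag_ket tvZr castZ -scalemxAr tv_sumr cast_sum mulmx_sumr.
under [in LHS]eq_bigr do rewrite cast_tvA' tensmx_tv mul1mx end_mul_ket tvZl.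
by rewrite -scaler_sumr !scalerA mulrC.
Qed.

Lemma end_frobr d e :
  scomp (id_ (d * d) *t end_mul R d) ((end_mul R d)^t* *t id_ (d * d)) e =
  (end_mul R d)^t* *m end_mul R d.
Proof.
apply: ket4_ext => i j k l; rewrite scompE -mulmxA end_mul_ket -scalemxAr end_mul_dag_ket.
rewrite tensmx_tv mul1mx end_mul_dag_ket tvZl castZ -scalemxAr tv_suml cast_sum mulmx_sumr.
under [in LHS]eq_bigr do rewrite cast_tvA tensmx_tv mul1mx end_mul_ket tvZr.
by rewrite -scaler_sumr !scalerA mulrC.
Qed.

(** The Frobenius equations hold in every matrix algebra; equivariance of the product
    is [mxprod_mod], and that of the unit is the unitarity of the adjoints. *)
Theorem frob_of_upt_simple (F' : functorData A) (a : uptData F F') :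
  is_upt a -> is_simple_frobenius (frob_of_upt (existT _ F' a)).
Proof.
move=> ua; have us := (is_uptP a).1 ua; have d0 := us_dim us.
split.
  split.
  - exact: upt_mix_is_upt.
  - by rewrite /= end_mulE; apply: mod_scale; exact: mxprod_mod.
  - by apply/is_modificationP => X k i; exact: frob_unit_mod.
  - exact: end_mulA.
  - exact: end_mul1l.
  - exact: end_mul1r.
  - exact: end_frobl.
  - exact: end_frobr.
exists a; split => //; exists 1%:M; split.
- by split; rewrite dag1 mulmx1.
- by rewrite mul1mx tens11 mulmx1.
- by rewrite mul1mx.
Qed.

Lemma upt_comp_unitary (F1 F2 F3 : functorData A) (a : uptData F1 F2) (b : uptData F2 F3) X :
  upt_spec a -> upt_spec b -> unitary (ucomp (upt_comp a b) X).
Proof.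
move=> ua ub; rewrite ucomp_umat; split.
  apply/umat_isometry => i j.
  transitivity (\sum_p \sum_q ((op a p i)^t* *m op a q j) *t
      (\sum_k (@uop _ _ _ _ b X k p)^t* *m @uop _ _ _ _ b X k q)).
    under eq_bigr do rewrite !uop_comp dag_sum mulmx_suml.
    rewrite exchange_big; apply: eq_bigr => p _ /=.
    under eq_bigr do rewrite mulmx_sumr.
    rewrite exchange_big; apply: eq_bigr => q _ /=.
    by rewrite tens_sumr; apply: eq_bigr => k _; rewrite dag_tens tensmx_mul.
  transitivity (((i == j)%:R%:M : 'M[C]_a) *t (1%:M : 'M[C]_b)); last by rewrite tens_scalar mulr1.
  rewrite -(us_iso ua) tens_suml; apply: eq_bigr => p _.
  rewrite (bigD1 p) //= [X in _ + X]big1 => [|q /negPf qp].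
    by rewrite (us_iso ub) eqxx addr0.
  by rewrite (us_iso ub) eq_sym qp raddf0 tensmx0.
apply/umat_coisometry => k l.
transitivity (\sum_p \sum_q (\sum_i op a p i *m (op a q i)^t*) *t
      (@uop _ _ _ _ b X k p *m (@uop _ _ _ _ b X l q)^t*)).
  under eq_bigr do rewrite !uop_comp dag_sum mulmx_suml.
  rewrite exchange_big; apply: eq_bigr => p _ /=.
  under eq_bigr do rewrite mulmx_sumr.
  rewrite exchange_big; apply: eq_bigr => q _ /=.
  by rewrite tens_suml; apply: eq_bigr => i _; rewrite dag_tens tensmx_mul.
transitivity ((1%:M : 'M[C]_a) *t ((k == l)%:R%:M : 'M[C]_b)); last by rewrite tens_scalar mul1r.
rewrite -(us_coiso ub) tens_sumr; apply: eq_bigr => p _.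
rewrite (bigD1 p) //= [X in _ + X]big1 => [|q /negPf qp].
  by rewrite (us_coiso ua) eqxx addr0.
by rewrite (us_coiso ua) eq_sym qp raddf0 tens0mx.
Qed.

End FrobOfUpt.

(** * Kraus decompositions *)

Section Kraus.
Variable R : realType.
Local Notation C := R[i].
Local Notation id_ n := (1%:M : 'M[C]_n).

(** Together with a count of dimensions, unitarity of the matrix of adjoints. *)
Definition fam_adj_coiso d n m (f : 'I_n -> 'I_m -> 'M[C]_d) :=
  forall k l, \sum_i (f k i)^t* *m f l i = (k == l)%:R%:M.

Lemma pfam_adj_coiso d n m n' m' (f : 'I_n -> 'I_m -> 'M[C]_d) (g : 'I_n' -> 'I_m' -> 'M[C]_d) :
  fam_adj_coiso f -> fam_adj_coiso g -> fam_adj_coiso (pfam f g).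
Proof.
move=> f1 g1 K L; case: (mxtens_indexP K) => k k'; case: (mxtens_indexP L) => l l'.
rewrite sum_mxtens eq_mxtens exchange_big.
transitivity (\sum_j (g k' j)^t* *m (\sum_i (f k i)^t* *m f l i) *m g l' j).
  apply: eq_bigr => j _; rewrite mulmx_sumr mulmx_suml; apply: eq_bigr => i _.
  by rewrite !pfamE dagM !mulmxA.
under eq_bigr do rewrite f1 mul_mx_scalar -scalemxAl.
by rewrite -scaler_sumr g1 scale_scalar_mx -natrM mulnb.
Qed.

(** Contracting the equation with the adjoints of s and t shows that the matrices
    sum_j a_vj^+ t_wj satisfy X A = B X for all X with B = sum_i s_vi^+ b_wi; so both
    are the same scalar c_vw, and contracting with t alone expresses b through s. *)
Lemma kraus_scalars d p q m l (s : 'I_p -> 'I_m -> 'M[C]_d) (a : 'I_p -> 'I_l -> 'M[C]_d)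
    (b : 'I_q -> 'I_m -> 'M[C]_d) (t : 'I_q -> 'I_l -> 'M[C]_d) :
  (0 < d)%N -> fam_adj_coiso s -> fam_adj_coiso t ->
  (forall X i j, \sum_v s v i *m X *m (a v j)^t* = \sum_w b w i *m X *m (t w j)^t*) ->
  exists c : 'M[C]_(p, q),
    (forall v w, c v w = d%:R^-1 * \sum_i \tr ((s v i)^t* *m b w i)) /\
    (forall w i, b w i = \sum_v c v w *: s v i).
Proof.
move=> d0 s1 t1 E.
pose Ac v w := \sum_j (a v j)^t* *m t w j.
pose Bc v w := \sum_i (s v i)^t* *m b w i.
have E1 X w i : \sum_v s v i *m X *m Ac v w = b w i *m X.
  transitivity (\sum_j (\sum_v s v i *m X *m (a v j)^t*) *m t w j).
    under [RHS]eq_bigr do rewrite mulmx_suml; rewrite [RHS]exchange_big.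
    apply: eq_bigr => v _ /=; rewrite /Ac mulmx_sumr; apply: eq_bigr => j _.
    by rewrite !mulmxA.
  under eq_bigr do rewrite E mulmx_suml; rewrite exchange_big /=.
  transitivity (\sum_w' (w' == w)%:R *: (b w' i *m X)); last by rewrite delta_sum.
  apply: eq_bigr => w' _; under eq_bigr do rewrite -mulmxA.
  by rewrite -mulmx_sumr t1 mul_mx_scalar.
have E2 X v w : X *m Ac v w = Bc v w *m X.
  transitivity (\sum_i (s v i)^t* *m (\sum_v' s v' i *m X *m Ac v' w)).
    under eq_bigr do rewrite mulmx_sumr; rewrite exchange_big /=.
    transitivity (\sum_v' (v == v')%:R *: (X *m Ac v' w)); first by rewrite delta_sum'.
    apply: eq_bigr => v' _; rewrite -mul_scalar_mx -s1 mulmx_suml.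
    by apply: eq_bigr => i _; rewrite !mulmxA.
  by rewrite /Bc mulmx_suml; apply: eq_bigr => i _; rewrite E1 mulmxA.
have cP (vw : 'I_p * 'I_q) :
    exists c : C, Ac vw.1 vw.2 = c%:M /\ Bc vw.1 vw.2 = c%:M.
  by apply: central_scalar => X; exact: E2.
have [c cE] := choice cP.
exists (\matrix_(v, w) c (v, w)); split=> [v w|w i].
  rewrite mxE -mxtrace_sum -/(Bc v w) (cE (v, w)).2 mxtrace_scalar -[c (v, w) *+ d]mulr_natl.
  by rewrite mulKf // pnatr_eq0 -lt0n.
have := E1 1%:M w i; rewrite mulmx1 => <-; apply: eq_bigr => v _.
by rewrite mulmx1 (cE (v, w)).1 mul_mx_scalar mxE.
Qed.

Lemma projection_split N (p : 'M[C]_N) : p ^t* = p -> p *m p = p ->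
  exists n (i : 'M[C]_(N, n)), Defs.isometry i /\ i *m i ^t* = p.
Proof.
move=> pd pp; pose G := schmidt (row_base p).
have rN : (\rank p <= N)%N by exact: rank_leq_row.
have G1 : G *m G ^t* = 1%:M by apply/unitarymxP; exact: schmidt_unitarymx.
have Gp : (G :=: p)%MS.
  apply: eqmx_trans (eq_row_base p); apply: eqmx_schmidt_free.
  exact: row_base_free.
have [D DG] : exists D, p = D *m G by apply/submxP; rewrite Gp.
have GE : G *m p = G.
  have [D' D'p] : exists D', G = D' *m p by apply/submxP; rewrite Gp.
  by rewrite D'p -mulmxA pp.
exists (\rank p), (G ^t*); rewrite /Defs.isometry trmxCK; split=> //.
have pG : p *m G ^t* = G ^t*.
  by have := congr1 (fun M => M ^t*) GE; rewrite dagM pd.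
have E : D *m G *m (G ^t* *m G) = D *m G.
  by rewrite -mulmxA (mulmxA G) G1 mul1mx.
by rewrite -DG mulmxA pG in E.
Qed.

Lemma vec_dot m n (X Y : 'M[C]_(m, n)) : ((vec X)^t* *m vec Y) 0 0 = \tr (X^t* *m Y).
Proof.
rewrite tr_adj_mul mxE sum_mxtens; apply: eq_bigr => i _; apply: eq_bigr => j _.
by rewrite dagE !vecE.
Qed.

Lemma tr_nondeg n m (X : 'M[C]_(n, m)) : (forall Y, \tr (Y *m X) = 0) -> X = 0.
Proof. by move=> /(_ (X^t*)); exact: tr_eq0. Qed.

Lemma castket n n' (e : n = n') (i : 'I_n) :
  castmx (e, erefl) (ket R i) = ket R (cast_ord e i).
Proof. by case: n' / e; rewrite castmx_id cast_ord_id. Qed.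

End Kraus.

(** * A simple Frobenius monoid as an action on matrices *)

Section SimpleFrobenius.
Variable R : realType.
Local Notation C := R[i].
Variable A : hopfStarAlg R.
Hypothesis hA : is_cqg A.
Local Notation F := (canonical_functor A).
Local Notation id_ n := (1%:M : 'M[C]_n).

Variables (B : frobData A) (d : nat) (f : 'M[C]_(d * d, B)).
Hypotheses (frB : is_frobenius B) (d0 : (0 < d)%N) (fB : is_end_iso f).

Let ff1 : f ^t* *m f = 1%:M. Proof. by case: fB => -[]. Qed.
Let ff2 : f *m f ^t* = 1%:M. Proof. by case: fB => -[]. Qed.
Let fm : f *m fr_mul B = end_mul R d *m (f *t f). Proof. by case: fB. Qed.
Let fu : f *m fr_unit B = end_unit R d. Proof. by case: fB. Qed.

(** The operators of the Frobenius monoid in standard form. *)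
Definition std_op (V : corep A) (k i : 'I_(F V)) : 'M[C]_(d * d) :=
  f *m @uop _ _ _ _ B V k i *m f ^t*.

Lemma standard_compE V : standard_comp f V = umat (@std_op V).
Proof.
rewrite /standard_comp; apply: mx_ket_ext => x; case: (mxtens_indexP x) => i h.
rewrite ket_tv umatE -!mulmxA tensmx_tv mul1mx ucomp_umat umatE mulmx_sumr.
by apply: eq_bigr => k _; rewrite tensmx_tv mul1mx !mulmxA.
Qed.

Let usB : upt_spec B. Proof. by apply/is_uptP; case: frB. Qed.
Let acB V := upt_conj_unitary hA (frob_is_upt frB) V.

Lemma std_op_dag V k i : (@std_op V k i)^t* = f *m (@uop _ _ _ _ B V k i)^t* *m f^t*.
Proof. by rewrite /std_op !dagM trmxCK mulmxA. Qed.

Lemma std_conj (X Y : 'M[C]_B) :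
  (f *m X *m f^t*) *m (f *m Y *m f^t*) = f *m (X *m Y) *m f^t*.
Proof. by rewrite !mulmxA -(mulmxA _ (f^t*) f) ff1 mulmx1. Qed.

Lemma std_conj_sum I (r : seq I) P (X : I -> 'M[C]_B) :
  \sum_(i <- r | P i) (f *m X i *m f^t*) = f *m (\sum_(i <- r | P i) X i) *m f^t*.
Proof. by rewrite mulmx_sumr mulmx_suml. Qed.

Lemma std_conj_scalar c : f *m (c%:M) *m f^t* = c%:M.
Proof. by rewrite mul_mx_scalar -scalemxAl ff2 scalemx1. Qed.

Lemma std_iso V : fam_iso (@std_op V).
Proof.
move=> i j; under eq_bigr do rewrite std_op_dag std_conj.
by rewrite std_conj_sum (us_iso usB) std_conj_scalar.
Qed.

Lemma std_adj_coiso V : fam_adj_coiso (@std_op V).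
Proof.
move=> i j; under eq_bigr do rewrite std_op_dag std_conj.
by rewrite std_conj_sum (acB V).2 std_conj_scalar.
Qed.

Lemma std_adj_iso V i j : \sum_k @std_op V k i *m (std_op k j)^t* = (i == j)%:R%:M.
Proof.
under eq_bigr do rewrite std_op_dag std_conj.
by rewrite std_conj_sum (acB V).1 std_conj_scalar.
Qed.

Lemma std_mul V k i :
  end_mul R d *m (\sum_j @std_op V j i *t std_op k j) = std_op k i *m end_mul R d.
Proof.
have /is_modificationP/(_ V k i) := fr_mul_mod frB; rewrite uop_comp => E.
have -> : \sum_j @std_op V j i *t std_op k j =
    (f *t f) *m (\sum_j @uop _ _ _ _ B V j i *t uop B k j) *m (f *t f)^t*.
  rewrite mulmx_sumr mulmx_suml; apply: eq_bigr => j _.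
  by rewrite dag_tens !tensmx_mul.
rewrite !mulmxA -fm -(mulmxA f) E.
have -> : fr_mul B = f^t* *m end_mul R d *m (f *t f) by rewrite -mulmxA -fm mulmxA ff1 mul1mx.
rewrite /std_op -!mulmxA; do 3 congr (_ *m _).
by rewrite dag_tens tensmx_mul ff2 tens11 mulmx1.
Qed.

Lemma std_unit V k i : @std_op V k i *m end_unit R d = (k == i)%:R *: end_unit R d.
Proof.
have /is_modificationP/(_ V k i) := fr_unit_mod frB; rewrite uop_id mul_mx_scalar => E.
rewrite -fu /std_op -!mulmxA (mulmxA (f^t*)) ff1 mul1mx -E.
by rewrite -scalemxAr.
Qed.

Definition std_act V (k i : 'I_(F V)) (Y : 'M[C]_d) : 'M[C]_d := unvec (std_op k i *m vec Y).

Lemma std_actE V k i Y : @std_op V k i *m vec Y = vec (std_act k i Y).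
Proof. by rewrite unvecK. Qed.

Lemma std_actM V (k i : 'I_(F V)) Y Z :
  std_act k i (Y *m Z) = \sum_j std_act j i Y *m std_act k j Z.
Proof.
have s0 := sqrtd_neq0 R d0.
apply: (can_inj (@vecK _ _ _)); apply: (scalerI (invr_neq0 s0)).
rewrite -std_actE scalemxAr -end_mul_vec mulmxA -std_mul -mulmxA mulmx_suml mulmx_sumr.
rewrite vec_sum scaler_sumr; apply: eq_bigr => j _.
by rewrite tensmx_tv !std_actE end_mul_vec.
Qed.

Lemma std_unit_vec V k i : @std_op V k i *m vec (id_ d) = (k == i)%:R *: vec (id_ d).
Proof.
have s0 := sqrtd_neq0 R d0; apply: (scalerI s0).
have := std_unit k i; rewrite end_unit_vec -scalemxAr => ->.
by rewrite !scalerA mulrC.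
Qed.

Lemma std_unit_dag V k i : (@std_op V k i)^t* *m vec (id_ d) = (k == i)%:R *: vec (id_ d).
Proof.
transitivity (\sum_l (std_op l i)^t* *m (@std_op V l k *m vec (id_ d))).
  under eq_bigr do rewrite std_unit_vec -scalemxAr.
  by rewrite delta_sum.
under eq_bigr do rewrite mulmxA.
by rewrite -mulmx_suml std_iso mul_scalar_mx eq_sym.
Qed.

Lemma std_act_tr V (k i : 'I_(F V)) Y : \tr (std_act k i Y) = (k == i)%:R * \tr Y.
Proof.
have trE (Z : 'M[C]_d) : \tr Z = ((vec (id_ d))^t* *m vec Z) 0 0.
  by rewrite vec_dot dag1 mul1mx.
have E : (vec (id_ d))^t* *m std_op k i = (k == i)%:R *: (vec (id_ d))^t*.
  by have := congr1 (fun M => M^t*) (std_unit_dag k i); rewrite dagM trmxCK dagZ cj_nat.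
by rewrite !trE -std_actE mulmxA E -scalemxAl mxE.
Qed.

(** For x_j = b_jl(T^+)^+ and for x_j = b_lj(T) alike, the sum over j of
    tr(x_j^+ b_kj(Z)) is delta_lk tr(T^+ Z): in the first case since b is
    multiplicative and preserves the trace, in the second since the matrix of adjoints
    is unitary.  The families (b_kj(Z))_j span, so the two agree. *)
Lemma std_act_dag V (k i : 'I_(F V)) Y : (std_act k i Y)^t* = std_act i k (Y^t*).
Proof.
pose h i' j' X : 'M[C]_d := (@std_act V j' i' (X^t*))^t*.
suff hE i' j' X : h i' j' X = std_act i' j' X by rewrite -hE /h trmxCK.
have E1 l k' T Z : \sum_j \tr ((h l j T)^t* *m std_act k' j Z) = (l == k')%:R * \tr (T^t* *m Z).
  rewrite -mxtrace_sum /h; under eq_bigr do rewrite trmxCK.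
  by rewrite -std_actM std_act_tr eq_sym.
have E2 l k' T Z : \sum_j \tr ((std_act l j T)^t* *m @std_act V k' j Z) =
    (l == k')%:R * \tr (T^t* *m Z).
  transitivity (\sum_j ((vec T)^t* *m ((std_op l j)^t* *m @std_op V k' j) *m vec Z) 0 0).
    apply: eq_bigr => j _; rewrite -vec_dot -!std_actE dagM.
    by rewrite !mulmxA.
  rewrite -summxE -mulmx_suml -mulmx_sumr std_adj_coiso mul_mx_scalar -scalemxAl mxE.
  by rewrite vec_dot.
pose W j := h i' j X - std_act i' j X.
suff W0 : W j' = 0 by apply/eqP; rewrite -subr_eq0 -/(W j') W0.
apply: tr_eq0; set Z := W j'.
have E3 k' Y' : \sum_j \tr ((W j)^t* *m std_act k' j Y') = 0.
  under eq_bigr do rewrite dagB mulmxBl mxtraceB.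
  by rewrite sumrB E1 E2 subrr.
have E4 : \sum_k' \sum_j \tr ((W j)^t* *m @std_act V k' j (unvec ((std_op k' j')^t* *m vec Z))) = 0.
  by apply: big1 => k' _; exact: E3.
rewrite -E4 exchange_big /=.
transitivity (\sum_j (j == j')%:R * \tr ((W j)^t* *m Z)).
  rewrite (bigD1 j') //= big1 => [|j /negPf ->]; last by rewrite mul0r.
  by rewrite eqxx mul1r addr0.
apply: eq_bigr => j _.
transitivity (((vec (W j))^t* *m (\sum_k' @std_op V k' j *m (std_op k' j')^t*) *m vec Z) 0 0).
  by rewrite std_adj_iso mul_mx_scalar -scalemxAl [RHS]mxE vec_dot.
rewrite mulmx_sumr mulmx_suml summxE; apply: eq_bigr => k' _.
by rewrite -vec_dot -std_actE unvecK !mulmxA.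
Qed.

End SimpleFrobenius.

(** * From a simple Frobenius monoid to a transformation *)

Section Casts.
Variable R : realType.

(** The changes of bracketing in the definitions of the standard form, of p_V and
    of the structure maps of F_alpha, on basis vectors: both sides are basis vectors,
    and their positions agree. *)
Lemma cast_shape1 d F e (a : 'I_d) (i : 'I_F) (b c c' : 'I_d) :
  castmx (e : (d * F * d * (d * d) = d * (F * (d * d)) * d)%N, erefl)
    (ket R a *k ket R i *k ket R b *k (ket R c *k ket R c')) =
  ket R a *k (ket R i *k (ket R b *k ket R c)) *k ket R c'.
Proof. by rewrite -!ket_tv castket; congr ket; apply: val_inj => /=; ring. Qed.

Lemma cast_shape2 d F e (a x y : 'I_d) (k : 'I_F) (c : 'I_d) :
  castmx (e : (d * (d * d * F) * d = d * d * (d * F * d))%N, erefl)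
    (ket R a *k (ket R x *k ket R y *k ket R k) *k ket R c) =
  ket R a *k ket R x *k (ket R y *k ket R k *k ket R c).
Proof. by rewrite -!ket_tv castket; congr ket; apply: val_inj => /=; ring. Qed.

Lemma cast_shape3 d F e (a a' : 'I_d) (i : 'I_F) (h : 'I_d) :
  castmx (e : (d * d * (F * d) = d * (d * F * d))%N, erefl)
    (ket R a *k ket R a' *k (ket R i *k ket R h)) =
  ket R a *k (ket R a' *k ket R i *k ket R h).
Proof. by rewrite -!ket_tv castket; congr ket; apply: val_inj => /=; ring. Qed.

Lemma cast_shape4 d F G e (a b c x : 'I_d) (i : 'I_F) (j : 'I_G) :
  castmx (e : (d * F * d * (d * G * d) = d * F * (d * d) * (G * d))%N, erefl)
    (ket R a *k ket R i *k ket R b *k (ket R c *k ket R j *k ket R x)) =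
  ket R a *k ket R i *k (ket R b *k ket R c) *k (ket R j *k ket R x).
Proof. by rewrite -!ket_tv castket; congr ket; apply: val_inj => /=; ring. Qed.

Lemma cast_shape5 d F G e (a x : 'I_d) (i : 'I_F) (j : 'I_G) (z : 'I_1) :
  castmx (e : (d * F * 1 * (G * d) = d * (F * G) * d)%N, erefl)
    (ket R a *k ket R i *k ket R z *k (ket R j *k ket R x)) =
  ket R a *k (ket R i *k ket R j) *k ket R x.
Proof. by rewrite -!ket_tv castket; congr ket; apply: val_inj; rewrite /= (ord1 z) /=; ring. Qed.

Lemma cast_shape6 d e (a b : 'I_d) :
  castmx (e : (d * d = d * 1 * d)%N, erefl) (ket R a *k ket R b) =
  ket R a *k ket R (0 : 'I_1) *k ket R b.
Proof. by rewrite -!ket_tv castket; congr ket; apply: val_inj => /=; ring. Qed.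

Lemma scalar_ket1 (c : R[i]) : (c%:M : 'cV_1) = c *: ket R (0 : 'I_1).
Proof. by apply/colP => i; rewrite !ord1 !mxE eqxx mulr1n mulr1. Qed.

Lemma ev_ket d (i j : 'I_d) : ev R d *m (ket R i *k ket R j) = ((i == j)%:R)%:M.
Proof.
rewrite ev_tv (bigD1 i) //= big1 => [|k /negPf ki]; last by rewrite ketE ki mul0r.
by rewrite !ketE eqxx mul1r addr0.
Qed.

Lemma coev_ket1 d : coev R d *m (1%:M : 'cV_1) = \sum_c ket R c *k ket R c.
Proof. by rewrite mulmx1 coev_ket. Qed.

Lemma ket3E m n p (i i' : 'I_m) (j j' : 'I_n) (k k' : 'I_p) :
  (ket R i *k ket R j *k ket R k) (mxtens_index (mxtens_index (i', j'), k')) 0 =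
  (i' == i)%:R * (j' == j)%:R * (k' == k)%:R.
Proof. by rewrite !tvE !ketE. Qed.

Lemma cV_ket3 m n p (v : 'cV[R[i]]_(m * n * p)) :
  v = \sum_i \sum_j \sum_k v (mxtens_index (mxtens_index (i, j), k)) 0 *:
        (ket R i *k ket R j *k ket R k).
Proof.
rewrite [LHS]cV_ket sum_mxtens sum_mxtens; apply: eq_bigr => i _; apply: eq_bigr => j _.
by apply: eq_bigr => k _; rewrite !ket_tv.
Qed.

End Casts.

Section Split.
Variable R : realType.
Local Notation C := R[i].
Variable A : hopfStarAlg R.
Local Notation F := (canonical_functor A).
Local Notation id_ n := (1%:M : 'M[C]_n).
Local Notation idx3 a i b := (mxtens_index (mxtens_index (a, i), b)).
Variables (B : frobData A) (d : nat) (f : 'M[C]_(d * d, B)).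

Lemma standard_comp_ket V (i : 'I_(F V)) (b c : 'I_d) :
  standard_comp f V *m (ket R i *k (ket R b *k ket R c)) =
  \sum_k \sum_x \sum_y std_op f k i (mxtens_index (x, y)) (mxtens_index (b, c)) *:
    (ket R x *k ket R y *k ket R k).
Proof.
rewrite standard_compE umatE; apply: eq_bigr => k _.
rewrite -ket_tv [std_op f k i *m _]cV_ket sum_mxtens tv_suml; apply: eq_bigr => x _.
rewrite tv_suml; apply: eq_bigr => y _.
by rewrite mulmx_ket tvZl ket_tv.
Qed.

Lemma split_proj_ket V (a b : 'I_d) (i : 'I_(F V)) :
  split_proj f V *m (ket R a *k ket R i *k ket R b) =
  d%:R^-1 *: \sum_c \sum_k \sum_y
    std_op f k i (mxtens_index (a, y)) (mxtens_index (b, c)) *: (ket R y *k ket R k *k ket R c).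
Proof.
rewrite /split_proj -scalemxAl; congr (_ *: _).
rewrite !scompE !mul1mx cast_1tvr tensmx_tv mul1mx coev_ket1 tv_sumr cast_sum mulmx_sumr.
rewrite cast_sum mulmx_sumr cast_sum; apply: eq_bigr => c _.
rewrite cast_shape1 !tensmx_tv !mul1mx standard_comp_ket tv_sumr tv_suml.
rewrite cast_sum mulmx_sumr cast_sum; apply: eq_bigr => k _.
rewrite tv_sumr tv_suml cast_sum mulmx_sumr cast_sum.
transitivity (\sum_x (a == x)%:R *: \sum_y std_op f k i (mxtens_index (x, y))
    (mxtens_index (b, c)) *: (ket R y *k ket R k *k ket R c)); last by rewrite delta_sum'.
apply: eq_bigr => x _.
rewrite tv_sumr tv_suml cast_sum mulmx_sumr cast_sum scaler_sumr; apply: eq_bigr => y _.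
rewrite tvZr tvZl castZ -scalemxAr castZ cast_shape2 tensmx_tv mul1mx ev_ket.
rewrite cast_tv1l scalerA mulrC -scalerA mxE eqxx mulr1n.
by rewrite !scalerA mulrC.
Qed.

(** Up to 1/d, p_V and the operators of the monoid have the same entries: the
    indices of the two copies of H and H^* are exchanged. *)
Lemma split_projE V (y a c b : 'I_d) (k i : 'I_(F V)) :
  split_proj f V (idx3 y k c) (idx3 a i b) =
  d%:R^-1 * std_op f k i (mxtens_index (a, y)) (mxtens_index (b, c)).
Proof.
rewrite -mulmx_ket !ket_tv split_proj_ket [LHS]mxE; congr (_ * _).
have sc n (c' : C) (v : 'cV[C]_n) z : (c' *: v) z 0 = c' * v z 0 by rewrite mxE.
rewrite summxE (bigD1 c) //= [X in _ + X]big1 => [|c1 /negPf cc]; last first.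
  rewrite summxE big1 // => k1 _; rewrite summxE big1 // => y1 _.
  by rewrite sc ket3E [c == c1]eq_sym cc !mulr0.
rewrite summxE (bigD1 k) //= [X in _ + X + _]big1 => [|k1 /negPf kk]; last first.
  rewrite summxE big1 // => y1 _.
  by rewrite sc ket3E [k == k1]eq_sym kk !(mulr0, mul0r).
rewrite summxE (bigD1 y) //= [X in _ + X + _ + _]big1 => [|y1 /negPf yy]; last first.
  by rewrite sc ket3E [y == y1]eq_sym yy !(mulr0, mul0r).
by rewrite sc ket3E !eqxx !mulr1 !addr0.
Qed.

Variables (n : corep A -> nat) (iota : forall V, 'M[C]_(d * F V * d, n V)).

(** The operators of the square root of the monoid, see [split_upt_op]. *)
Definition kraus_op V (v : 'I_(n V)) (i : 'I_(F V)) : 'M[C]_d :=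
  \matrix_(a, h) (sqrtd R d * (iota V (idx3 a i h) v)^*).

Lemma split_upt_op V v i : @uop _ _ _ _ (split_upt iota) V v i = kraus_op v i.
Proof.
apply: (@uop_eq _ _ _ _ (split_upt iota) V (@kraus_op V)) => {v i}.
apply: mx_ket_ext => x; case: (mxtens_indexP x) => i h {x}.
rewrite !ket_tv umatE /= -scalemxAl !scompE !mul1mx cast_1tvl tensmx_tv mul1mx coev_ket1.
rewrite tv_suml cast_sum mulmx_sumr scaler_sumr.
transitivity (\sum_a \sum_v kraus_op v i a h *: (ket R a *k ket R v)).
  apply: eq_bigr => a _; rewrite cast_shape3 tensmx_tv mul1mx -!ket_tv.
  rewrite [(iota V)^t* *m _]cV_ket tv_sumr scaler_sumr; apply: eq_bigr => v _.
  by rewrite mulmx_ket dagE tvZr scalerA [kraus_op _ _ _ _]mxE.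
rewrite exchange_big; apply: eq_bigr => v _ /=.
rewrite [kraus_op v i *m _]cV_ket tv_suml; apply: eq_bigr => a _.
by rewrite mulmx_ket tvZl.
Qed.

Hypothesis d0 : (0 < d)%N.

Lemma iota_kraus V a i h v :
  iota V (idx3 a i h) v = (sqrtd R d)^-1 * (kraus_op v i a h)^*.
Proof.
rewrite mxE cjM conjCK sqrtd_conj mulrA mulVf ?mul1r //.
exact: sqrtd_neq0.
Qed.

Lemma iota_dot V W (v : 'I_(n V)) (w : 'I_(n W)) (i : 'I_(F V)) (j : 'I_(F W)) :
  \sum_a \sum_h (iota V (idx3 a i h) v)^* * iota W (idx3 a j h) w =
  d%:R^-1 * \tr ((kraus_op w j)^t* *m kraus_op v i).
Proof.
rewrite tr_adj_mul mulr_sumr; apply: eq_bigr => a _.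
rewrite mulr_sumr; apply: eq_bigr => h _.
rewrite !iota_kraus cjM conjCK fmorphV /= sqrtd_conj mulrACA sqrtdV2.
by congr (_ * _); rewrite mulrC.
Qed.

(** Together with the next two lemmas: the structure maps of F_alpha are the scalars
    which [kraus_scalars] attaches to pairs of Kraus decompositions. *)
Lemma fmor_splitE V W (g : inter V W) w v :
  fmor (split_functor iota) g w v =
  d%:R^-1 * \sum_l \sum_k imx g l k * \tr ((kraus_op v k)^t* *m kraus_op w l).
Proof.
rewrite /= -mulmx_ket -!mulmxA.
have E : ((id_ d *t imx g *t id_ d) *m (iota V *m ket R v)) =
   \sum_a \sum_l \sum_h (\sum_k imx g l k * iota V (idx3 a k h) v) *:
      (ket R a *k ket R l *k ket R h).
  rewrite [iota V *m _]cV_ket3 mulmx_sumr; apply: eq_bigr => a _.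
  transitivity (\sum_k \sum_h \sum_l imx g l k * iota V (idx3 a k h) v *:
       (ket R a *k ket R l *k ket R h)).
    rewrite mulmx_sumr; apply: eq_bigr => k _; rewrite mulmx_sumr; apply: eq_bigr => h _.
    rewrite mulmx_ket -scalemxAr !tensmx_tv !mul1mx [imx g *m _]cV_ket tv_sumr tv_suml.
    rewrite scaler_sumr; apply: eq_bigr => l _.
    by rewrite mulmx_ket tvZr tvZl scalerA mulrC.
  rewrite exchange_big /=.
  under eq_bigr do rewrite exchange_big /=.
  rewrite exchange_big /=; apply: eq_bigr => l _; apply: eq_bigr => h _.
  by rewrite scaler_suml.
rewrite E mulmx_sumr summxE.
transitivity (\sum_a \sum_l \sum_h \sum_k imx g l k *
    ((iota W (idx3 a l h) w)^* * iota V (idx3 a k h) v)).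
  apply: eq_bigr => a _; rewrite mulmx_sumr summxE; apply: eq_bigr => l _.
  rewrite mulmx_sumr summxE; apply: eq_bigr => h _.
  rewrite -scalemxAr [LHS]mxE -!ket_tv mulmx_ket dagE mulr_suml; apply: eq_bigr => k _.
  by rewrite -mulrA; congr (_ * _); rewrite mulrC.
rewrite exchange_big mulr_sumr; apply: eq_bigr => l _ /=.
under eq_bigr do rewrite exchange_big /=.
rewrite exchange_big mulr_sumr; apply: eq_bigr => k _ /=.
rewrite mulrCA -iota_dot mulr_sumr; apply: eq_bigr => a _.
by rewrite mulr_sumr.
Qed.

Lemma fmul_splitE V W u v w :
  fmul (split_functor iota) V W u (mxtens_index (v, w)) =
  d%:R^-1 * \sum_i \sum_j \tr ((kraus_op v i *m kraus_op w j)^t* *m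
     kraus_op u (mxtens_index (i, j))).
Proof.
rewrite /= [LHS]mxE -mulmx_ket ket_tv !scompE tensmx_tv.
have E : castmx (erefl, erefl) (id_ 1) = id_ 1 by rewrite castmx_id.
rewrite [iota V *m _]cV_ket3 tv_suml cast_sum mulmx_sumr cast_sum mulmx_sumr summxE.
transitivity (sqrtd R d * \sum_a \sum_i \sum_b \sum_j \sum_x
    iota V (idx3 a i b) v * iota W (idx3 b j x) w *
    (iota (tens_corep V W) (idx3 a (mxtens_index (i, j)) x) u)^*).
  congr (_ * _); apply: eq_bigr => a _.
  rewrite tv_suml cast_sum mulmx_sumr cast_sum mulmx_sumr summxE; apply: eq_bigr => i _.
  rewrite tv_suml cast_sum mulmx_sumr cast_sum mulmx_sumr summxE; apply: eq_bigr => b _.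
  rewrite mulmx_ket tvZl castZ -scalemxAr castZ -scalemxAr [LHS]mxE.
  under [RHS]eq_bigr do under eq_bigr do rewrite -mulrA.
  under [RHS]eq_bigr do rewrite -mulr_sumr.
  rewrite -mulr_sumr; congr (_ * _).
  rewrite [iota W *m _]cV_ket3 tv_sumr cast_sum mulmx_sumr cast_sum mulmx_sumr summxE.
  rewrite (bigD1 b) //= [X in _ + X]big1 => [|c /negPf cb]; last first.
    rewrite tv_sumr cast_sum mulmx_sumr cast_sum mulmx_sumr summxE big1 // => j _.
    rewrite tv_sumr cast_sum mulmx_sumr cast_sum mulmx_sumr summxE big1 // => x _.
    rewrite tvZr castZ -scalemxAr castZ -scalemxAr cast_shape4 !tensmx_tv ev_ket eq_sym cb.
    rewrite (_ : (false%:R%:M : 'cV[C]_1) = 0) ?tv0r ?tv0l; last first.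
      by apply/colP => z; rewrite !mxE mul0rn.
    rewrite (_ : castmx _ 0 = 0) ?mulmx0 ?scaler0 ?mxE //.
    by rewrite -[0](scale0r 0) castZ !scale0r.
  rewrite addr0 tv_sumr cast_sum mulmx_sumr cast_sum mulmx_sumr summxE; apply: eq_bigr => j _.
  rewrite tv_sumr cast_sum mulmx_sumr cast_sum mulmx_sumr summxE; apply: eq_bigr => x _.
  rewrite tvZr castZ -scalemxAr castZ -scalemxAr cast_shape4 !tensmx_tv ev_ket eqxx.
  rewrite scalar_ket1 scale1r !mul1mx cast_shape5 -mulmxA !tensmx_tv !mul1mx.
  by rewrite mulmx_ket [LHS]mxE -!ket_tv mulmx_ket dagE.
rewrite exchange_big !mulr_sumr; apply: eq_bigr => i _ /=.
set T := fun a b j x => iota V (idx3 a i b) v * iota W (idx3 b j x) w *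
    (iota (tens_corep V W) (idx3 a (mxtens_index (i, j)) x) u)^*.
have -> : \sum_a \sum_b \sum_j \sum_x T a b j x = \sum_j \sum_a \sum_x \sum_b T a b j x.
  rewrite [RHS]exchange_big; apply: eq_bigr => a _ /=.
  by rewrite exchange_big; apply: eq_bigr => j _ /=; rewrite exchange_big.
rewrite !mulr_sumr; apply: eq_bigr => j _; rewrite tr_adj_mul !mulr_sumr.
apply: eq_bigr => a _; rewrite !mulr_sumr; apply: eq_bigr => x _.
rewrite [(kraus_op v i *m _) _ _]mxE cj_sum mulr_suml !mulr_sumr; apply: eq_bigr => b _.
rewrite /T !iota_kraus !cjM !conjCK fmorphV /= sqrtd_conj -sqrtdV2.
have s0 := sqrtd_neq0 R d0; move: (sqrtd R d) s0 => s s0.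
by field.
Qed.

Lemma funit_splitE u :
  funit (split_functor iota) u 0 = d%:R^-1 * \tr (kraus_op u (0 : 'I_1)).
Proof.
rewrite /= [LHS]mxE /scomp coev_ket cast_sum mulmx_sumr summxE /mxtrace !mulr_sumr.
apply: eq_bigr => a _; rewrite cast_shape6 -mulmxA !tensmx_tv !mul1mx -!ket_tv mulmx_ket dagE.
by rewrite (@iota_kraus (unit_corep A) a (0 : 'I_1) a u) cjM conjCK fmorphV /= sqrtd_conj mulrA sqrtdV2.
Qed.

End Split.

Local Notation idx3 a i b := (mxtens_index (mxtens_index (a, i), b)).

Section DeltaSandwich.
Variable T : comPzRingType.

Lemma mul_delta_entry m n p q (P : 'M[T]_(m, n)) (Q : 'M[T]_(p, q)) a b x y :
  (P *m delta_mx a b *m Q) x y = P x a * Q b y.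
Proof.
rewrite mxE (bigD1 b) //= big1 => [|b' /negPf bb]; last first.
  by rewrite mxE big1 ?mul0r // => a' _; rewrite mxE bb andbF mulr0.
rewrite mxE (bigD1 a) //= big1 => [|a' /negPf aa]; last by rewrite mxE aa mulr0.
by rewrite mxE !eqxx mulr1 !addr0.
Qed.

Lemma delta_mul_delta m n p q (P : 'M[T]_(n, p)) (a : 'I_m) b c (e : 'I_q) :
  delta_mx a b *m P *m delta_mx c e = P b c *: delta_mx a e.
Proof.
apply/matrixP => x y; rewrite mxE (bigD1 c) //= big1 => [|c' /negPf cc]; last first.
  by rewrite [delta_mx c e _ _]mxE cc mulr0.
rewrite mxE (bigD1 b) //= big1 => [|b' /negPf bb]; last by rewrite mxE bb andbF mul0r.
rewrite !mxE !eqxx !addr0 andbT.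
by case: (x == a); case: (y == e); rewrite ?(mulr1, mul1r, mul0r, mulr0).
Qed.
End DeltaSandwich.

Section SplitUpt.
Variable R : realType.
Local Notation C := R[i].
Variable A : hopfStarAlg R.
Hypothesis hA : is_cqg A.
Local Notation F := (canonical_functor A).
Local Notation id_ n := (1%:M : 'M[C]_n).
Variables (B : frobData A) (d : nat) (f : 'M[C]_(d * d, B)).
Hypotheses (frB : is_frobenius B) (d0 : (0 < d)%N) (fB : is_end_iso f).

Let usB : upt_spec B. Proof. by apply/is_uptP; case: frB. Qed.
Let ff1 : f ^t* *m f = 1%:M. Proof. by case: fB => -[]. Qed.
Let ff2 : f *m f ^t* = 1%:M. Proof. by case: fB => -[]. Qed.
Let dn0 : d%:R != 0 :> C. Proof. by rewrite pnatr_eq0 -lt0n. Qed.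

Lemma std_act_nat X Y (g : inter X Y) l i Z :
  \sum_k imx g l k *: std_act f (k : 'I_(F X)) i Z =
  \sum_j imx g j i *: std_act f (l : 'I_(F Y)) j Z.
Proof.
have := us_nat usB g l i => /= /(congr1 (fun M => f *m M *m f^t* *m vec Z)).
rewrite !mulmx_sumr !mulmx_suml => E; apply: (can_inj (@vecK _ _ _)).
rewrite !vec_sum.
transitivity (\sum_i0 f *m (imx g l i0 *: @uop _ _ _ _ B X i0 i) *m f^t* *m vec Z).
  by apply: eq_bigr => k _; rewrite vecZ -std_actE /std_op -!scalemxAr -!scalemxAl.
rewrite E; apply: eq_bigr => k _.
by rewrite vecZ -std_actE /std_op -!scalemxAr -!scalemxAl.
Qed.

Lemma std_act_tens X Y (k i : 'I_(F X)) (l j : 'I_(F Y)) Z :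
  @std_act _ _ _ _ f (tens_corep X Y) (mxtens_index (k, l)) (mxtens_index (i, j)) Z =
  std_act f k i (std_act f l j Z).
Proof.
apply: (can_inj (@vecK _ _ _)); rewrite -!std_actE /std_op (uop_tens usB) /=.
rewrite (bigD1 k) //= [X in _ + X]big1 => [|k' /negPf kk]; last first.
  by apply: big1 => l' _; rewrite mxE eq_mxtens eq_sym kk scale0r.
rewrite (bigD1 l) //= [X in _ + X + _]big1 => [|l' /negPf ll]; last first.
  by rewrite mxE eq_mxtens [l == l']eq_sym ll andbF scale0r.
rewrite mxE eqxx scale1r !addr0 -!mulmxA.
by rewrite (mulmxA (f^t*) f) ff1 mul1mx.
Qed.

Lemma std_act_unit Z :
  @std_act _ _ _ _ f (unit_corep A) (0 : 'I_1) (0 : 'I_1) Z = Z.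
Proof.
apply: (can_inj (@vecK _ _ _)); rewrite -std_actE /std_op (uop_unit usB) /=.
by rewrite mxE eqxx mulmx1 ff2 mul1mx.
Qed.

Lemma std_act_delta V (k i : 'I_(F V)) (p q p' q' : 'I_d) :
  std_act f k i (delta_mx p q) p' q' = std_op f k i (mxtens_index (p', q')) (mxtens_index (p, q)).
Proof.
rewrite mxE; have -> : vec (delta_mx p q : 'M[C]_d) = ket R (mxtens_index (p, q)).
  apply/colP => z; case: (mxtens_indexP z) => z1 z2.
  by rewrite vecE ketE mxE eq_mxtens.
by rewrite mulmx_ket.
Qed.

(** Self-adjointness of p_V is compatibility of the action with the involution, and
    idempotency is its multiplicativity on matrix units. *)
Lemma split_exists : exists (n : corep A -> nat)
    (iota : forall V, 'M[C]_(d * F V * d, n V)), is_split f iota.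
Proof.
have ex V : exists ni : {n & 'M[C]_(d * F V * d, n)},
    isometry (projT2 ni) /\ projT2 ni *m (projT2 ni)^t* = split_proj f V.
  have [||n [i iP]] := @projection_split R _ (split_proj f V); last by exists (existT _ n i).
    apply/matrixP => x y; rewrite dagE.
    case: (mxtens_indexP x) => yk c; case: (mxtens_indexP yk) => y' k {x yk}.
    case: (mxtens_indexP y) => ai b; case: (mxtens_indexP ai) => a i {y ai}.
    rewrite !split_projE cjM fmorphV /= cj_nat; congr (_ * _).
    have /matrixP/(_ a y') := std_act_dag hA frB d0 fB i k (delta_mx c b).
    rewrite dagE std_act_delta => ->; rewrite trmx_delta map_delta_mx.
    by rewrite std_act_delta.
  apply/matrixP => x y.
  case: (mxtens_indexP x) => yk c; case: (mxtens_indexP yk) => y' k {x yk}.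
  case: (mxtens_indexP y) => ai b; case: (mxtens_indexP ai) => a i {y ai}.
  rewrite mxE sum_mxtens sum_mxtens split_projE -std_act_delta.
  transitivity (\sum_(b' < d) d%:R^-1 * d%:R^-1 *
      (std_act f k i ((delta_mx b b' : 'M_(d, d)) *m delta_mx b' c)) a y').
    transitivity (\sum_(a' < d) \sum_j \sum_(b' < d) d%:R^-1 * d%:R^-1 *
        (std_act f j i (delta_mx b b') a a' * std_act f k j (delta_mx b' c) a' y')).
      apply: eq_bigr => a' _; apply: eq_bigr => j _; apply: eq_bigr => b' _.
      by rewrite !split_projE -!std_act_delta mulrACA; congr (_ * _); rewrite mulrC.
    under eq_bigr do rewrite exchange_big /=.
    rewrite exchange_big; apply: eq_bigr => b' _ /=.
    rewrite (std_actM frB d0 fB) summxE mulr_sumr exchange_big; apply: eq_bigr => j _ /=.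
    by rewrite mxE mulr_sumr.
  under eq_bigr do rewrite mul_delta_mx.
  by rewrite sumr_const card_ord -[X in X = _]mulr_natl !mulrA divff // mul1r.
pose ni V := projT1 (cid (ex V)).
by exists (fun V => projT1 (ni V)), (fun V => projT2 (ni V)) => V; exact: projT2 (cid (ex V)).
Qed.

Variables (n : corep A -> nat) (iota : forall V, 'M[C]_(d * F V * d, n V)).
Hypothesis splitf : is_split f iota.

Local Notation kop := (kraus_op iota).

(** The equation iota iota^+ = p, read entrywise. *)
Lemma kraus_dec V (k i : 'I_(F V)) :
  std_op f k i = \sum_v kop v i *t cmx (kop v k).
Proof.
apply/matrixP => X Y; case: (mxtens_indexP X) => x y; case: (mxtens_indexP Y) => b c.
have -> : std_op f k i (mxtens_index (x, y)) (mxtens_index (b, c)) =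
    d%:R * split_proj f V (idx3 y k c) (idx3 x i b).
  by rewrite split_projE mulrA divff ?mul1r.
rewrite -(splitf V).2 mxE summxE mulr_sumr; apply: eq_bigr => v _.
rewrite dagE !(iota_kraus _ d0) tensmxE [cmx _ _ _]mxE cjM conjCK fmorphV /= sqrtd_conj.
rewrite mulrACA sqrtdV2.
by rewrite mulVKf // mulrC.
Qed.

Lemma kraus_act V (k i : 'I_(F V)) Y :
  std_act f k i Y = \sum_v kop v i *m Y *m (kop v k)^t*.
Proof.
apply: (can_inj (@vecK _ _ _)); rewrite -std_actE kraus_dec mulmx_suml vec_sum.
by apply: eq_bigr => v _; rewrite tens_conj_vec.
Qed.

(** The equation iota^+ iota = 1, read entrywise. *)
Lemma kraus_orth V (v w : 'I_(n V)) :
  \sum_i \tr ((kop w i)^t* *m kop v i) = d%:R * (v == w)%:R.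
Proof.
have /matrixP/(_ v w) := (splitf V).1; rewrite mxE [RHS]mxE => <-.
rewrite !sum_mxtens [X in _ = _ * X]exchange_big mulr_sumr; apply: eq_bigr => i _ /=.
transitivity (d%:R * \sum_a \sum_h (iota V (idx3 a i h) v)^* * iota V (idx3 a i h) w).
  by rewrite (iota_dot _ d0) mulrA divff // mul1r; congr (\tr _).
by congr (_ * _); apply: eq_bigr => a _; apply: eq_bigr => h _; rewrite dagE.
Qed.

Lemma kraus_indep V (c : 'I_(n V) -> C) :
  (forall i, \sum_v c v *: kop v i = 0) -> forall v, c v = 0.
Proof.
move=> c0 w; apply: (mulfI dn0); rewrite mulr0.
transitivity (\sum_i \tr ((kop w i)^t* *m \sum_v c v *: kop v i)); last first.
  by apply: big1 => i _; rewrite c0 mulmx0 mxtrace0.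
under eq_bigr do rewrite mulmx_sumr mxtrace_sum; rewrite exchange_big /=.
under eq_bigr do under eq_bigr do rewrite -scalemxAr mxtraceZ.
under eq_bigr do rewrite -mulr_sumr kraus_orth.
rewrite (bigD1 w) //= big1 => [|v /negPf ->]; last by rewrite !mulr0.
by rewrite eqxx mulr1 addr0 mulrC.
Qed.

(** Inserting the Kraus decomposition into b_ki(YZ) = sum_j b_ji(Y) b_kj(Z) gives
    sum_vw s_vi Y T_vw Z s_wk^+ = 0 for all Y and Z, with T_vw the defect.  As the s_v
    are linearly independent, T = 0. *)
Lemma kraus_adj_coiso V : fam_adj_coiso (@kraus_op _ _ _ _ iota V).
Proof.
(* the defect in the unitarity of the adjoints *)
pose T (v w : 'I_(n V)) : 'M[C]_d := \sum_i (kop v i)^t* *m kop w i - (v == w)%:R%:M.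
have T1 Y Z i k : \sum_v \sum_w kop v i *m (Y *m T v w *m Z) *m (kop w k)^t* = 0.
  have := std_actM frB d0 fB k i Y Z; rewrite kraus_act => E.
  transitivity (\sum_j std_act f j i Y *m std_act f k j Z -
      \sum_v kop v i *m (Y *m Z) *m (kop v k)^t*); last by rewrite E subrr.
  transitivity (\sum_v \sum_w (\sum_j kop v i *m Y *m (kop v j)^t* *m
     (kop w j *m Z *m (kop w k)^t*) - (v == w)%:R *: (kop v i *m (Y *m Z) *m (kop w k)^t*))).
    apply: eq_bigr => v _; apply: eq_bigr => w _.
    rewrite /T mulmxBr mulmxBl mulmxBr mulmxBl; congr (_ - _); last first.
      by rewrite mul_mx_scalar -!scalemxAl -!scalemxAr -!scalemxAl.
    rewrite mulmx_sumr !mulmx_suml mulmx_sumr mulmx_suml; apply: eq_bigr => j _.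
    by rewrite !mulmxA.
  under eq_bigr do rewrite sumrB (delta_sum' _ (fun w => _ *m (kop w k)^t*)).
  rewrite sumrB; congr (_ - _).
  under [RHS]eq_bigr do rewrite !kraus_act mulmx_suml.
  rewrite [RHS]exchange_big; apply: eq_bigr => v _ /=.
  under [RHS]eq_bigr do rewrite mulmx_sumr.
  by rewrite [RHS]exchange_big.
move=> v w; apply/eqP; rewrite -subr_eq0 -/(T v w); apply/eqP/matrixP => q r.
rewrite [RHS]mxE -[LHS]conjCK; apply: (canLR conjCK); rewrite conjC0.
move: v w; have T2 v k y b : \sum_w T v w q r * (kop w k y b)^* = 0.
  move: v; apply: kraus_indep => i; apply/matrixP => x a; rewrite [RHS]mxE.
  have /matrixP/(_ x y) := T1 (delta_mx a q) (delta_mx r b) i k; rewrite [RHS]mxE => E.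
  rewrite summxE -[RHS]E summxE; apply: eq_bigr => v _.
  rewrite [LHS]mxE mulr_suml summxE; apply: eq_bigr => w _.
  rewrite delta_mul_delta -scalemxAr -scalemxAl [RHS]mxE mul_delta_entry dagE -mulrA.
  by congr (_ * _); rewrite mulrC.
move=> v; apply: kraus_indep => k; apply/matrixP => y b; rewrite [RHS]mxE.
have := congr1 Num.conj (T2 v k y b); rewrite conjC0 cj_sum => E.
by rewrite -[RHS]E summxE; apply: eq_bigr => w _; rewrite mxE cjM conjCK.
Qed.

(** Dual to invariance of the trace under the action. *)
Lemma kraus_iso V : fam_iso (@kraus_op _ _ _ _ iota V).
Proof.
move=> k i; apply/eqP; rewrite -subr_eq0; apply/eqP; apply: tr_nondeg => Y.
rewrite mulmxBr mxtraceB mul_mx_scalar mxtraceZ eq_sym.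
have := std_act_tr frB d0 fB k i Y; rewrite eq_sym kraus_act => <-.
apply/eqP; rewrite subr_eq0; apply/eqP.
rewrite mulmx_sumr !mxtrace_sum; apply: eq_bigr => v _.
by rewrite mulmxA mxtrace_mulC !mulmxA mxtrace_mulC mulmxA.
Qed.

(** Both sides are the trace of the sum of all s_vi^+ s_vi. *)
Lemma kraus_dims V : (cdim V * d = d * n V)%N.
Proof.
apply/eqP; rewrite -(eqr_nat C) [(d * _)%N]mulnC !natrM; apply/eqP.
transitivity (\sum_(v < n V) \sum_i \tr ((kop v i)^t* *m kop v i)).
  rewrite exchange_big /=; under eq_bigr do rewrite -mxtrace_sum kraus_iso eqxx mxtrace1.
  by rewrite sumr_const card_ord -[RHS]mulr_natl.
by under eq_bigr do rewrite kraus_orth eqxx mulr1; rewrite sumr_const card_ord -[LHS]mulr_natl.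
Qed.

Lemma kraus_coiso V : fam_coiso (@kraus_op _ _ _ _ iota V).
Proof.
apply/umat_coisometry; apply: isometry_dim; last exact: kraus_dims.
by apply/umat_isometry; exact: kraus_iso.
Qed.

(** Naturality, multiplicativity and unitality each hold because two families are
    Kraus decompositions of the same map: they differ by the scalars of
    [kraus_scalars], which are the structure maps of F_alpha. *)
Theorem split_upt_is_upt : is_upt (split_upt iota).
Proof.
apply/is_uptP; split => //.
- by move=> X i j; under eq_bigr do rewrite !split_upt_op; exact: kraus_iso.
- by move=> X i j; under eq_bigr do rewrite !split_upt_op; exact: kraus_coiso.
- move=> X Y g w i.
  under eq_bigr do rewrite split_upt_op; under [RHS]eq_bigr do rewrite split_upt_op.
  have [|c [cE bE]] := @kraus_scalars R d _ _ _ _ (@kraus_op _ _ _ _ iota X)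
     (fun v l => \sum_k (imx g l k)^* *: kop v k)
     (fun w i => \sum_j imx g j i *: kop w j) (@kraus_op _ _ _ _ iota Y) d0 (@kraus_adj_coiso X) (@kraus_adj_coiso Y).
    move=> Z i' l; transitivity (\sum_k imx g l k *: std_act f (k : 'I_(F X)) i' Z).
      under [RHS]eq_bigr do rewrite kraus_act scaler_sumr.
      rewrite [RHS]exchange_big; apply: eq_bigr => v _ /=.
      rewrite dag_sum mulmx_sumr; apply: eq_bigr => k _.
      by rewrite dagZ conjCK scalemxAr.
    rewrite std_act_nat; under eq_bigr do rewrite kraus_act scaler_sumr.
    rewrite exchange_big; apply: eq_bigr => w' _ /=.
    rewrite !mulmx_suml; apply: eq_bigr => j _.
    by rewrite -!scalemxAl.
  rewrite [RHS]bE; apply: eq_bigr => v _; congr (_ *: _).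
  rewrite fmor_splitE // cE; congr (_ * _).
  rewrite exchange_big; apply: eq_bigr => k _ /=.
  by rewrite mulmx_sumr mxtrace_sum; apply: eq_bigr => l _; rewrite -scalemxAr mxtraceZ.
- move=> X Y u i j; rewrite scale_delta_sum split_upt_op.
  pose b := pfam (@kraus_op _ _ _ _ iota X) (@kraus_op _ _ _ _ iota Y).
  have kb : fam_adj_coiso b by apply: pfam_adj_coiso; exact: kraus_adj_coiso.
  have [|c [cE bE]] := @kraus_scalars R d _ _ _ _ b b
     (@kraus_op _ _ _ _ iota (tens_corep X Y)) (@kraus_op _ _ _ _ iota (tens_corep X Y))
     d0 kb (@kraus_adj_coiso _).
    move=> Z I K; case: (mxtens_indexP I) => i' j'; case: (mxtens_indexP K) => k l.
    rewrite -kraus_act std_act_tens !kraus_act sum_mxtens; apply: eq_bigr => v _.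
    rewrite mulmx_sumr mulmx_suml; apply: eq_bigr => w _.
    by rewrite /b !pfamE dagM !mulmxA.
  rewrite bE sum_mxtens; apply: eq_bigr => v _; apply: eq_bigr => w _.
  rewrite !split_upt_op /b pfamE; congr (_ *: _).
  rewrite fmul_splitE // [LHS]cE sum_mxtens; congr (_ * _).
  by apply: eq_bigr => i' _; apply: eq_bigr => j' _; rewrite /b pfamE.
- move=> u /=.
  rewrite (scale_delta_sum (0 : 'I_1) (fun I : 'I_1 => @uop _ _ _ _ (split_upt iota) (unit_corep A) u I)).
  rewrite split_upt_op.
  have k1 : fam_adj_coiso (@fam1 R d).
    by move=> i j; rewrite big_ord1 !ord1 eqxx /fam1 dag1 mulmx1.
  have [|c [cE bE]] := @kraus_scalars R d _ _ _ _ (@fam1 R d) (@fam1 R d)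
     (@kraus_op _ _ _ _ iota (unit_corep A)) (@kraus_op _ _ _ _ iota (unit_corep A))
     d0 k1 (@kraus_adj_coiso _).
    move=> Z i j; rewrite big_ord1 /fam1 mul1mx dag1 mulmx1 -kraus_act.
    by rewrite (ord1 (i : 'I_1)) (ord1 (j : 'I_1)) std_act_unit.
  rewrite bE big_ord1 scalemx1; congr _%:M.
  have := funit_splitE d0 u; rewrite /= => ->.
  rewrite cE big_ord1 /fam1 dag1 mul1mx.
  by [].
Qed.

(** The given f is already unitary and multiplicative; that it is a modification is
    the Kraus decomposition. *)
Lemma split_star_isomorphic :
  star_isomorphic B (frob_of_upt (existT _ (split_functor iota) (split_upt iota))).
Proof.
case: (fB) => fU fm fu; exists f; split=> //.
apply/is_modificationP => X k i.
have -> : @uop _ _ _ _ (frob_of_upt (existT _ (split_functor iota) (split_upt iota))) X k i =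
    std_op f k i.
  rewrite kraus_dec [LHS]uop_mix; apply: eq_bigr => v _.
  by rewrite !split_upt_op.
by rewrite /std_op -[RHS]mulmxA ff1 mulmx1.
Qed.

End SplitUpt.

(** * Monoidal isomorphisms and equivalence of transformations *)

Section MonoidalIso.
Variable R : realType.
Local Notation C := R[i].
Variable A : hopfStarAlg R.
Local Notation F := (canonical_functor A).
Local Notation id_ n := (1%:M : 'M[C]_n).

Lemma monoidal_iso_refl (F1 : functorData A) : monoidally_isomorphic F1 F1.
Proof.
exists (fun X => 1%:M); split=> [X|X Y f|X Y|].
- by split; rewrite dag1 mulmx1.
- by rewrite mulmx1 mul1mx.
- by rewrite tens11 mulmx1 mul1mx.
- by rewrite mul1mx.
Qed.

Lemma monoidal_iso_inv (F1 F2 : functorData A) (E : forall X, 'M[C]_(F2 X, F1 X)) :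
  is_monoidal_iso E -> @is_monoidal_iso _ _ F2 F1 (fun X => (E X)^t*).
Proof.
case=> U N M e; have U1 X := (U X).1; have U2 X := (U X).2; split=> [X|X Y f|X Y|].
- by split; rewrite trmxCK.
- rewrite -[LHS]mul1mx -(U1 Y) -mulmxA (mulmxA (E Y)) -N -!mulmxA U2.
  by rewrite mulmx1.
- rewrite -[LHS]mulmx1 -(tens11 R (F2 X) (F2 Y)) -(U2 X) -(U2 Y) -tensmx_mul.
  by rewrite -mulmxA (mulmxA (fmul _ _ _)) -M !mulmxA U1 mul1mx.
- by rewrite -e mulmxA U1 mul1mx.
Qed.

Lemma monoidal_iso_sym (F1 F2 : functorData A) :
  monoidally_isomorphic F1 F2 -> monoidally_isomorphic F2 F1.
Proof. by case=> E /monoidal_iso_inv ?; eexists; eassumption. Qed.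

Lemma monoidal_iso_trans (F1 F2 F3 : functorData A) :
  monoidally_isomorphic F1 F2 -> monoidally_isomorphic F2 F3 ->
  monoidally_isomorphic F1 F3.
Proof.
case=> E [U N M e] [E' [U' N' M' e']]; exists (fun X => E' X *m E X); split=> [X|X Y f|X Y|].
- have [[U1 U2] [U1' U2']] := (U X, U' X); split; rewrite dagM.
    by rewrite -mulmxA (mulmxA _ (E' X)) U1' mul1mx.
  by rewrite -mulmxA (mulmxA (E X)) U2 mul1mx.
- by rewrite mulmxA N' -!mulmxA N.
- by rewrite -mulmxA M mulmxA M' -mulmxA tensmx_mul.
- by rewrite -mulmxA e e'.
Qed.

Lemma upt_dimE (F' : functorData A) (a : uptData F F') X :
  is_upt a -> (cdim X * a = F' X * a)%N.
Proof. by case=> _ /(_ X)/unitary_dim E _ _ _; rewrite E mulnC. Qed.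

(** Each property of G holds after tensoring with H and composing with the unitary
    family of a, where it follows from the same property of the two transformations. *)
Lemma monoidal_iso_of_upts (F1 F2 : functorData A) (a : uptData F F1)
    (b : forall X, 'M[C]_(a * F2 X, F X * a))
    (G : forall X, 'M[C]_(F2 X, F1 X)) :
  is_upt a -> is_upt (UptData b) ->
  (forall X w i, @uop _ _ _ _ (UptData b) X w i =
     \sum_z G X w z *: @uop _ _ _ _ a X z i) ->
  is_monoidal_iso G.
Proof.
move=> ua ub Gab; have usa := (is_uptP _).1 ua; have usb := (is_uptP _).1 ub.
have d0 := us_dim usa.
pose al X := bmx (@uop _ _ _ _ a X).
pose be X := bmx (@uop _ _ _ _ (UptData b) X).
have GE X : be X = (G X *t id_ a) *m al X.
  rewrite bmx_scalar bmxM; apply: bmx_ext => w i; rewrite Gab.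
  by apply: eq_bigr => z _; rewrite mul_scalar_mx.
have al2 X : al X *m (al X)^t* = 1%:M by apply/fam_coisoP; exact: us_coiso usa X.
have be2 X : be X *m (be X)^t* = 1%:M by apply/fam_coisoP; exact: us_coiso usb X.
have canc X m (M M' : 'M[C]_(m, F1 X)) :
    (M *t id_ a) *m al X = (M' *t id_ a) *m al X -> M = M'.
  by apply: bmx_cancel => //; exact: us_coiso usa X.
have dims X : F1 X = F2 X.
  have E : (F1 X * a = F2 X * a)%N by rewrite -(upt_dimE X ua) -(upt_dimE X ub).
  by apply/eqP; move/eqP: E; rewrite eqn_pmul2r.
split=> [X|X Y f|X Y|].
- have G2 : G X *m (G X)^t* = 1%:M.
    apply: (tens1_inj d0); rewrite tens11 -(be2 X) GE -tens1M -dag_tens1 dagM.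
    by rewrite -mulmxA (mulmxA (al X)) al2 mul1mx.
  split=> //; have := @isometry_dim R _ _ ((G X)^t*).
  by rewrite trmxCK => H; apply: H; rewrite ?dims.
- apply: canc; rewrite -!tens1M -!mulmxA.
  have na : (fmor F1 f *t id_ a) *m al X = al Y *m (imx f *t id_ a) by exact: (fam_of_nat usa).
  have nb : (fmor F2 f *t id_ a) *m be X = be Y *m (imx f *t id_ a) by exact: (fam_of_nat usb).
  by rewrite na [RHS]mulmxA -!GE; exact: nb.
- apply: (bmx_cancel d0 (pfam_coiso (@us_coiso _ _ _ _ _ usa X) (@us_coiso _ _ _ _ _ usa Y))).
  rewrite -!tens1M -!mulmxA (fam_of_mul usa) -/(al _) -GE /be.
  rewrite -(fam_of_mul usb); congr (_ *m _).
  rewrite pfam_mulmx; apply: pfam_ext => k i; exact: Gab.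
- apply: (tens1_inj d0).
  have E (F0 : functorData A) (c : uptData F F0) :
      upt_spec c -> funit F0 *t id_ c = bmx (@uop _ _ _ _ c (unit_corep A)).
    move=> us; rewrite bmx_scalar; apply: bmx_ext => k i; rewrite (ord1 (i : 'I_1)).
    by rewrite (uop_unit us).
  by rewrite -tens1M (E _ _ usa) (E _ _ usb) -/(al _) -/(be _) GE.
Qed.

Definition upt_conj (F' : functorData A) (a : uptData F F') (d : nat) (U : 'M[C]_(a, d))
    X : 'M[C]_(d * F' X, F X * d) :=
  umat (fun k i => U^t* *m @uop _ _ _ _ a X k i *m U).

Lemma uop_conj F' (a : uptData F F') d (U : 'M[C]_(a, d)) X k i :
  @uop _ _ _ _ (UptData (upt_conj U)) X k i = U^t* *m uop a k i *m U.
Proof.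
exact: (@uop_eq _ _ _ _ (UptData (upt_conj U)) X (fun k i => U^t* *m @uop _ _ _ _ a X k i *m U)).
Qed.

Lemma upt_conj_is_upt F' (a : uptData F F') d (U : 'M[C]_(a, d)) :
  U^t* *m U = 1%:M -> U *m U^t* = 1%:M -> is_upt a -> is_upt (UptData (upt_conj U)).
Proof.
move=> U1 U2 ua; have us := (is_uptP _).1 ua; apply/is_uptP.
have cM (X Y : 'M[C]_a) : (U^t* *m X *m U) *m (U^t* *m Y *m U) = U^t* *m (X *m Y) *m U.
  by rewrite !mulmxA -(mulmxA _ U (U^t*)) U2 mulmx1.
have cD (X : 'M[C]_a) : (U^t* *m X *m U)^t* = U^t* *m X^t* *m U.
  by rewrite !dagM trmxCK mulmxA.
have cS I (r : seq I) P (X : I -> 'M[C]_a) :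
    \sum_(i <- r | P i) (U^t* *m X i *m U) = U^t* *m (\sum_(i <- r | P i) X i) *m U.
  by rewrite mulmx_sumr mulmx_suml.
have cc (c : C) : U^t* *m c%:M *m U = c%:M by rewrite mul_mx_scalar -scalemxAl U1 scalemx1.
have cZ c (X : 'M[C]_a) : c *: (U^t* *m X *m U) = U^t* *m (c *: X) *m U.
  by rewrite -scalemxAr -scalemxAl.
split.
- have E : (a = d :> nat) by symmetry; apply: unitary_dim; split; [exact: U1|exact: U2].
  by rewrite /= -E (us_dim us).
- move=> X i j; under eq_bigr do rewrite !uop_conj cD cM.
  by rewrite cS (us_iso us) cc.
- move=> X i j; under eq_bigr do rewrite !uop_conj cD cM.
  by rewrite cS (us_coiso us) cc.
- move=> X Y f l i.
  under eq_bigr do rewrite uop_conj cZ; under [RHS]eq_bigr do rewrite uop_conj cZ.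
  by rewrite !cS (us_nat us).
- move=> X Y K i j.
  under eq_bigr do rewrite uop_conj cZ.
  under [RHS]eq_bigr do under eq_bigr do rewrite !uop_conj cM cZ.
  under [RHS]eq_bigr do rewrite cS.
  by rewrite !cS (us_mul us).
- move=> K; under eq_bigr do rewrite uop_conj cZ.
  by rewrite cS (us_unit us) cc.
Qed.

End MonoidalIso.

Section SkolemNoether.
Variable R : realType.
Local Notation C := R[i].
Local Notation id_ n := (1%:M : 'M[C]_n).

(** The Skolem-Noether theorem.  As phi preserves products, the unit and the inner
    product, the automorphism psi preserves trace and adjoints.  For a unit vector v
    in the range of the projection psi(E_00), the vectors psi(E_a0) v form an
    orthonormal basis; they are the columns of U. *)
Lemma end_iso_inner d1 d2 (phi : 'M[C]_(d2 * d2, d1 * d1)) : (0 < d1)%N ->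
  unitary phi -> phi *m end_mul R d1 = end_mul R d2 *m (phi *t phi) ->
  phi *m end_unit R d1 = end_unit R d2 ->
  exists U : 'M[C]_(d2, d1), unitary U /\
    forall X, phi *m vec X = vec (U *m X *m U^t*).
Proof.
move=> d0 Up pm pu.
have dd : d1 = d2 by apply/eqP; rewrite -eqn_sqr -!mulnn (unitary_dim Up).
subst d2; case: d1 d0 phi Up pm pu => // d d0 phi [Up1 Up2] pm pu.
have s0 : sqrtd R d.+1 != 0 by exact: sqrtd_neq0.
pose psi X : 'M[C]_d.+1 := unvec (phi *m vec X).
have psiE X : phi *m vec X = vec (psi X) by rewrite unvecK.
have psiZD (c : C) X Y : psi (c *: X + Y) = c *: psi X + psi Y.
  apply: (can_inj (@vecK _ _ _)).
  by rewrite !(vecD, vecZ) -!psiE vecD vecZ mulmxDr scalemxAr.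
have psi0 : psi 0 = 0 by apply: (can_inj (@vecK _ _ _)); rewrite -psiE !vec0 mulmx0.
have psi_sum (I : finType) (c : I -> C) (X : I -> 'M_d.+1) :
    psi (\sum_i c i *: X i) = \sum_i c i *: psi (X i).
  by elim/big_rec2: _ => [|i Y Z _ <-] //; rewrite psiZD.
have psiM X Y : psi (X *m Y) = psi X *m psi Y.
  apply: (can_inj (@vecK _ _ _)); apply: (scalerI (invr_neq0 s0)).
  rewrite -psiE scalemxAr -!end_mul_vec mulmxA pm -mulmxA tensmx_tv !psiE //.
have psi1 : psi 1%:M = 1%:M.
  apply: (can_inj (@vecK _ _ _)); apply: (scalerI s0).
  by rewrite -psiE scalemxAr -!end_unit_vec.
have psi_dot X Y : \tr ((psi X)^t* *m psi Y) = \tr (X^t* *m Y).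
  by rewrite -!vec_dot -!psiE dagM -mulmxA (mulmxA (phi^t*)) Up1 mul1mx.
have psi_tr X : \tr (psi X) = \tr X.
  by have := psi_dot 1%:M X; rewrite psi1 !dag1 !mul1mx.
have psi_dag X : (psi X)^t* = psi (X^t*).
  apply/eqP; rewrite -subr_eq0; apply/eqP; apply: tr_nondeg => Z.
  have [Y ->] : exists Y, Z = psi Y.
    exists (unvec (phi^t* *m vec Z)); apply: (can_inj (@vecK _ _ _)).
    by rewrite -psiE unvecK mulmxA Up2 mul1mx.
  by rewrite mxtrace_mulC mulmxBl mxtraceB psi_dot -psiM psi_tr subrr.
pose P := psi (delta_mx 0 0).
have PP : P *m P = P by rewrite -psiM mul_delta_mx.
have [j Pj] : exists j, P *m ket R j != 0.
  apply: contrapT => Pn; have P0 : P = 0.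
    apply: mx_ket_ext => j; rewrite mul0mx; apply/eqP; apply: contrapT => /negP Pj.
    by apply: Pn; exists j.
  have : \tr P = 1 by rewrite psi_tr /mxtrace (bigD1 0) //= big1 ?addr0 => [|k /negPf k0]; rewrite mxE ?k0 //.
  by rewrite P0 mxtrace0 => /esym/eqP; rewrite oner_eq0.
pose u := P *m ket R j; pose nu := (u^t* *m u) 0 0.
have nu_tr : nu = \tr (u^t* *m u) by rewrite /mxtrace big_ord1.
have nu0 : nu != 0 by rewrite nu_tr; apply: contraNneq Pj => /tr_eq0 u0; rewrite -/u u0.
have nu_ge : 0 <= nu by rewrite nu_tr trmul_ge0.
pose r := sqrtC nu.
have rr : r * r = nu by rewrite -expr2 sqrtCK.
have r0 : r != 0 by rewrite sqrtC_eq0.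
have rC : r^* = r by apply: CrealP; rewrite ger0_real // sqrtC_ge0.
pose v := r^-1 *: u.
have vv : v^t* *m v = 1%:M.
  apply/matrixP => k l; rewrite !ord1 /v dagZ -scalemxAl -scalemxAr mxE [X in _ * X]mxE.
  rewrite -/nu -rr fmorphV /= rC mxE eqxx.
  by rewrite mulKf // mulVf.
have Pv : P *m v = v by rewrite /v -scalemxAr mulmxA PP.
pose U : 'M[C]_d.+1 := \matrix_(i, a) (psi (delta_mx a 0) *m v) i 0.
have UE a : U *m ket R a = psi (delta_mx a 0) *m v.
  by apply/colP => i; rewrite mulmx_ket mxE.
have U1 : U^t* *m U = 1%:M.
  apply/matrixP => a b.
  have -> : (U^t* *m U) a b = ((U *m ket R a)^t* *m (U *m ket R b)) 0 0.
    rewrite mxE [RHS]mxE; apply: eq_bigr => k _.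
    by rewrite !dagE !mulmx_ket.
  rewrite !UE dagM psi_dag -mulmxA (mulmxA (psi _)) -psiM trmx_delta map_delta_mx.
  rewrite mul_delta_mx_cond; case: eqP => [->|/eqP/negPf ab].
    by rewrite mulr1n -/P Pv vv mxE !eqxx mxE eqxx.
  by rewrite mulr0n psi0 mul0mx mulmx0 !mxE ab.
have U2 : U *m U^t* = 1%:M by exact: mulmx1C.
exists U; split=> // X; rewrite psiE; congr vec.
suff XU : psi X *m U = U *m X by rewrite -XU -mulmxA U2 mulmx1.
apply: mx_ket_ext => a; rewrite -!mulmxA UE mulmxA -psiM.
have -> : X *m delta_mx a 0 = \sum_b X b a *: (delta_mx b 0 : 'M_d.+1).
  apply/matrixP => x y; rewrite -[X *m _]mulmx1 mul_delta_entry summxE.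
  rewrite (bigD1 x) //= big1 => [|b /negPf bx]; last by rewrite !mxE eq_sym bx mulr0.
  by rewrite !mxE eqxx addr0 /= eq_sym.
rewrite psi_sum mulmx_suml [X *m ket R a]cV_ket mulmx_sumr; apply: eq_bigr => b _.
by rewrite mulmx_ket -[RHS]scalemxAr UE scalemxAl.
Qed.
End SkolemNoether.

Section UptEquivalence.
Variable R : realType.
Local Notation C := R[i].
Variable A : hopfStarAlg R.
Hypothesis hA : is_cqg A.
Local Notation F := (canonical_functor A).
Local Notation id_ n := (1%:M : 'M[C]_n).

Lemma runitE n p (f : 'M[C]_(n, p)) (c : C) :
  runit R n *m (f *t (c%:M : 'M_1)) = c *: (f *m runit R p).
Proof.
apply: mx_tv_ext => x y; rewrite -mulmxA tensmx_tv -scalemxAl -mulmxA /runit.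
rewrite !scompE !mul1mx !cast_tv1r -scalemxAr mul_scalar_mx [(c *: y) 0 0]mxE scalerA.
by [].
Qed.

Lemma runit_unitary n : unitary (runit R n).
Proof.
have E : (runit R n)^t* *m runit R n = 1%:M.
  have cast1 m m' (e : m = m') :
      (castmx (e, erefl m) (id_ m))^t* *m castmx (e, erefl m) (id_ m) = id_ m.
    by case: m' / e; rewrite castmx_id dag1 mulmx1.
  by rewrite /runit /scomp mul1mx cast1.
split=> //; apply: isometry_dim => //.
exact: muln1.
Qed.

Lemma uop_comp_iso (F1 F2 : functorData A) (a : uptData F F2)
    (E : forall X, 'M[C]_(F1 X, F2 X)) X k i :
  runit R a *m @uop _ _ _ _ (upt_comp a (upt_of_iso E)) X k i =
  (\sum_j E X k j *: @uop _ _ _ _ a X j i) *m runit R a.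
Proof.
rewrite uop_comp mulmx_sumr mulmx_suml; apply: eq_bigr => j _.
by rewrite uop_iso runitE scalemxAl.
Qed.

(** The factor C contributed by the natural isomorphism is absorbed in U. *)
Lemma upt_equivalentP (F1 F2 : functorData A) (a1 : uptData F F1) (a2 : uptData F F2) :
  upt_equivalent (existT _ F1 a1) (existT _ F2 a2) <->
  exists (E : forall X, 'M[C]_(F1 X, F2 X)) (U : 'M[C]_(a2, a1)),
    [/\ is_monoidal_iso E, unitary U &
      forall X k i, U *m @uop _ _ _ _ a1 X k i =
        (\sum_j E X k j *: @uop _ _ _ _ a2 X j i) *m U].
Proof.
have [r [[r1 r2] rE]] : exists r : 'M[C]_(a2, a2 * 1), unitary r /\
    forall (E : forall X, 'M[C]_(F1 X, F2 X)) X k i,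
      r *m @uop _ _ _ _ (upt_comp a2 (upt_of_iso E)) X k i =
      (\sum_j E X k j *: @uop _ _ _ _ a2 X j i) *m r.
  by exists (runit R a2); split; [exact: runit_unitary|exact: uop_comp_iso].
split.
  case=> E [Em [t [[t1 t2] /is_modificationP tm]]].
  exists E, (r *m t); split=> //.
    split; rewrite dagM.
      by rewrite -mulmxA (mulmxA _ (r)) r1 mul1mx.
    by rewrite -mulmxA (mulmxA t) t2 mul1mx.
  by move=> X k i; rewrite -mulmxA tm [LHS]mulmxA rE -[LHS]mulmxA.
case=> E [U [Em [U1 U2] UE]]; exists E; split=> //.
exists ((r)^t* *m U); split.
  split; rewrite dagM trmxCK.
    by rewrite -mulmxA (mulmxA (r)) r2 mul1mx.
  by rewrite -mulmxA (mulmxA U) U2 mul1mx.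
apply/is_modificationP => X k i; rewrite -mulmxA UE mulmxA mulmxA; congr (_ *m _).
rewrite -[RHS]mul1mx -r1 -!mulmxA; congr (_ *m _).
by rewrite mulmxA rE -mulmxA r2 mulmx1.
Qed.

(** The isomorphism of monoids is Y |-> U Y U^+; the coefficients of the unitary E
    cancel between the operators of a2 and their adjoints. *)
Lemma star_iso_of_equivalent (F1 F2 : functorData A) (a1 : uptData F F1) (a2 : uptData F F2) :
  upt_equivalent (existT _ F1 a1) (existT _ F2 a2) ->
  star_isomorphic (frob_of_upt (existT _ F1 a1)) (frob_of_upt (existT _ F2 a2)).
Proof.
case/upt_equivalentP=> E [U [[EU _ _ _] UU UE]]; have [U1 U2] := UU.
have dd : sqrtd R a1 = sqrtd R a2 by rewrite /sqrtd (unitary_dim UU).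
have phiE (X : 'M[C]_a1) : (U *t cmx U) *m vec X = vec (U *m X *m U^t*).
  exact: tens_conj_vec.
exists (U *t cmx U); split.
- split; rewrite dag_tens tensmx_mul cmx_dag -cmxM ?U1 ?U2 cmx_scalar conjC1 tens11 //.
- apply/is_modificationP => X k i; apply: mx_vec_ext => Y.
  rewrite -!mulmxA phiE !uop_mix_vec phiE; congr vec.
  rewrite mulmx_sumr mulmx_suml.
  transitivity (\sum_z \sum_j \sum_j' (E X z j * (E X z j')^*) *:
     (@uop _ _ _ _ a2 X j i *m (U *m Y *m U^t*) *m (@uop _ _ _ _ a2 X j' k)^t*)).
    apply: eq_bigr => z _; rewrite !mulmxA UE -!mulmxA -dagM UE dagM !mulmxA.
    rewrite !mulmx_suml; apply: eq_bigr => j _.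
    rewrite dag_sum mulmx_sumr; apply: eq_bigr => j' _.
    rewrite dagZ -!scalemxAl -!scalemxAr scalerA !mulmxA.
    by [].
  rewrite exchange_big; apply: eq_bigr => j _ /=; rewrite exchange_big /=.
  rewrite -[RHS](delta_sum j (fun j' => uop a2 j i *m (U *m Y *m U ^t*) *m
     (@uop _ _ _ _ a2 X j' k)^t*)).
  apply: eq_bigr => j' _; rewrite -scaler_suml; congr (_ *: _).
  have /matrixP/(_ j' j) := (EU X).1; rewrite !mxE => <-.
  by apply: eq_bigr => z _; rewrite !mxE mulrC.
- apply: mx_vec2_ext => X Y; rewrite -!mulmxA end_mul_vec tensmx_tv -scalemxAr !phiE.
  rewrite end_mul_vec dd; congr (_ *: vec _).
  by rewrite !mulmxA -(mulmxA _ (U^t*) U) U1 mulmx1.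
- by rewrite /= !end_unit_vec -scalemxAr phiE mulmx1 U2 dd.
Qed.

(** The isomorphism is conjugation by some U, so the a1_zi and the
    U^+ a2_zi U are Kraus decompositions of the same maps.  The scalars relating them form a
    monoidal isomorphism by [monoidal_iso_of_upts]. *)
Lemma equivalent_of_star_iso (F1 F2 : functorData A) (a1 : uptData F F1) (a2 : uptData F F2) :
  is_upt a1 -> is_upt a2 ->
  star_isomorphic (frob_of_upt (existT _ F1 a1)) (frob_of_upt (existT _ F2 a2)) ->
  upt_equivalent (existT _ F1 a1) (existT _ F2 a2).
Proof.
move=> ua1 ua2 [phi [Up /is_modificationP pmod pm pu]].
have us1 := (is_uptP _).1 ua1; have d0 := us_dim us1.
have [U [[U1 U2] pE]] := end_iso_inner d0 Up pm pu.
pose t := UptData (upt_conj U).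
have ut : is_upt t by exact: upt_conj_is_upt.
have ust := (is_uptP _).1 ut.
have ac (F' : functorData A) (a : uptData F F') : is_upt a -> forall X, fam_adj_coiso (@uop _ _ _ _ a X).
  by move=> ua X; exact: (upt_conj_unitary hA ua X).2.
have ex X : exists c : 'M[C]_(F1 X, F2 X),
    forall w i, @uop _ _ _ _ t X w i = \sum_z c z w *: @uop _ _ _ _ a1 X z i.
  have [|c [_ cE]] := @kraus_scalars R a1 _ _ _ _ (@uop _ _ _ _ a1 X) (@uop _ _ _ _ a1 X)
     (@uop _ _ _ _ t X) (@uop _ _ _ _ t X) d0 (@ac _ _ ua1 X) (@ac _ _ ut X); last by exists c.
  move=> Y i k.
  have /(congr1 (mulmx^~ (vec Y))) := pmod X k i.
  rewrite -!mulmxA pE !uop_mix_vec pE => /(can_inj (@vecK _ _ _)) E.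
  transitivity (U^t* *m (U *m (\sum_z uop a1 z i *m Y *m (@uop _ _ _ _ a1 X z k)^t*) *m U^t*) *m U).
    by rewrite !mulmxA U1 mul1mx -mulmxA U1 mulmx1.
  rewrite E mulmx_sumr mulmx_suml; apply: eq_bigr => z _.
  by rewrite !uop_conj !dagM trmxCK !mulmxA.
pose G X : 'M[C]_(F2 X, F1 X) := (projT1 (cid (ex X)))^T.
have GE X w i : @uop _ _ _ _ t X w i = \sum_z G X w z *: @uop _ _ _ _ a1 X z i.
  by rewrite (projT2 (cid (ex X)) w i); apply: eq_bigr => z _; rewrite mxE.
have Giso : is_monoidal_iso G.
  exact: monoidal_iso_of_upts ua1 ut GE.
apply/upt_equivalentP; exists (fun X => (G X)^t*), U; split=> //.
  exact: monoidal_iso_inv.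
move=> X k i; have [G1 _] : unitary (G X) by case: Giso.
have E : @uop _ _ _ _ a1 X k i = \sum_j (G X)^t* k j *: @uop _ _ _ _ t X j i.
  under eq_bigr do rewrite GE scaler_sumr; rewrite exchange_big /=.
  rewrite -[LHS](delta_sum' k (fun z => @uop _ _ _ _ a1 X z i)); apply: eq_bigr => z _.
  under eq_bigr do rewrite scalerA; rewrite -scaler_suml; congr (_ *: _).
  by have /matrixP/(_ k z) := G1; rewrite mxE [RHS]mxE => <-.
rewrite E mulmx_sumr mulmx_suml; apply: eq_bigr => j _.
by rewrite uop_conj -scalemxAr -scalemxAl !mulmxA U2 mul1mx.
Qed.

End UptEquivalence.

(** * From Morita equivalence to monoidal isomorphism *)

Section BiRep.
Variable R : realType.
Local Notation C := R[i].
Local Notation id_ n := (1%:M : 'M[C]_n).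

(** L(X, Y) stands for m |-> X m Y on a bimodule over two matrix algebras, which is
    why the arguments in the second variable are multiplied in the reverse order. *)
Record birep (d1 d2 K : nat) (L : 'M[C]_d1 -> 'M[C]_d2 -> 'M[C]_K) : Prop := BiRep {
  br_linl : forall Y, linear (L^~ Y);
  br_linr : forall X, linear (L X);
  br_mul : forall X X' Y Y', L X Y' *m L X' Y = L (X *m X') (Y *m Y');
  br_one : L 1%:M 1%:M = 1%:M;
  br_dag : forall X Y, (L X Y)^t* = L (X^t*) (Y^t*) }.

Variables (d1 d2 K : nat) (L : 'M[C]_d1 -> 'M[C]_d2 -> 'M[C]_K).
Hypothesis Lb : birep L.

Lemma br0l Y : L 0 Y = 0.
Proof. by have := linear_0 (br_linl Lb Y). Qed.
Lemma br0r X : L X 0 = 0.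
Proof. by have := linear_0 (br_linr Lb X). Qed.
Lemma brZl c X Y : L (c *: X) Y = c *: L X Y.
Proof. by have := br_linl Lb Y c X 0; rewrite /= br0l !addr0. Qed.
Lemma brZr c X Y : L X (c *: Y) = c *: L X Y.
Proof. by have := br_linr Lb X c Y 0; rewrite br0r !addr0. Qed.
Lemma brDl X X' Y : L (X + X') Y = L X Y + L X' Y.
Proof. by have := br_linl Lb Y 1 X X'; rewrite /= !scale1r. Qed.
Lemma brDr X Y Y' : L X (Y + Y') = L X Y + L X Y'.
Proof. by have := br_linr Lb X 1 Y Y'; rewrite !scale1r. Qed.
Lemma br_suml (I : Type) (r : seq I) P X Y :
  L (\sum_(i <- r | P i) X i) Y = \sum_(i <- r | P i) L (X i) Y.
Proof. by elim/big_rec2: _ => [|i a b _ <-]; rewrite ?br0l ?brDl. Qed.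
Lemma br_sumr (I : Type) (r : seq I) P X Y :
  L X (\sum_(i <- r | P i) Y i) = \sum_(i <- r | P i) L X (Y i).
Proof. by elim/big_rec2: _ => [|i a b _ <-]; rewrite ?br0r ?brDr. Qed.

Lemma br_scalar (c e : C) : L c%:M e%:M = (c * e)%:M.
Proof.
have scE n (z : C) : (z%:M : 'M_n) = z *: 1%:M by rewrite scalemx1.
rewrite (scE _ c) (scE _ e) brZl brZr (br_one Lb).
by rewrite !scalemx1 scale_scalar_mx.
Qed.

(** Matrix units are conjugate to each other, so that all rank one projections have
    the same trace. *)
Lemma br_trace (a : 'I_d1) (b : 'I_d2) :
  \tr (L (delta_mx a a) (delta_mx b b)) * (d1 * d2)%:R = K%:R.
Proof.
have trE (a' : 'I_d1) (b' : 'I_d2) : \tr (L (delta_mx a' a') (delta_mx b' b')) =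
    \tr (L (delta_mx a a) (delta_mx b b)).
  transitivity (\tr (L (delta_mx a' a) (delta_mx b b') *m L (delta_mx a a') (delta_mx b' b))).
    by rewrite (br_mul Lb) !mul_delta_mx.
  by rewrite mxtrace_mulC (br_mul Lb) !mul_delta_mx.
have <- : \tr (L 1%:M 1%:M) = K%:R by rewrite (br_one Lb) mxtrace1.
rewrite [in RHS]mx1_sum_delta br_suml mxtrace_sum.
under eq_bigr do rewrite mx1_sum_delta br_sumr mxtrace_sum.
under eq_bigr do under eq_bigr do rewrite trE.
by rewrite !sumr_const !card_ord -mulrnA mulnC mulr_natr.
Qed.

Lemma br_dim : (0 < d1)%N -> (0 < d2)%N -> exists l, K = (d1 * d2 * l)%N.
Proof.
move=> d1_gt0 d2_gt0; pose a := Ordinal d1_gt0; pose b := Ordinal d2_gt0.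
pose p := L (delta_mx a a) (delta_mx b b).
have pd : p^t* = p by rewrite (br_dag Lb) !trmx_delta !map_delta_mx.
have pp : p *m p = p by rewrite (br_mul Lb) !mul_delta_mx.
have [n [i [i1 i2]]] := projection_split pd pp.
exists n; apply/eqP; rewrite -(eqr_nat C) -(br_trace a b) -/p -i2 mxtrace_mulC i1 mxtrace1.
by rewrite -natrM mulnC.
Qed.

Lemma br_trace_l (a a' : 'I_d1) :
  \tr (L (delta_mx a a') 1%:M) * d1%:R = (a == a')%:R * K%:R.
Proof.
have E (c c' : 'I_d1) : \tr (L (delta_mx c c') 1%:M) = (c == c')%:R * \tr (L (delta_mx a a) 1%:M).
  transitivity (\tr (L (delta_mx c a) 1%:M *m L (delta_mx a c') 1%:M)).
    by rewrite (br_mul Lb) mul_delta_mx mulmx1.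
  rewrite mxtrace_mulC (br_mul Lb) mulmx1 mul_delta_mx_cond eq_sym.
  by case: eqP => _; rewrite ?mul1r ?mul0r ?mulr1n // mulr0n br0l mxtrace0.
rewrite E -mulrA; congr (_ * _).
have <- : \tr (L 1%:M 1%:M) = K%:R by rewrite (br_one Lb) mxtrace1.
rewrite [X in _ = \tr (L X _)]mx1_sum_delta.
rewrite br_suml mxtrace_sum; under eq_bigr do rewrite E eqxx mul1r.
by rewrite sumr_const card_ord mulr_natr.
Qed.

Lemma br_trace_r (b b' : 'I_d2) :
  \tr (L 1%:M (delta_mx b b')) * d2%:R = (b == b')%:R * K%:R.
Proof.
have E (c c' : 'I_d2) : \tr (L 1%:M (delta_mx c c')) = (c == c')%:R * \tr (L 1%:M (delta_mx b b)).
  transitivity (\tr (L 1%:M (delta_mx b c') *m L 1%:M (delta_mx c b))).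
    by rewrite (br_mul Lb) mul_delta_mx mulmx1.
  rewrite mxtrace_mulC (br_mul Lb) mulmx1 mul_delta_mx_cond eq_sym.
  by case: eqP => _; rewrite ?mul1r ?mul0r ?mulr1n // mulr0n br0r mxtrace0.
rewrite E -mulrA; congr (_ * _).
have <- : \tr (L 1%:M 1%:M) = K%:R by rewrite (br_one Lb) mxtrace1.
rewrite [X in _ = \tr (L _ X)]mx1_sum_delta br_sumr mxtrace_sum; under eq_bigr do rewrite E eqxx mul1r.
by rewrite sumr_const card_ord mulr_natr.
Qed.

(** Schur's lemma.  In dimension d1 d2 the projection L(E_00, E_00) has rank one, so
    G acts on its range by a scalar; the translates of this range span. *)
Lemma br_commutant (G : 'M[C]_K) : (0 < d1)%N -> (0 < d2)%N -> K = (d1 * d2)%N ->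
  (forall X Y, G *m L X Y = L X Y *m G) -> exists c : C, G = c%:M.
Proof.
move=> d1_gt0 d2_gt0 Kd GL; pose o := Ordinal d1_gt0; pose o' := Ordinal d2_gt0.
pose p := L (delta_mx o o) (delta_mx o' o').
have pd : p^t* = p by rewrite (br_dag Lb) !trmx_delta !map_delta_mx.
have pp : p *m p = p by rewrite (br_mul Lb) !mul_delta_mx.
have [n [x [x1 x2]]] := projection_split pd pp.
have n1 : n = 1%N.
  have := br_trace o o'; rewrite -/p -x2 mxtrace_mulC x1 mxtrace1 -natrM Kd.
  move/eqP; rewrite eqr_nat -[X in _ == X]mul1n eqn_pmul2r ?muln_gt0 ?d1_gt0 //.
  by move/eqP.
subst n; have px : p *m x = x by rewrite -x2 -mulmxA x1 mulmx1.
exists ((x^t* *m G *m x) 0 0).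
have Gx : G *m x = (x^t* *m G *m x) 0 0 *: x.
  rewrite -{1}px mulmxA GL -/p -x2 -!mulmxA {1}[x^t* *m _]mx11_scalar mul_mx_scalar.
  by rewrite mulmxA.
have GLx X Y : G *m (L X Y *m x) = (x^t* *m G *m x) 0 0 *: (L X Y *m x).
  by rewrite mulmxA GL -mulmxA Gx scalemxAr.
have idE : id_ K = \sum_a \sum_b (L (delta_mx a o) (delta_mx o' b) *m x) *m
    (x^t* *m L (delta_mx o a) (delta_mx b o')).
  rewrite -(br_one Lb) [X in L X _]mx1_sum_delta br_suml; apply: eq_bigr => a _.
  rewrite mx1_sum_delta br_sumr; apply: eq_bigr => b _.
  rewrite mulmxA -(mulmxA _ x) x2 /p !(br_mul Lb).
  by rewrite !mul_delta_mx.
rewrite -[LHS]mulmx1 -[RHS]scalemx1 idE scaler_sumr mulmx_sumr; apply: eq_bigr => a _.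
rewrite scaler_sumr mulmx_sumr; apply: eq_bigr => b _.
by rewrite mulmxA GLx -scalemxAl.
Qed.

End BiRep.

Section BimoduleRep.
Variable R : realType.
Local Notation C := R[i].
Variable A : hopfStarAlg R.
Local Notation F := (canonical_functor A).
Local Notation id_ n := (1%:M : 'M[C]_n).

(** The bracketing in the associativity axiom for bimodules. *)
Lemma cast_shape_act b1 b1' m b2 b2' e (x : 'cV[C]_b1) (x' : 'cV_b1') (v : 'cV_m)
    (y : 'cV_b2) (y' : 'cV_b2') :
  castmx (e : (b1 * b1' * m * (b2 * b2') = b1 * (b1' * m * b2) * b2')%N, erefl)
    (x *k x' *k v *k (y *k y')) = x *k (x' *k v *k y) *k y'.
Proof.
have e1 : (b1 * b1' * m * (b2 * b2') = b1 * (b1' * m) * (b2 * b2'))%N by rewrite !mulnA.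
have e2 : (b1 * (b1' * m) * (b2 * b2') = b1 * (b1' * m * b2) * b2')%N by rewrite !mulnA.
rewrite (_ : e = etrans e1 e2) -?castcast; last exact: eq_irrelevance.
have e3 : (b1 * b1' * m = b1 * (b1' * m))%N by rewrite mulnA.
by rewrite (@cast_tv_in _ _ _ _ _ _ _ e3 erefl) castmx_id cast_tvA cast_tv_mid.
Qed.

Lemma cast_shape_act' b1 b1' m b2 b2' e (x : 'cV[C]_b1) (x' : 'cV_b1') (v : 'cV_m)
    (y : 'cV_b2) (y' : 'cV_b2') :
  castmx (e : (b1 * (b1' * m * b2) * b2' = b1 * b1' * m * (b2 * b2'))%N, erefl)
    (x *k (x' *k v *k y) *k y') = x *k x' *k v *k (y *k y').
Proof. by apply: (canLR (castmxKV _ _)) => /=; rewrite cast_shape_act. Qed.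

Lemma end_iso_mul (B : frobData A) d (f : 'M[C]_(d * d, B)) (fB : is_end_iso f) X Y :
  fr_mul B *m ((f^t* *m vec X) *k (f^t* *m vec Y)) =
  (sqrtd R d)^-1 *: (f^t* *m vec (X *m Y)).
Proof.
case: fB => -[ff1 ff2] fm _.
rewrite -[fr_mul B]mul1mx -ff1 -mulmxA -mulmxA (mulmxA f) fm -mulmxA tensmx_tv !mulmxA ff2.
by rewrite !mul1mx -mulmxA end_mul_vec -scalemxAr.
Qed.

Lemma end_iso_unit (B : frobData A) d (f : 'M[C]_(d * d, B)) (fB : is_end_iso f) :
  fr_unit B = sqrtd R d *: (f^t* *m vec (id_ d)).
Proof.
case: fB => -[ff1 ff2] _ fu.
by rewrite -[LHS]mul1mx -ff1 -mulmxA fu end_unit_vec -scalemxAr.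
Qed.

(** In the endomorphism algebra the form u^+ m is the trace form. *)
Lemma end_iso_form (B : frobData A) d (f : 'M[C]_(d * d, B)) (fB : is_end_iso f) X Y :
  (0 < d)%N ->
  ((fr_unit B)^t* *m fr_mul B *m ((f^t* *m vec X) *k (f^t* *m vec Y))) 0 0 = \tr (X *m Y).
Proof.
move=> d_gt0; have [[ff1 ff2] _ _] := fB; rewrite -mulmxA end_iso_mul // (end_iso_unit fB).
rewrite dagZ sqrtd_conj -scalemxAl -scalemxAr scalerA mulfV ?sqrtd_neq0 // scale1r.
by rewrite dagM trmxCK -mulmxA (mulmxA f) ff2 mul1mx vec_dot dag1 mul1mx.
Qed.

Lemma end_iso_ket (B : frobData A) d (f : 'M[C]_(d * d, B)) (fB : is_end_iso f) (a : 'I_B) X :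
  \tr (X *m unvec (f *m ket R a)) = ((f^t* *m vec (X^t*)) a 0)^*.
Proof.
rewrite -[X in \tr (X *m _)]trmxCK -vec_dot unvecK mulmxA mulmx_ket.
by rewrite -[(vec _)^t* *m f]trmxCK dagM trmxCK dagE.
Qed.

Lemma end_iso_forml (B : frobData A) d (f : 'M[C]_(d * d, B)) X (a : 'I_B) :
  (0 < d)%N -> is_end_iso f ->
  ((fr_unit B)^t* *m fr_mul B *m ((f^t* *m vec (X^t*)) *k ket R a)) 0 0 =
  ((f^t* *m vec X) a 0)^*.
Proof.
move=> d_gt0 fB; have [[g1 _] _ _] := fB.
have := end_iso_ket fB a (X^t*); rewrite trmxCK => <-.
rewrite -(end_iso_form fB (X^t*) (unvec (f *m ket R a))) //.
by rewrite (@unvecK _ d d (f *m ket R a)) mulmxA g1 mul1mx.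
Qed.

Lemma end_iso_formr (B : frobData A) d (f : 'M[C]_(d * d, B)) X (a : 'I_B) :
  (0 < d)%N -> is_end_iso f ->
  ((fr_unit B)^t* *m fr_mul B *m (ket R a *k (f^t* *m vec (X^t*)))) 0 0 =
  ((f^t* *m vec X) a 0)^*.
Proof.
move=> d_gt0 fB; have [[g1 _] _ _] := fB.
have := end_iso_ket fB a (X^t*); rewrite trmxCK => <-.
rewrite mxtrace_mulC -(end_iso_form fB (unvec (f *m ket R a)) (X^t*)) //.
by rewrite (@unvecK _ d d (f *m ket R a)) mulmxA g1 mul1mx.
Qed.

Section Action.
Variables (B1 B2 : frobData A) (M : bimodData B1 B2).

Definition act2 (x : 'cV[C]_B1) (y : 'cV[C]_B2) : 'M[C]_M :=
  \matrix_(p, q) (bim_act M *m (x *k ket R q *k y)) p 0.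

Lemma act2E x y v : act2 x y *m v = bim_act M *m (x *k v *k y).
Proof.
rewrite [v in RHS]cV_ket tv_sumr tv_suml mulmx_sumr.
apply/colP => p; rewrite mxE summxE; apply: eq_bigr => q _.
by rewrite tvZr tvZl -scalemxAr mxE [RHS]mxE mulrC.
Qed.

Lemma act2Dl a x x' y : act2 (a *: x + x') y = a *: act2 x y + act2 x' y.
Proof.
apply: mx_cV_ext => v; rewrite mulmxDl -scalemxAl !act2E !tvDl !tvZl mulmxDr.
by rewrite scalemxAr.
Qed.
Lemma act2Dr a x y y' : act2 x (a *: y + y') = a *: act2 x y + act2 x y'.
Proof.
apply: mx_cV_ext => v; rewrite mulmxDl -scalemxAl !act2E !tvDr !tvZr mulmxDr.
by rewrite scalemxAr.
Qed.

Lemma act2Zl a x y : act2 (a *: x) y = a *: act2 x y.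
Proof.
by apply: mx_cV_ext => v; rewrite -scalemxAl !act2E !tvZl -scalemxAr.
Qed.
Lemma act2Zr a x y : act2 x (a *: y) = a *: act2 x y.
Proof.
by apply: mx_cV_ext => v; rewrite -scalemxAl !act2E !tvZr -scalemxAr.
Qed.

Lemma cast_11tv n (x y : 'cV[C]_1) (v : 'cV[C]_n) (e : (1 * n * 1 = n)%N) :
  castmx (e, erefl) (x *k v *k y) = (x 0 0 * y 0 0) *: v.
Proof.
have e1 : (1 * n * 1 = 1 * n)%N by rewrite muln1.
have e2 : (1 * n = n)%N by rewrite mul1n.
rewrite (_ : e = etrans e1 e2) -?castcast; last exact: eq_irrelevance.
by rewrite cast_tv1r castZ cast_tv1l scalerA mulrC.
Qed.

(** The right side of the axiom relating an action to its adjoint only depends on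
    the adjoint of the action of the vectors x' and y' which represent the functionals
    (u^+ m)(x, -) and (u^+ m)(-, y). *)
Lemma bim_dagE e1 e2 (x x' : 'cV_B1) (y y' : 'cV_B2) v :
  (forall a, ((fr_unit B1)^t* *m fr_mul B1 *m (x *k ket R a)) 0 0 = (x' a 0)^*) ->
  (forall b, ((fr_unit B2)^t* *m fr_mul B2 *m (ket R b *k y)) 0 0 = (y' b 0)^*) ->
  scomp (scomp (id_ M) (((fr_unit B1) ^t* *m fr_mul B1) *t id_ M *t
                        ((fr_unit B2) ^t* *m fr_mul B2)) e1)
        (id_ B1 *t (bim_act M) ^t* *t id_ B2) e2 *m (x *k v *k y) =
  (act2 x' y')^t* *m v.
Proof.
move=> xx' yy'.
rewrite scompE tensmx_tv tensmx_tv !mul1mx.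
set w := (bim_act M)^t* *m v; rewrite [w]cV_ket3.
rewrite tv_sumr tv_suml cast_sum mulmx_sumr.
under eq_bigr => a _.
  rewrite tv_sumr tv_suml cast_sum mulmx_sumr.
  under eq_bigr => q _.
    rewrite tv_sumr tv_suml cast_sum mulmx_sumr.
    under eq_bigr => b _.
      rewrite tvZr tvZl castZ -scalemxAr scompE mul1mx.
      rewrite cast_shape_act' !tensmx_tv cast_11tv xx' yy' mul1mx.
      over.
    over.
  over.
apply/colP => p; rewrite summxE [RHS]mxE.
transitivity (((x' *k ket R p *k y')^t* *m w) 0 0); last first.
  rewrite /w mulmxA -dagM !mxE; apply: eq_bigr => q _.
  by rewrite !dagE [act2 _ _ _ _]mxE.
rewrite mxE sum_mxtens sum_mxtens; apply: eq_bigr => a _.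
rewrite summxE; apply: eq_bigr => q _; rewrite summxE; apply: eq_bigr => b _.
rewrite dagE !tvE ketE !mxE eqxx andbT !cjM cj_nat [(q == p)]eq_sym.
by ring.
Qed.

Hypothesis bM : is_bimodule M.

Lemma act2M x x' y y' :
  act2 x y' *m act2 x' y = act2 (fr_mul B1 *m (x *k x')) (fr_mul B2 *m (y *k y')).
Proof.
apply: mx_cV_ext => v; rewrite -mulmxA !act2E.
have /(congr1 (fun f => f *m (x *k x' *k v *k (y *k y')))) := bim_act_mul bM.
rewrite -mulmxA !tensmx_tv mul1mx => ->.
by rewrite scompE -!mulmxA mul1mx cast_shape_act !tensmx_tv !mul1mx.
Qed.

Lemma act2_unit : act2 (fr_unit B1) (fr_unit B2) = 1%:M.
Proof.
apply: mx_cV_ext => v; rewrite act2E.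
have /(congr1 (fun f => f *m v)) := bim_act_unit bM.
rewrite [X in _ = X]mul1mx => {2}<-.
rewrite scompE mul1mx -mulmxA; congr (_ *m _).
have e1 : (M = 1 * M :> nat)%N by rewrite mul1n.
have e2 : (1 * M = 1 * M * 1)%N by rewrite muln1.
rewrite [X in castmx (X, _)](_ : _ = etrans e1 e2); last exact: eq_irrelevance.
by rewrite -castcast cast_1tvl cast_1tvr !tensmx_tv !mul1mx !mulmx1.
Qed.

Lemma act2_dag (x x' : 'cV_B1) (y y' : 'cV_B2) :
  (forall a, ((fr_unit B1)^t* *m fr_mul B1 *m (x *k ket R a)) 0 0 = (x' a 0)^*) ->
  (forall b, ((fr_unit B2)^t* *m fr_mul B2 *m (ket R b *k y)) 0 0 = (y' b 0)^*) ->
  act2 x y = (act2 x' y')^t*.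
Proof.
move=> xx' yy'; apply: mx_cV_ext => v; rewrite act2E (bim_act_dag bM).
exact: bim_dagE.
Qed.

Variables (d1 d2 : nat) (f1 : 'M[C]_(d1 * d1, B1)) (f2 : 'M[C]_(d2 * d2, B2)).
Hypotheses (d1_gt0 : (0 < d1)%N) (d2_gt0 : (0 < d2)%N).
Hypotheses (fB1 : is_end_iso f1) (fB2 : is_end_iso f2).

(** The units of the two monoids are sqrt(d1) and sqrt(d2) times identity matrices;
    the factor makes the representation unital. *)
Definition bim_rep (X : 'M[C]_d1) (Y : 'M[C]_d2) : 'M[C]_M :=
  (sqrtd R d1 * sqrtd R d2) *: act2 (f1^t* *m vec X) (f2^t* *m vec Y).

(** The three bimodule axioms are multiplicativity, unitality and compatibility with
    adjoints; for the last one, X^+ represents the functional Y |-> tr(X Y). *)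
Lemma bim_rep_birep : birep bim_rep.
Proof.
have s1 := sqrtd_neq0 R d1_gt0; have s2 := sqrtd_neq0 R d2_gt0.
split=> [Y a X X'|X a Y Y'|X X' Y Y'||X Y].
- by rewrite /bim_rep vecD vecZ mulmxDr -scalemxAr act2Dl scalerDr !scalerA mulrC.
- by rewrite /bim_rep vecD vecZ mulmxDr -scalemxAr act2Dr scalerDr !scalerA mulrC.
- rewrite /bim_rep -scalemxAl -scalemxAr act2M !end_iso_mul //.
  rewrite act2Zl act2Zr !scalerA; congr (_ *: _); field.
  by rewrite s1 s2.
- by rewrite -act2_unit (end_iso_unit fB1) (end_iso_unit fB2) act2Zl act2Zr scalerA.
rewrite /bim_rep dagZ cjM !sqrtd_conj; congr (_ *: _); symmetry.
by apply: act2_dag => a; [exact: end_iso_forml|exact: end_iso_formr].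
Qed.

End Action.
End BimoduleRep.

Section BimoduleCompat.
Variable R : realType.
Local Notation C := R[i].
Variable A : hopfStarAlg R.
Local Notation F := (canonical_functor A).
Local Notation id_ n := (1%:M : 'M[C]_n).
Local Notation op a := (@uop _ _ _ _ a _).

Section Relation.
Variables (B1 B2 : frobData A) (M : bimodData B1 B2) (bM : is_bimodule M).
Variables (F1 F2 : functorData A) (a1 : uptData F F1) (a2 : uptData F F2).
Variables (f1 : 'M[C]_(a1 * a1, B1)) (f2 : 'M[C]_(a2 * a2, B2)).
Hypotheses (fB1 : is_end_iso f1) (fB2 : is_end_iso f2).
Hypotheses (fM1 : @is_modification _ _ _ _ B1 (upt_mix a1 a1) f1).
Hypotheses (fM2 : @is_modification _ _ _ _ B2 (upt_mix a2 a2) f2).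

Local Notation L := (bim_rep M f1 f2).

Lemma star_iso_op (B : frobData A) (F' : functorData A) (a : uptData F F')
    (f : 'M[C]_(a * a, B)) V (k i : 'I_(F V)) X :
  is_end_iso f -> @is_modification _ _ _ _ B (upt_mix a a) f ->
  op B k i *m (f^t* *m vec X) =
  f^t* *m vec (\sum_z op a z i *m X *m (op a z k)^t*).
Proof.
case=> -[ff1 ff2] _ _ /is_modificationP fM; rewrite -uop_mix_vec.
rewrite -[LHS]mul1mx -ff1 -(mulmxA (f^t*)); congr (_ *m _).
by rewrite mulmxA fM -mulmxA (mulmxA f) ff2 mul1mx.
Qed.

(** The action is a modification, and the operators of the monoid of a transformation
    a act by X |-> sum_z a_zi X a_zj^+. *)
Lemma bim_rep_op V (k i : 'I_(F V)) X Y :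
  op M k i *m L X Y =
  \sum_j \sum_l L (\sum_z op a1 z i *m X *m (op a1 z j)^t*)
                  (\sum_w op a2 w l *m Y *m (op a2 w k)^t*) *m @uop _ _ _ _ M V l j.
Proof.
have /is_modificationP/(_ V k i) := bim_act_mod bM => E.
apply: mx_cV_ext => v; rewrite /bim_rep -scalemxAr -scalemxAl -[_ *m _ *m v]mulmxA act2E.
rewrite mulmxA -E uop_comp.
under eq_bigr do rewrite uop_comp tens_suml.
rewrite -mulmxA mulmx_suml mulmx_sumr scaler_sumr mulmx_suml.
rewrite [LHS](eq_bigr (fun l => \sum_j (sqrtd R a1 * sqrtd R a2) *: (bim_act M *m
   ((op B1 j i *t op M l j *t op B2 k l) *m (f1^t* *m vec X *k v *k (f2^t* *m vec Y)))))).
  rewrite [LHS]exchange_big; apply: eq_bigr => j _; rewrite mulmx_suml.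
  apply: eq_bigr => l _; rewrite !tensmx_tv -scalemxAl -scalemxAl -mulmxA act2E.
  by rewrite !star_iso_op.
by move=> l _; rewrite mulmx_suml mulmx_sumr scaler_sumr.
Qed.
End Relation.

Lemma vec_delta m n (i : 'I_m) (j : 'I_n) : vec (delta_mx i j) = ket R i *k ket R j.
Proof.
apply/colP => x; case: (mxtens_indexP x) => k l.
by rewrite vecE tvE !ketE mxE -natrM mulnb.
Qed.

Lemma right_actE (B1 B2 : frobData A) (M : bimodData B1 B2) v y :
  right_act M *m (v *k y) = act2 M (fr_unit B1) y *m v.
Proof.
rewrite /right_act scompE mul1mx -mulmxA act2E; congr (_ *m _).
have e1 : (M = 1 * M :> nat)%N by rewrite mul1n.
rewrite (@cast_tv_in _ _ _ _ _ _ _ e1 erefl) castmx_id cast_1tvl !tensmx_tv !mul1mx.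
by rewrite mulmx1.
Qed.

Lemma left_actE (B1 B2 : frobData A) (M : bimodData B1 B2) v x :
  left_act M *m (x *k v) = act2 M x (fr_unit B2) *m v.
Proof.
rewrite /left_act scompE mul1mx -mulmxA act2E; congr (_ *m _).
by rewrite cast_1tvr tensmx_tv mul1mx mulmx1.
Qed.

(** In matrix units, m^+ u = sum_bc E_bc (x) E_cb. *)
Lemma end_iso_comul_unit (B : frobData A) d (f : 'M[C]_(d * d, B)) : (0 < d)%N ->
  is_end_iso f ->
  (fr_mul B)^t* *m fr_unit B =
  \sum_b \sum_c (f^t* *m vec (delta_mx b c)) *k (f^t* *m vec (delta_mx c b)).
Proof.
move=> d_gt0 [[ff1 ff2] fm fu].
have -> : fr_unit B = f^t* *m end_unit R d by rewrite -fu mulmxA ff1 mul1mx.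
rewrite mulmxA -dagM fm dagM dag_tens -mulmxA /end_unit -scalemxAr coev_ket !mulmx_sumr scaler_sumr.
rewrite mulmx_sumr; apply: eq_bigr => b _.
rewrite end_mul_dag_ket scalerA mulfV ?sqrtd_neq0 // scale1r mulmx_sumr.
by apply: eq_bigr => c _; rewrite tensmx_tv !vec_delta.
Qed.

Lemma rel_idemE (B1 B2 B3 : frobData A) (M : bimodData B1 B2) (N : bimodData B2 B3)
    d1 d2 d3 (f1 : 'M[C]_(d1 * d1, B1)) (f2 : 'M[C]_(d2 * d2, B2)) (f3 : 'M[C]_(d3 * d3, B3)) :
  (0 < d2)%N -> is_end_iso f1 -> is_end_iso f2 -> is_end_iso f3 ->
  rel_idem M N = d2%:R^-1 *:
    \sum_b \sum_c bim_rep M f1 f2 1%:M (delta_mx b c) *t bim_rep N f2 f3 (delta_mx c b) 1%:M.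
Proof.
move=> d_gt0 fB1 fB2 fB3; have s0 := sqrtd_neq0 R d_gt0.
apply: mx_tv_ext => v w; rewrite /rel_idem !scompE !mul1mx.
have e1 : (M = M * 1 :> nat)%N by rewrite muln1.
rewrite (@cast_tv_in _ _ _ _ _ _ _ e1 erefl) castmx_id cast_1tvr !tensmx_tv !mul1mx.
rewrite mulmx1 (end_iso_comul_unit d_gt0 fB2) tv_sumr tv_suml cast_sum mulmx_sumr.
rewrite -scalemxAl mulmx_suml scaler_sumr; apply: eq_bigr => b _.
rewrite tv_sumr tv_suml cast_sum mulmx_sumr mulmx_suml scaler_sumr; apply: eq_bigr => c _.
rewrite cast_tv_mid' tensmx_tv right_actE left_actE tensmx_tv /bim_rep -!scalemxAl.
rewrite (end_iso_unit fB1) (end_iso_unit fB3) act2Zl act2Zr -!scalemxAl !tvZl !tvZr !scalerA.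
congr (_ *: _); rewrite -sqrtd2; field.
by rewrite s0.
Qed.

(** The dimensions of M and N are multiples d1 d2 l and d1 d2 l' of d1 d2.  The
    trace of the idempotent is dim M dim N / d2^2 = d1^2 l l', while its range has the
    dimension d1^2 of the regular bimodule. *)
Lemma bimodule_dim (B1 B2 : frobData A) (M : bimodData B1 B2) (N : bimodData B2 B1)
    (T : bimodData B1 B1) (i : 'M[C]_(M * N, T))
    d1 d2 (f1 : 'M[C]_(d1 * d1, B1)) (f2 : 'M[C]_(d2 * d2, B2)) :
  (0 < d1)%N -> (0 < d2)%N -> is_end_iso f1 -> is_end_iso f2 ->
  is_bimodule M -> is_bimodule N -> is_rel_tensor i -> T = B1 :> nat ->
  M = (d1 * d2)%N :> nat.
Proof.
move=> d1_gt0 d2_gt0 fB1 fB2 bM bN [_ _ i1 i2 _] TB.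
have LM := bim_rep_birep bM d1_gt0 d2_gt0 fB1 fB2.
have LN := bim_rep_birep bN d2_gt0 d1_gt0 fB2 fB1.
have [l Ml] := br_dim LM d1_gt0 d2_gt0; have [l' Nl] := br_dim LN d2_gt0 d1_gt0.
have B1d : (B1 = d1 * d1 :> nat)%N by case: fB1 => /unitary_dim.
have d2n : d2%:R != 0 :> C by rewrite pnatr_eq0 -lt0n.
have : \tr (rel_idem M N) = (d1 * d1)%:R.
  by rewrite -i2 mxtrace_mulC i1 mxtrace1 TB B1d.
rewrite (rel_idemE M N d2_gt0 fB1 fB2 fB1) mxtraceZ mxtrace_sum.
have trE b : \tr (\sum_c bim_rep M f1 f2 1%:M (delta_mx b c) *t bim_rep N f2 f1 (delta_mx c b) 1%:M)
     = (M * N)%:R / (d2 * d2)%:R :> C.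
  rewrite mxtrace_sum (bigD1 b) //= big1 ?addr0 => [|c /negPf cb].
    rewrite mxtrace_tens; apply: (mulIf (mulf_neq0 d2n d2n)).
    rewrite [LHS]mulrACA (br_trace_r LM) (br_trace_l LN) !eqxx !mul1r !natrM; field.
    by rewrite d2n.
  rewrite mxtrace_tens; apply: (mulIf (mulf_neq0 d2n d2n)).
  by rewrite [LHS]mulrACA (br_trace_r LM) (br_trace_l LN) cb eq_sym cb !mul0r.
under eq_bigr do rewrite trE.
rewrite sumr_const card_ord -mulr_natr => E.
have {}E : ((M * N)%:R = (d1 * d1 * (d2 * d2))%:R :> C).
  rewrite [RHS]natrM -E !natrM; field.
  by rewrite d2n.
move/eqP: E; rewrite eqr_nat Ml Nl => /eqP E.
suff -> : l = 1%N by rewrite muln1.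
have : (d1 * d1 * (d2 * d2) * (l * l') = d1 * d1 * (d2 * d2) * 1)%N by rewrite [RHS]muln1 -[RHS]E; ring.
move/eqP; rewrite eqn_pmul2l ?muln_gt0 ?d1_gt0 ?d2_gt0 // muln_eq1.
by case/andP=> /eqP.
Qed.

End BimoduleCompat.

Section BirepFamilies.
Variable R : realType.
Local Notation C := R[i].
Local Notation id_ n := (1%:M : 'M[C]_n).
Variables (d1 d2 K : nat) (L : 'M[C]_d1 -> 'M[C]_d2 -> 'M[C]_K).
Hypotheses (Lb : birep L) (K_gt0 : (0 < K)%N).

Lemma adj_contractl n m (s : 'I_n -> 'I_m -> 'M[C]_d1) X y (j : 'I_m) : fam_adj_coiso s ->
  \sum_i (s y i)^t* *m (\sum_u s u i *m X *m (s u j)^t*) = X *m (s y j)^t*.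
Proof.
move=> sk; transitivity (\sum_u (\sum_i (s y i)^t* *m s u i) *m X *m (s u j)^t*).
  under eq_bigr do rewrite mulmx_sumr; rewrite exchange_big; apply: eq_bigr => u _.
  by rewrite !mulmx_suml; apply: eq_bigr => i _; rewrite !mulmxA.
under eq_bigr do rewrite sk mul_scalar_mx -scalemxAl.
by rewrite delta_sum'.
Qed.

Lemma adj_contractr n m (t : 'I_n -> 'I_m -> 'M[C]_d2) Y z (l : 'I_m) : fam_adj_coiso t ->
  \sum_k (\sum_w t w l *m Y *m (t w k)^t*) *m t z k = t z l *m Y.
Proof.
move=> tk; transitivity (\sum_w t w l *m Y *m (\sum_k (t w k)^t* *m t z k)).
  under eq_bigr do rewrite mulmx_suml; rewrite exchange_big; apply: eq_bigr => w _.
  by rewrite !mulmx_sumr; apply: eq_bigr => k _; rewrite !mulmxA.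
under eq_bigr do rewrite tk mul_mx_scalar.
by rewrite delta_sum.
Qed.

Lemma br_sum2 (I J : finType) (X : I -> 'M[C]_d1) (Y : J -> 'M[C]_d2) :
  L (\sum_i X i) (\sum_j Y j) = \sum_i \sum_j L (X i) (Y j).
Proof. by rewrite (br_suml Lb); apply: eq_bigr => i _; rewrite (br_sumr Lb). Qed.

(** Contracting with L(s_yi^+, t_zk) reads off the coefficient of index (z, y). *)
Lemma br_indep p m q n (s : 'I_p -> 'I_m -> 'M[C]_d1) (t : 'I_q -> 'I_n -> 'M[C]_d2)
    (e e' : 'M[C]_(q, p)) : fam_adj_coiso s -> fam_adj_coiso t ->
  (forall i k, \sum_z \sum_y e z y *: L (s y i) ((t z k)^t*) =
               \sum_z \sum_y e' z y *: L (s y i) ((t z k)^t*)) -> e = e'.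
Proof.
move=> sk tk ee; apply/matrixP => z y.
have E (e0 : 'M[C]_(q, p)) : \sum_i \sum_k L ((s y i)^t*) (t z k) *m
     (\sum_z \sum_y e0 z y *: L (s y i) ((t z k)^t*)) = (e0 z y)%:M.
  transitivity (\sum_z' \sum_y' e0 z' y' *: L (\sum_i (s y i)^t* *m s y' i)
      (\sum_k (t z' k)^t* *m t z k)).
    under eq_bigr do under eq_bigr do rewrite mulmx_sumr.
    under eq_bigr do under eq_bigr do under eq_bigr do rewrite mulmx_sumr.
    under eq_bigr do rewrite exchange_big; rewrite [LHS]exchange_big.
    apply: eq_bigr => z' _ /=; under eq_bigr do rewrite exchange_big; rewrite [LHS]exchange_big.
    apply: eq_bigr => y' _ /=; rewrite br_sum2 scaler_sumr; apply: eq_bigr => i _.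
    rewrite scaler_sumr; apply: eq_bigr => k _.
    by rewrite -scalemxAr (br_mul Lb).
  under eq_bigr do under eq_bigr do rewrite sk tk (br_scalar Lb).
  rewrite (bigD1 z) //= (bigD1 y) //= !eqxx big1 => [|y' /negPf yy].
    rewrite big1 ?addr0 ?mulr1 ?scalemx1 // => z' /negPf zz.
    by rewrite big1 // => y' _; rewrite zz mulr0 raddf0 scaler0.
  by rewrite eq_sym yy mul0r raddf0 scaler0.
have : (e z y)%:M = (e' z y)%:M :> 'M_K by rewrite -!E; under eq_bigr do under eq_bigr do rewrite ee.
case: (K) K_gt0 => // K' _ /matrixP/(_ 0 0).
by rewrite !mxE eqxx !mulr1n.
Qed.

Lemma br_expand p p' q q' (c : 'M[C]_(q, p)) (m : 'M[C]_(p, p')) (n : 'M[C]_(q', q))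
    (s : 'I_p' -> 'M[C]_d1) (t : 'I_q' -> 'M[C]_d2) :
  \sum_z \sum_y c z y *: L (\sum_i m y i *: s i) (\sum_k n k z *: t k) =
  \sum_k \sum_i (n *m c *m m) k i *: L (s i) (t k).
Proof.
transitivity (\sum_z \sum_y \sum_k \sum_i (n k z * c z y * m y i) *: L (s i) (t k)).
  apply: eq_bigr => z _; apply: eq_bigr => y _.
  rewrite br_sum2 scaler_sumr [RHS]exchange_big; apply: eq_bigr => i _ /=.
  rewrite scaler_sumr; apply: eq_bigr => k _.
  rewrite (brZl Lb) (brZr Lb) !scalerA; congr (_ *: _); ring.
transitivity (\sum_k \sum_i \sum_y \sum_z (n k z * c z y * m y i) *: L (s i) (t k)).
  under [LHS]eq_bigr do rewrite exchange_big.
  rewrite [LHS]exchange_big; apply: eq_bigr => k _ /=.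
  under [LHS]eq_bigr do rewrite exchange_big.
  rewrite [LHS]exchange_big; apply: eq_bigr => i _ /=.
  by rewrite [LHS]exchange_big.
apply: eq_bigr => k _; apply: eq_bigr => i _.
rewrite mxE scaler_suml; apply: eq_bigr => y _.
by rewrite mxE -scaler_suml mulr_suml.
Qed.

End BirepFamilies.

Section MoritaIso.
Variable R : realType.
Local Notation C := R[i].
Variable A : hopfStarAlg R.
Hypothesis hA : is_cqg A.
Local Notation F := (canonical_functor A).
Local Notation id_ n := (1%:M : 'M[C]_n).
Local Notation op a := (@uop _ _ _ _ a _).
Variables (F1 F2 : functorData A) (a1 : uptData F F1) (a2 : uptData F F2).
Hypotheses (ua1 : is_upt a1) (ua2 : is_upt a2).
Variables (M : uptData F F) (L : 'M[C]_a1 -> 'M[C]_a2 -> 'M[C]_M).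
Hypotheses (uM : is_upt M) (Lb : birep L) (M_dim : M = (a1 * a2)%N :> nat).
Hypothesis L_op : forall V (k i : 'I_(F V)) X Y,
  op M k i *m L X Y =
  \sum_j \sum_l L (\sum_z op a1 z i *m X *m (op a1 z j)^t*)
                  (\sum_w op a2 w l *m Y *m (op a2 w k)^t*) *m @uop _ _ _ _ M V l j.

Let us1 := (is_uptP _).1 ua1.
Let us2 := (is_uptP _).1 ua2.
Let usM := (is_uptP _).1 uM.
Let fF2 := fibre_functor_of_upt ua2.
Let ac1 V : fam_adj_coiso (@uop _ _ _ _ a1 V). Proof. exact: (upt_conj_unitary hA ua1 V).2. Qed.
Let ac2 V : fam_adj_coiso (@uop _ _ _ _ a2 V). Proof. exact: (upt_conj_unitary hA ua2 V).2. Qed.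

(** The candidate for a coefficient of M_ki in the family L(a1_yi, a2_zk^+): if
    M_ki is a combination of these, contraction with L(a1_yi^+, a2_zk) isolates it. *)
Definition morita_gamma V (z : 'I_(F2 V)) (y : 'I_(F1 V)) : 'M[C]_M :=
  \sum_(k : 'I_(F V)) \sum_(i : 'I_(F V)) L ((op a1 y i)^t*) (op a2 z k) *m op M k i.

(** Moving L(X, Y) through M_ki conjugates X and Y by the operators of a1 and a2,
    and the contraction undoes this. *)
Lemma gamma_commutes V z y X Y :
  @morita_gamma V z y *m L X Y = L X Y *m @morita_gamma V z y.
Proof.
transitivity (\sum_j \sum_l L
   (\sum_i (op a1 y i)^t* *m \sum_u op a1 u i *m X *m (op a1 u j)^t*)
   (\sum_k (\sum_w op a2 w l *m Y *m (op a2 w k)^t*) *m op a2 z k) *m @uop _ _ _ _ M V l j).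
  rewrite /morita_gamma mulmx_suml.
  under eq_bigr do rewrite mulmx_suml.
  under eq_bigr do under eq_bigr do rewrite -mulmxA L_op mulmx_sumr.
  under eq_bigr do under eq_bigr do under eq_bigr do rewrite mulmx_sumr.
  under eq_bigr do rewrite exchange_big; rewrite [LHS]exchange_big; apply: eq_bigr => j _ /=.
  under eq_bigr do rewrite exchange_big; rewrite [LHS]exchange_big; apply: eq_bigr => l _ /=.
  rewrite br_sum2 // [LHS]exchange_big mulmx_suml; apply: eq_bigr => i _.
  by rewrite mulmx_suml; apply: eq_bigr => k _; rewrite mulmxA (br_mul Lb).
under eq_bigr do under eq_bigr do rewrite (adj_contractl _ _ _ (@ac1 V)) (adj_contractr _ _ _ (@ac2 V)).
rewrite /morita_gamma exchange_big /= mulmx_sumr; apply: eq_bigr => k _.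
by rewrite mulmx_sumr; apply: eq_bigr => i _; rewrite mulmxA (br_mul Lb).
Qed.

Let o : 'I_M := Ordinal (us_dim usM).
(** By Schur's lemma the operators [morita_gamma] are scalar, and any diagonal entry
    gives the scalar. *)
Definition morita_iso V : 'M[C]_(F2 V, F1 V) := \matrix_(z, y) @morita_gamma V z y o o.

Lemma morita_gammaE V z y : @morita_gamma V z y = (morita_iso V z y)%:M.
Proof.
rewrite [morita_iso V z y]mxE.
have [c ->] := br_commutant Lb (us_dim us1) (us_dim us2) M_dim (@gamma_commutes V z y).
by rewrite !mxE eqxx mulr1n.
Qed.

Lemma morita_dec V (k i : 'I_(F V)) :
  op M k i = \sum_z \sum_y morita_iso V z y *: L (op a1 y i) ((op a2 z k)^t*).
Proof.
have K1 := (upt_conj_unitary hA ua1 V).1; have K2 := (upt_conj_unitary hA ua2 V).1.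
transitivity (\sum_z \sum_y L (op a1 y i) ((op a2 z k)^t*) *m @morita_gamma V z y); last first.
  by apply: eq_bigr => z _; apply: eq_bigr => y _; rewrite morita_gammaE mul_mx_scalar.
transitivity (\sum_k' \sum_i' L (\sum_y op a1 y i *m (op a1 y i')^t*)
    (\sum_z op a2 z k' *m (op a2 z k)^t*) *m @uop _ _ _ _ M V k' i').
  under [RHS]eq_bigr do under eq_bigr do rewrite K1 K2 (br_scalar Lb) mul_scalar_mx -scalerA.
  under [RHS]eq_bigr do rewrite delta_sum'.
  by rewrite delta_sum.
rewrite /morita_gamma.
under [RHS]eq_bigr do under eq_bigr do rewrite mulmx_sumr.
under [RHS]eq_bigr do under eq_bigr do under eq_bigr do rewrite mulmx_sumr.
under [RHS]eq_bigr do rewrite exchange_big; rewrite [RHS]exchange_big; apply: eq_bigr => k' _ /=.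
under [RHS]eq_bigr do rewrite exchange_big; rewrite [RHS]exchange_big; apply: eq_bigr => i' _ /=.
rewrite br_sum2 // [X in X *m _]exchange_big mulmx_suml; apply: eq_bigr => z _.
by rewrite mulmx_suml; apply: eq_bigr => y _; rewrite mulmxA (br_mul Lb).
Qed.

(** Naturality of M, a1 and a2 gives two expansions of the same operator in the
    independent family of [br_indep]. *)
Lemma morita_iso_nat X Y (g : inter X Y) :
  fmor F2 g *m morita_iso X = morita_iso Y *m fmor F1 g.
Proof.
apply: (br_indep Lb (us_dim usM) (@ac1 X) (@ac2 Y)) => i l.
transitivity (\sum_k imx g l k *: @uop _ _ _ _ M X k i).
  transitivity (\sum_z \sum_y morita_iso X z y *:
      L (op a1 y i) (\sum_k imx g l k *: (@uop _ _ _ _ a2 X z k)^t*)).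
    have E z : \sum_k imx g l k *: (@uop _ _ _ _ a2 X z k)^t* =
        \sum_w fmor F2 g w z *: (@uop _ _ _ _ a2 Y w l)^t*.
      have /(congr1 (fun G => G^t*)) := us_nat us2 (inter_dag g) z l.
      rewrite !dag_sum (fmor_dag fF2) => E; symmetry; under eq_bigr do rewrite -[fmor F2 g _ _]conjCK -dagE -dagZ.
      rewrite E; apply: eq_bigr => k _.
      by rewrite dagZ /= dagE conjCK.
    under [RHS]eq_bigr do under eq_bigr do rewrite E (br_sumr Lb) scaler_sumr.
    under [RHS]eq_bigr do rewrite exchange_big; rewrite [RHS]exchange_big; apply: eq_bigr => w _ /=.
    rewrite [RHS]exchange_big; apply: eq_bigr => y _ /=.
    rewrite mxE scaler_suml; apply: eq_bigr => z _.
    by rewrite (brZr Lb) scalerA mulrC.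
  under [RHS]eq_bigr do rewrite morita_dec scaler_sumr.
  rewrite [RHS]exchange_big; apply: eq_bigr => z _ /=.
  under [RHS]eq_bigr do rewrite scaler_sumr.
  rewrite [RHS]exchange_big; apply: eq_bigr => y _ /=.
  rewrite (br_sumr Lb) scaler_sumr; apply: eq_bigr => k _.
  by rewrite (brZr Lb) !scalerA mulrC.
rewrite (us_nat usM g l i) /=.
transitivity (\sum_z \sum_y morita_iso Y z y *:
      L (\sum_j imx g j i *: @uop _ _ _ _ a1 Y y j) ((@uop _ _ _ _ a2 Y z l)^t*)).
  under [LHS]eq_bigr do rewrite morita_dec scaler_sumr.
  rewrite [LHS]exchange_big; apply: eq_bigr => z _ /=.
  under [LHS]eq_bigr do rewrite scaler_sumr.
  rewrite [LHS]exchange_big; apply: eq_bigr => y _ /=.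
  rewrite (br_suml Lb) scaler_sumr; apply: eq_bigr => k _.
  by rewrite (brZl Lb) !scalerA mulrC.
apply: eq_bigr => z _.
have N1 y : \sum_j imx g j i *: @uop _ _ _ _ a1 Y y j =
    \sum_w fmor F1 g y w *: @uop _ _ _ _ a1 X w i by rewrite (us_nat us1 g y i).
transitivity (\sum_y \sum_w (morita_iso Y z y * fmor F1 g y w) *:
    L (@uop _ _ _ _ a1 X w i) ((@uop _ _ _ _ a2 Y z l)^t*)).
  apply: eq_bigr => y _; transitivity (morita_iso Y z y *:
      L (\sum_w fmor F1 g y w *: @uop _ _ _ _ a1 X w i) ((@uop _ _ _ _ a2 Y z l)^t*)).
    by congr (_ *: L _ _); exact: N1.
  rewrite (br_suml Lb) scaler_sumr; apply: eq_bigr => w _.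
  by rewrite (brZl Lb) scalerA.
by rewrite exchange_big; apply: eq_bigr => w _ /=; rewrite mxE scaler_suml.
Qed.

Lemma uop_tens_canonical (B : uptData F F) X Y (k i : 'I_(F X)) (l j : 'I_(F Y)) :
  is_upt B -> @uop _ _ _ _ B (tens_corep X Y) (mxtens_index (k, l)) (mxtens_index (i, j)) =
  op B k i *m op B l j.
Proof.
move=> /is_uptP us; rewrite (uop_tens us) /=.
rewrite (bigD1 k) //= [X in _ + X]big1 => [|k' /negPf kk]; last first.
  by apply: big1 => l' _; rewrite mxE eq_mxtens eq_sym kk scale0r.
rewrite (bigD1 l) //= [X in _ + X + _]big1 => [|l' /negPf ll]; last first.
  by rewrite mxE eq_mxtens [l == l']eq_sym ll andbF scale0r.
by rewrite mxE eqxx scale1r !addr0.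
Qed.

Lemma uop_tens_pfam (F' : functorData A) (a : uptData F F') X Y K I :
  is_upt a -> @uop _ _ _ _ a (tens_corep X Y) K I =
  \sum_Q fmul F' X Y K Q *: pfam (@uop _ _ _ _ a X) (@uop _ _ _ _ a Y) Q I.
Proof.
move=> /is_uptP us; case: (mxtens_indexP I) => i j.
by rewrite (uop_tens us) sum_mxtens; apply: eq_bigr => k _; apply: eq_bigr => l _; rewrite pfamE.
Qed.

(** As in [morita_iso_nat], with the two expansions of M_ki M_lj. *)
Lemma morita_iso_mul X Y :
  morita_iso (tens_corep X Y) *m fmul F1 X Y = fmul F2 X Y *m (morita_iso X *t morita_iso Y).
Proof.
have [m2a m2b] := fmul_unitary fF2 X Y.
suff E : (fmul F2 X Y)^t* *m morita_iso (tens_corep X Y) *m fmul F1 X Y =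
    morita_iso X *t morita_iso Y by rewrite -E !mulmxA m2b mul1mx.
apply: (br_indep Lb (us_dim usM) (pfam_adj_coiso (@ac1 X) (@ac1 Y))
  (pfam_adj_coiso (@ac2 X) (@ac2 Y))) => I J; case: (mxtens_indexP I) => i j.
case: (mxtens_indexP J) => k l.
transitivity (op M k i *m op M l j); last first.
  rewrite morita_dec mulmx_suml sum_mxtens; apply: eq_bigr => z _.
  rewrite mulmx_suml.
  under eq_bigr do rewrite -scalemxAl morita_dec mulmx_sumr scaler_sumr.
  rewrite [LHS]exchange_big; apply: eq_bigr => z' _ /=.
  rewrite sum_mxtens; apply: eq_bigr => y _; rewrite mulmx_sumr scaler_sumr.
  apply: eq_bigr => y' _; rewrite -scalemxAr (br_mul Lb) scalerA tensmxE !pfamE.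
  by rewrite dagM.
rewrite -uop_tens_canonical // morita_dec.
set n := (fmul F2 X Y)^t*.
have T2 z : (@uop _ _ _ _ a2 (tens_corep X Y) z (mxtens_index (k, l)))^t* =
    \sum_Q n Q z *: (pfam (@uop _ _ _ _ a2 X) (@uop _ _ _ _ a2 Y) Q (mxtens_index (k, l)))^t*.
  rewrite uop_tens_pfam // dag_sum; apply: eq_bigr => Q _.
  by rewrite dagZ /n dagE.
pose s Q := pfam (@uop _ _ _ _ a1 X) (@uop _ _ _ _ a1 Y) Q (mxtens_index (i, j)).
pose t Q := (pfam (@uop _ _ _ _ a2 X) (@uop _ _ _ _ a2 Y) Q (mxtens_index (k, l)))^t*.
have := br_expand Lb (morita_iso (tens_corep X Y)) (fmul F1 X Y) n s t => <-.
apply: eq_bigr => z _; apply: eq_bigr => y _.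
by rewrite uop_tens_pfam // T2.
Qed.

Lemma morita_iso_unit : morita_iso (unit_corep A) *m funit F1 = funit F2.
Proof.
have [u2a u2b] := funit_unitary fF2.
suff E : (funit F2)^t* *m morita_iso (unit_corep A) *m funit F1 = 1%:M.
  by rewrite -[RHS]mulmx1 -E !mulmxA u2b mul1mx.
have := uop_unit usM (0 : 'I_1); rewrite mxE eqxx => U.
apply/matrixP => x y; rewrite !ord1.
have : ((funit F2)^t* *m morita_iso (unit_corep A) *m funit F1) 0 0 *: (id_ M) = 1 *: 1%:M.
  rewrite scale1r -[RHS]U morita_dec.
  under [RHS]eq_bigr => z _.
    under eq_bigr => y' _.
      rewrite (uop_unit us1) (uop_unit us2) dag_scalar (br_scalar Lb) -[_%:M]scalemx1 scalerA.
      over.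
    rewrite -scaler_suml; over.
  rewrite -scaler_suml; congr (_ *: _).
  rewrite mxE; under eq_bigr do rewrite mxE mulr_suml.
  rewrite exchange_big; apply: eq_bigr => z _; apply: eq_bigr => y' _ /=.
  by rewrite dagE; ring.
move/matrixP/(_ o o); rewrite !mxE eqxx !mulr1.
by move=> ->.
Qed.

(** Expanding sum_k M_ki^+ M_kj = delta_ij gives
    sum_yy' (c^+ c)_yy' L(a1_yi^+ a1_y'j, 1) = delta_ij; contracting with L(a1_xi, 1)
    and comparing coefficients gives c^+ c = 1. *)
Lemma morita_iso_unitary X : unitary (morita_iso X).
Proof.
have dims (F' : functorData A) (a : uptData F F') : is_upt a -> F' X = cdim X.
  move=> ua; have us := (is_uptP _).1 ua; have := upt_dimE X ua => /eqP.
  by rewrite eqn_pmul2r ?(us_dim us) // => /eqP.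
suff E : (morita_iso X)^t* *m morita_iso X = 1%:M.
  by split=> //; apply: isometry_dim => //; rewrite (dims _ _ ua1) (dims _ _ ua2).
set W := _ *m _.
have K2 z' z : \sum_k (@uop _ _ _ _ a2 X z' k)^t* *m @uop _ _ _ _ a2 X z k = (z' == z)%:R%:M.
  exact: (@ac2 X).
have E1 i j : \sum_k (@uop _ _ _ _ M X k i)^t* *m @uop _ _ _ _ M X k j =
    \sum_y \sum_y' W y y' *: L ((@uop _ _ _ _ a1 X y i)^t* *m @uop _ _ _ _ a1 X y' j) 1%:M.
  transitivity (\sum_y \sum_y' \sum_z \sum_z' ((morita_iso X z y)^* * morita_iso X z' y') *:
     L ((@uop _ _ _ _ a1 X y i)^t* *m @uop _ _ _ _ a1 X y' j)
       (\sum_k (@uop _ _ _ _ a2 X z' k)^t* *m @uop _ _ _ _ a2 X z k)).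
    transitivity (\sum_k \sum_y \sum_y' \sum_z \sum_z' ((morita_iso X z y)^* * morita_iso X z' y') *:
     L ((@uop _ _ _ _ a1 X y i)^t* *m @uop _ _ _ _ a1 X y' j)
       ((@uop _ _ _ _ a2 X z' k)^t* *m @uop _ _ _ _ a2 X z k)).
      apply: eq_bigr => k _; rewrite !morita_dec dag_sum mulmx_suml.
      under eq_bigr do rewrite dag_sum mulmx_suml.
      rewrite [LHS]exchange_big; apply: eq_bigr => y _ /=.
      rewrite [RHS]exchange_big; apply: eq_bigr => z _ /=.
      rewrite mulmx_sumr [RHS]exchange_big; apply: eq_bigr => z' _ /=.
      rewrite mulmx_sumr; apply: eq_bigr => y' _.
      rewrite dagZ (br_dag Lb) trmxCK -scalemxAl -scalemxAr (br_mul Lb).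
      by rewrite scalerA.
    rewrite [LHS]exchange_big; apply: eq_bigr => y _ /=.
    rewrite [LHS]exchange_big; apply: eq_bigr => y' _ /=.
    rewrite [LHS]exchange_big; apply: eq_bigr => z _ /=.
    rewrite [LHS]exchange_big; apply: eq_bigr => z' _ /=.
    by rewrite (br_sumr Lb) scaler_sumr.
  apply: eq_bigr => y _; apply: eq_bigr => y' _.
  rewrite mxE scaler_suml; apply: eq_bigr => z _.
  rewrite (bigD1 z) //= [X in _ + X]big1 => [|z' /negPf zz].
    by rewrite K2 eqxx addr0 dagE.
  by rewrite K2 zz raddf0 (br0r Lb) scaler0.
have t1 : fam_adj_coiso (fun i j : 'I_1 => id_ a2).
  by move=> i j; rewrite big_ord1 !ord1 eqxx dag1 mulmx1.
apply/row_matrixP => x; apply: (br_indep Lb (us_dim usM) (@ac1 X) t1) => j k.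
rewrite !big_ord1 dag1.
transitivity (\sum_i L (@uop _ _ _ _ a1 X x i) 1%:M *m ((i == j)%:R%:M)); last first.
  rewrite (bigD1 j) //= big1 => [|i /negPf ij]; last by rewrite ij raddf0 mulmx0.
  rewrite eqxx mulmx1 addr0 (bigD1 x) //= big1 => [|y /negPf yx].
    by rewrite !mxE eqxx scale1r addr0.
  by rewrite !mxE eq_sym yx scale0r.
under [RHS]eq_bigr do rewrite -(us_iso usM) E1 mulmx_sumr.
rewrite [RHS]exchange_big [RHS](bigD1 x) //= [X in _ = _ + X]big1 => [|y /negPf yx]; last first.
  under eq_bigr do rewrite mulmx_sumr; rewrite exchange_big big1 // => y' _ /=.
  transitivity (W y y' *: L ((\sum_i @uop _ _ _ _ a1 X x i *m (@uop _ _ _ _ a1 X y i)^t*) *m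
     @uop _ _ _ _ a1 X y' j) 1%:M).
    rewrite mulmx_suml (br_suml Lb) scaler_sumr; apply: eq_bigr => i _.
    by rewrite -scalemxAr (br_mul Lb) mulmxA mulmx1.
  by rewrite (us_coiso us1) eq_sym yx raddf0 mul0mx (br0l Lb) scaler0.
rewrite addr0; under [RHS]eq_bigr do rewrite mulmx_sumr.
rewrite [RHS]exchange_big; apply: eq_bigr => y' _ /=.
transitivity (W x y' *: L ((\sum_i @uop _ _ _ _ a1 X x i *m (@uop _ _ _ _ a1 X x i)^t*) *m
     @uop _ _ _ _ a1 X y' j) 1%:M).
  by rewrite (us_coiso us1) eqxx mul1mx [row _ _ _ _]mxE.
rewrite mulmx_suml (br_suml Lb) scaler_sumr; apply: eq_bigr => i _.
by rewrite -scalemxAr (br_mul Lb) mulmxA mulmx1.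
Qed.

Theorem morita_monoidal_iso : monoidally_isomorphic F1 F2.
Proof.
exists morita_iso; split.
- exact: morita_iso_unitary.
- exact: morita_iso_nat.
- exact: morita_iso_mul.
- exact: morita_iso_unit.
Qed.

End MoritaIso.

Section MoritaIsoThm.
Variable R : realType.
Local Notation C := R[i].
Variable A : hopfStarAlg R.
Hypothesis hA : is_cqg A.
Local Notation F := (canonical_functor A).

(** Results about the monoids of transformations are transported to all simple
    Frobenius monoids by comparing them with a transformation that induces them up to
    isomorphism. *)
Definition is_frob_of (B : frobData A) (F' : functorData A) (a : uptData F F') : Prop :=
  is_upt a /\ star_isomorphic B (frob_of_upt (existT _ F' a)).

Theorem monoidal_iso_of_morita (F1 F2 : functorData A) (a1 : uptData F F1) (a2 : uptData F F2)
    (B1 B2 : frobData A) :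
  is_frob_of B1 a1 -> is_frob_of B2 a2 -> morita_equivalent B1 B2 -> monoidally_isomorphic F1 F2.
Proof.
move=> [ua1 [f1 [U1 fM1 fm1 fu1]]] [ua2 [f2 [U2 fM2 fm2 fu2]]].
move=> [M [N [bM bN [T [i [iT [g [gU _ _]]]]] _]]].
have TB := unitary_dim gU.
have d1 := us_dim ((is_uptP _).1 ua1); have d2 := us_dim ((is_uptP _).1 ua2).
have fB1 : @is_end_iso _ _ B1 a1 f1 by split.
have fB2 : @is_end_iso _ _ B2 a2 f2 by split.
have Md := bimodule_dim d1 d2 fB1 fB2 bM bN iT TB.
apply: (morita_monoidal_iso hA ua1 ua2 (bim_is_upt bM) (bim_rep_birep bM d1 d2 fB1 fB2) Md).
exact: bim_rep_op.
Qed.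
End MoritaIsoThm.

(** * From monoidal isomorphism to Morita equivalence *)

Section MixBimodule.
Variable R : realType.
Local Notation C := R[i].
Variable A : hopfStarAlg R.
Hypothesis hA : is_cqg A.
Local Notation F := (canonical_functor A).
Local Notation id_ n := (1%:M : 'M[C]_n).
Local Notation op a := (@uop _ _ _ _ a _).
Variable F' : functorData A.

Section Data.
Variables (a1 a2 : uptData F F') (B1 B2 : frobData A).
Variables (f1 : 'M[C]_(a1 * a1, B1)) (f2 : 'M[C]_(a2 * a2, B2)).

(** The action x (x) Y (x) y |-> x Y y by matrix products, normalised as the
    multiplications of the two monoids are. *)
Definition mix_act : 'M[C]_(upt_mix a1 a2, B1 * upt_mix a1 a2 * B2) :=
  (sqrtd R a1 * sqrtd R a2)^-1 *:
  (mxprod R a1 a2 a2 *m ((mxprod R a1 a1 a2 *m (f1 *t id_ (a1 * a2))) *t f2)).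

Definition mix_bimod : bimodData B1 B2 := @BimodData R A B1 B2 (upt_mix a1 a2) mix_act.

Lemma mix_actE x y : act2 mix_bimod x y =
  (sqrtd R a1 * sqrtd R a2)^-1 *: (unvec (f1 *m x) *t (unvec (f2 *m y))^T).
Proof.
apply: mx_vec_ext => X; rewrite act2E /= /mix_act -!scalemxAl; congr (_ *: _).
rewrite -!mulmxA tensmx_tv -mulmxA tensmx_tv mul1mx tens_vec trmxK.
by rewrite -[f1 *m x]unvecK -[f2 *m y]unvecK mxprod_vec mxprod_vec !vecK.
Qed.

Hypotheses (ua1 : is_upt a1) (ua2 : is_upt a2).
Hypotheses (fB1 : is_end_iso f1) (fB2 : is_end_iso f2).
Hypotheses (fM1 : @is_modification _ _ _ _ B1 (upt_mix a1 a1) f1).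
Hypotheses (fM2 : @is_modification _ _ _ _ B2 (upt_mix a2 a2) f2).

Let d1_gt0 : (0 < a1)%N. Proof. by case: ua1. Qed.
Let d2_gt0 : (0 < a2)%N. Proof. by case: ua2. Qed.

Lemma mix_act_mod :
  @is_modification _ _ _ _ (upt_comp (upt_comp B1 (upt_mix a1 a2)) B2) (upt_mix a1 a2) mix_act.
Proof.
apply: mod_scale; apply: (mod_comp _ (@mxprod_mod _ _ hA _ a1 a2 a2 ua2)).
apply: (mod_tens _ fM2); apply: (mod_comp _ (@mxprod_mod _ _ hA _ a1 a1 a2 ua1)).
by apply: (mod_tens fM1); exact: mod_id.
Qed.

Lemma bim_repE X Y : bim_rep mix_bimod f1 f2 X Y = X *t Y^T.
Proof.
have [[_ g1] _ _] := fB1; have [[_ g2] _ _] := fB2.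
rewrite /bim_rep mix_actE scalerA mulfV ?scale1r ?mulf_neq0 ?sqrtd_neq0 //.
by rewrite (mulmxA f1) (mulmxA f2) g1 g2 !mul1mx !vecK.
Qed.

Lemma mix_left x v : left_act mix_bimod *m (x *k v) =
  (sqrtd R a1)^-1 *: ((unvec (f1 *m x) *t id_ a2) *m v).
Proof.
have s2 := sqrtd_neq0 R d2_gt0; have s1 := sqrtd_neq0 R d1_gt0; have [_ _ fu] := fB2.
rewrite left_actE mix_actE fu end_unit_vec unvecZ vecK [(_ *: 1%:M)^T]linearZ /= tensZr trmx1 scalerA.
rewrite -scalemxAl; congr (_ *: _); field.
by rewrite s2 s1.
Qed.

Lemma mix_right v y : right_act mix_bimod *m (v *k y) =
  (sqrtd R a2)^-1 *: ((id_ a1 *t (unvec (f2 *m y))^T) *m v).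
Proof.
have s2 := sqrtd_neq0 R d2_gt0; have s1 := sqrtd_neq0 R d1_gt0; have [_ _ fu] := fB1.
rewrite right_actE mix_actE fu end_unit_vec unvecZ vecK tensZl scalerA.
rewrite -scalemxAl; congr (_ *: _); field.
by rewrite s2 s1.
Qed.


Lemma act2_mix X Y Z x z :
  f1 *m x = vec X -> f2 *m z = vec Z ->
  mix_act *m (x *k vec Y *k z) = (sqrtd R a1 * sqrtd R a2)^-1 *: vec (X *m Y *m Z).
Proof.
move=> xX zZ; have := @act2E _ _ _ _ mix_bimod x z (vec Y) => <-.
by rewrite mix_actE xX zZ !vecK -scalemxAl tens_vec trmxK.
Qed.

Lemma end_iso_mul' (B : frobData A) d (f : 'M[C]_(d * d, B)) X Y x y : is_end_iso f ->
  f *m x = vec X -> f *m y = vec Y ->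
  f *m (fr_mul B *m (x *k y)) = (sqrtd R d)^-1 *: vec (X *m Y).
Proof.
case=> _ fm _ xX yY; rewrite mulmxA fm -mulmxA tensmx_tv xX yY.
exact: end_mul_vec.
Qed.

(** On matrices all axioms are associativity and unitality of the matrix product,
    together with (X Y Z)^+ = Z^+ Y^+ X^+ for the adjoint. *)
Lemma mix_is_bimodule : is_bimodule mix_bimod.
Proof.
have s2 := sqrtd_neq0 R d2_gt0; have s1 := sqrtd_neq0 R d1_gt0.
have [[g1 h1] m1 u1] := fB1; have [[g2 h2] m2 u2] := fB2.
split.
- exact: upt_mix_is_upt.
- exact: mix_act_mod.
- apply: mx_ket_ext => q; case: (mxtens_indexP q) => q' yy.
  case: (mxtens_indexP q') => xx' v; case: (mxtens_indexP xx') => x x'.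
  case: (mxtens_indexP yy) => y y' {q q' xx' yy}; rewrite !ket_tv.
  rewrite scompE mul1mx -!mulmxA cast_shape_act !tensmx_tv !mul1mx /=.
  have ex m n (w : 'cV[C]_(m * n)) : exists W : 'M_(m, n), w = vec W.
    by exists (unvec w); rewrite unvecK.
  have [X xX] := ex _ _ (f1 *m ket R x); have [X' xX'] := ex _ _ (f1 *m ket R x').
  have [Z zZ] := ex _ _ (f2 *m ket R y); have [Z' zZ'] := ex _ _ (f2 *m ket R y').
  have [V ->] := ex a1 (upt_dual a2) (ket R v).
  rewrite (act2_mix _ xX' zZ) tvZr tvZl -scalemxAr (act2_mix _ xX zZ').
  have eX : f1 *m (fr_mul B1 *m (ket R x *k ket R x')) = vec ((sqrtd R a1)^-1 *: (X *m X')).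
    by rewrite vecZ; apply: end_iso_mul'.
  have eZ : f2 *m (fr_mul B2 *m (ket R y *k ket R y')) = vec ((sqrtd R a2)^-1 *: (Z *m Z')).
    by rewrite vecZ; apply: end_iso_mul'.
  rewrite (act2_mix _ eX eZ) -!scalemxAl -!scalemxAr !vecZ !scalerA !mulmxA.
  congr (_ *: _); field.
  by rewrite s1 s2.
- apply: mx_vec_ext => V; rewrite scompE !mul1mx.
  have e1 : (mix_bimod = 1 * mix_bimod :> nat)%N by rewrite mul1n.
  have e2 : (1 * mix_bimod = 1 * mix_bimod * 1)%N by rewrite muln1.
  rewrite [X in castmx (X, _)](_ : _ = etrans e1 e2); last exact: eq_irrelevance.
  rewrite -castcast cast_1tvl cast_1tvr -mulmxA !tensmx_tv !mul1mx !mulmx1.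
  have e : f1 *m fr_unit B1 = vec (sqrtd R a1)%:M by rewrite u1 end_unit_vec -vecZ scalemx1.
  have e' : f2 *m fr_unit B2 = vec (sqrtd R a2)%:M by rewrite u2 end_unit_vec -vecZ scalemx1.
  rewrite (act2_mix _ e e') mul_scalar_mx mul_mx_scalar !vecZ !scalerA -[RHS]scale1r.
  congr (_ *: _); field.
  by rewrite s1 s2.
apply: mx_tv3_ext => x v z.
have ex m (w : 'cV[C]_(m * m)) : exists W : 'M_m, w = vec (W^t*).
  by exists ((unvec w)^t*); rewrite trmxCK unvecK.
have [X xX] := ex _ (f1 *m x); have [Z zZ] := ex _ (f2 *m z).
have {}xX : x = f1^t* *m vec (X^t*) by rewrite -xX mulmxA g1 mul1mx.
have {}zZ : z = f2^t* *m vec (Z^t*) by rewrite -zZ mulmxA g2 mul1mx.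
rewrite (@bim_dagE _ _ _ _ mix_bimod _ _ x (f1^t* *m vec X) z (f2^t* *m vec Z)); first last.
- by move=> b; rewrite zZ; exact: end_iso_formr.
- by move=> b; rewrite xX; exact: end_iso_forml.
rewrite -act2E; congr (_ *m _).
rewrite !mix_actE xX zZ !mulmxA h1 h2 !mul1mx !vecK dagZ dag_tens fmorphV rmorphM /= !sqrtd_conj.
congr (_ *: (_ *t _)); by apply/matrixP => i j; rewrite !mxE.
Qed.

End Data.
End MixBimodule.

Section MixRelTensor.
Variable R : realType.
Local Notation C := R[i].
Variable A : hopfStarAlg R.
Hypothesis hA : is_cqg A.
Local Notation F := (canonical_functor A).
Local Notation id_ n := (1%:M : 'M[C]_n).
Local Notation op a := (@uop _ _ _ _ a _).
Variables (F' : functorData A) (a1 a2 : uptData F F') (B1 B2 : frobData A).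
Variables (f1 : 'M[C]_(a1 * a1, B1)) (f2 : 'M[C]_(a2 * a2, B2)).
Hypotheses (ua1 : is_upt a1) (ua2 : is_upt a2) (uB1 : is_upt B1).
Hypotheses (fB1 : is_end_iso f1) (fB2 : is_end_iso f2).
Hypotheses (fM1 : @is_modification _ _ _ _ B1 (upt_mix a1 a1) f1).

Let d1_gt0 : (0 < a1)%N. Proof. by case: ua1. Qed.
Let d2_gt0 : (0 < a2)%N. Proof. by case: ua2. Qed.
Local Notation M := (mix_bimod f1 f2).
Local Notation N := (mix_bimod f2 f1).

(** The adjoint of the matrix product M_(d1,d2) (x) M_(d2,d1) -> M_d1, which is
    sqrt(d2) times a coisometry. *)
Definition mix_iso : 'M[C]_(M * N, B1) := (sqrtd R a2)^-1 *: ((mxprod R a1 a2 a1)^t* *m f1).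

Lemma mix_iso_mod : @is_modification _ _ _ _ B1 (upt_comp M N) mix_iso.
Proof.
apply: mod_scale; apply: (mod_comp fM1).
have um (b c : uptData F F') : is_upt b -> is_upt c -> is_upt (upt_mix b c).
  exact: upt_mix_is_upt.
apply: mod_dag; last exact: mxprod_mod.
- by move=> X; apply: upt_comp_unitary; apply/is_uptP; exact: um.
- by move=> X; exact: (upt_unitary (um _ _ ua1 ua1)).
Qed.

Lemma mix_isoK : mix_iso^t* *m mix_iso = 1%:M.
Proof.
have [[g1 h1] _ _] := fB1.
rewrite dagZ sqrtdV_conj -scalemxAl -scalemxAr scalerA sqrtdV2 dagM trmxCK.
rewrite mulmxA -(mulmxA (f1^t*)) mxprod_coiso mul_mx_scalar -scalemxAl scalerA g1.
by rewrite mulVf ?scale1r // pnatr_eq0 -lt0n.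
Qed.

Lemma mix_iso_idem : mix_iso *m mix_iso^t* = rel_idem M N.
Proof.
have [[g1 h1] _ _] := fB1.
rewrite (rel_idemE _ _ d2_gt0 fB1 fB2 fB1).
rewrite dagZ sqrtdV_conj -scalemxAl -scalemxAr scalerA sqrtdV2 dagM trmxCK; congr (_ *: _).
rewrite mulmxA -(mulmxA _ f1) h1 mulmx1.
apply: mx_ket_ext => q; case: (mxtens_indexP q) => ij kl.
case: (mxtens_indexP ij) => i j; case: (mxtens_indexP kl) => k l; rewrite !ket_tv.
rewrite -mulmxA mxprod_ket -scalemxAr mxprod_dag_ket mulmx_suml.
have delta_ket n (b c x : 'I_n) : delta_mx b c *m ket R x = (c == x)%:R *: ket R b.
  by rewrite /ket mul_delta_mx_cond scaler_nat.
have term b c : bim_rep M f1 f2 1%:M (delta_mx b c) *t bim_rep N f2 f1 (delta_mx c b) 1%:M *m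
     (ket R i *k ket R j *k (ket R k *k ket R l)) =
     ((b == j)%:R * (b == k)%:R) *: (ket R i *k ket R c *k (ket R c *k ket R l)).
  rewrite tensmx_tv !bim_repE // trmx_delta trmx1 !tensmx_tv !mul1mx !delta_ket.
  by rewrite !(tvZl, tvZr) scalerA mulrC.
rewrite [RHS](bigD1 j) //= [X in _ = _ + X]big1 => [|b /negPf bj].
  rewrite addr0 scaler_sumr mulmx_suml; apply: eq_bigr => c _.
  by rewrite term eqxx mul1r.
by rewrite mulmx_suml big1 // => c _; rewrite term bj mul0r scale0r.
Qed.

Lemma rel_act_mid e (x : 'cV_B1) (w : 'cV[C]_(M * N)) (y : 'cV_B1) :
  (left_act M *t right_act N) *m
    castmx (e : (B1 * (M * N) * B1 = B1 * M * (N * B1))%N, erefl) (x *k w *k y) =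
  ((sqrtd R a1)^-1 * (sqrtd R a1)^-1) *:
    (((unvec (f1 *m x) *t id_ a2) *t (id_ a2 *t (unvec (f1 *m y))^T)) *m w).
Proof.
rewrite [w]cV_ket sum_mxtens tv_sumr tv_suml cast_sum !mulmx_sumr scaler_sumr.
apply: eq_bigr => m _; rewrite tv_sumr tv_suml cast_sum !mulmx_sumr scaler_sumr.
apply: eq_bigr => n _; rewrite ket_tv tvZr tvZl castZ -!scalemxAr cast_tv_mid' tensmx_tv.
rewrite (mix_left ua1 ua2 fB2) (mix_right ua2 ua1 fB2) tvZl tvZr tensmx_tv !scalerA.
by congr (_ *: _); ring.
Qed.

(** The relative tensor product of M_(d1,d2) and M_(d2,d1) over M_d2 is M_d1, by
    the matrix product. *)
Lemma mix_rel_tensor : @is_rel_tensor _ _ _ _ _ M N (regular_bimod B1) mix_iso.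
Proof.
split; [exact: uB1|exact: mix_iso_mod|exact: mix_isoK|exact: mix_iso_idem|].
apply: mx_tv3_ext => x t y; rewrite scompE !tensmx_tv !mul1mx -[RHS]mulmxA.
rewrite rel_act_mid.
have [[g1 h1] _ _] := fB1.
have ex (w : 'cV[C]_B1) : exists W : 'M_a1, w = f1^t* *m vec W.
  by exists (unvec (f1 *m w)); rewrite unvecK mulmxA g1 mul1mx.
have [X ->] := ex x; have [T ->] := ex t; have [Y ->] := ex y.
rewrite /= -mulmxA tensmx_tv mul1mx !end_iso_mul // tvZl -scalemxAr end_iso_mul //.
rewrite /mix_iso dagZ sqrtdV_conj dagM trmxCK -scalemxAr -!scalemxAl -!scalemxAr !scalerA.
rewrite (mulmxA f1 _ (vec X)) (mulmxA f1 _ (vec Y)) h1 !mul1mx !vecK.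
rewrite -(mulmxA _ f1) (mulmxA f1 _ (vec T)) h1 mul1mx -[in RHS](mulmxA (f1^t*)).
rewrite (mulmxA (mxprod R a1 a2 a1)) mxprod_bilinear -(mulmxA _ (mxprod R a1 a2 a1)).
rewrite (mulmxA (mxprod R a1 a2 a1)) mxprod_coiso mul_scalar_mx -!scalemxAr tens_vec trmxK scalerA.
congr (_ *: _); rewrite -sqrtd2; field.
by rewrite !sqrtd_neq0.
Qed.

Lemma regular_isomorphic (B : frobData A) : bimod_isomorphic (regular_bimod B) (regular_bimod B).
Proof.
exists 1%:M; split; last 2 first.
- exact: mod_id.
- by rewrite mul1mx !tens11 mulmx1.
- by split; rewrite dag1 mulmx1.
Qed.

End MixRelTensor.

Section SameTarget.
Variable R : realType.
Local Notation C := R[i].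
Variable A : hopfStarAlg R.
Hypothesis hA : is_cqg A.
Local Notation F := (canonical_functor A).
Local Notation id_ n := (1%:M : 'M[C]_n).
Local Notation op a := (@uop _ _ _ _ a _).

Lemma morita_of_same_target (F' : functorData A) (a1 a2 : uptData F F') (B1 B2 : frobData A) :
  is_upt B1 -> is_upt B2 -> is_frob_of B1 a1 -> is_frob_of B2 a2 -> morita_equivalent B1 B2.
Proof.
move=> uB1 uB2 [ua1 [f1 [U1 fM1 fm1 fu1]]] [ua2 [f2 [U2 fM2 fm2 fu2]]].
have fB1 : @is_end_iso _ _ B1 a1 f1 by split.
have fB2 : @is_end_iso _ _ B2 a2 f2 by split.
exists (mix_bimod f1 f2), (mix_bimod f2 f1); split.
- exact: mix_is_bimodule.
- exact: mix_is_bimodule.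
- exists (regular_bimod B1), (mix_iso f1 f2); split; last exact: regular_isomorphic.
  exact: (mix_rel_tensor hA ua1 ua2 uB1 fB1 fB2 fM1).
exists (regular_bimod B2), (mix_iso f2 f1); split; last exact: regular_isomorphic.
exact: (mix_rel_tensor hA ua2 ua1 uB2 fB2 fB1 fM2).
Qed.

(** The composite of a with a natural transformation of its target, with the
    auxiliary space left unchanged. *)
Definition upt_push (F1 F2 : functorData A) (a : uptData F F1)
    (E : forall X, 'M[C]_(F2 X, F1 X)) : uptData F F2 :=
  @UptData R A F F2 a (fun X => umat (fun w i => \sum_z E X w z *: @uop _ _ _ _ a X z i)).

Lemma uop_push (F1 F2 : functorData A) (a : uptData F F1) (E : forall X, 'M[C]_(F2 X, F1 X)) X w i :
  @uop _ _ _ _ (upt_push a E) X w i = \sum_z E X w z *: @uop _ _ _ _ a X z i.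
Proof.
exact: (@uop_eq _ _ _ _ (upt_push a E) X (fun w i => \sum_z E X w z *: @uop _ _ _ _ a X z i)).
Qed.

Lemma upt_push_is_upt (F1 F2 : functorData A) (a : uptData F F1) (E : forall X, 'M[C]_(F2 X, F1 X)) :
  is_upt a -> is_monoidal_iso E -> is_upt (upt_push a E).
Proof.
move=> ua [EU EN EM Ee]; have us := (is_uptP _).1 ua; apply/is_uptP.
have E1 X : (E X)^t* *m E X = 1%:M by case: (EU X).
have E2 X : E X *m (E X)^t* = 1%:M by case: (EU X).
have pushE X : bmx (@uop _ _ _ _ (upt_push a E) X) = (E X *t id_ a) *m bmx (@uop _ _ _ _ a X).
  rewrite bmx_scalar bmxM; apply: bmx_ext => w i; rewrite uop_push.
  by apply: eq_bigr => z _; rewrite mul_scalar_mx.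
have al1 X : (bmx (@uop _ _ _ _ a X))^t* *m bmx (@uop _ _ _ _ a X) = 1%:M.
  by apply/fam_isoP; exact: us_iso us X.
have al2 X : bmx (@uop _ _ _ _ a X) *m (bmx (@uop _ _ _ _ a X))^t* = 1%:M.
  by apply/fam_coisoP; exact: us_coiso us X.
split.
- exact: us_dim us.
- move=> X; apply/fam_isoP; rewrite pushE dagM dag_tens1 -mulmxA (mulmxA (_ *t _)) tens1M.
  by rewrite E1 tens11 mul1mx al1.
- move=> X; apply/fam_coisoP; rewrite pushE dagM dag_tens1 mulmxA -(mulmxA _ (bmx _)) al2.
  by rewrite mulmx1 tens1M E2 tens11.
- move=> X Y f l i; under eq_bigr do rewrite uop_push scaler_sumr.
  rewrite [LHS]exchange_big /=.
  under [RHS]eq_bigr do rewrite uop_push scaler_sumr.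
  rewrite [RHS]exchange_big /=.
  transitivity (\sum_z (fmor F2 f *m E X) l z *: @uop _ _ _ _ a X z i).
    by apply: eq_bigr => z _; rewrite mxE scaler_suml; apply: eq_bigr => k _; rewrite scalerA.
  rewrite EN; transitivity (\sum_z E Y l z *: \sum_j imx f j i *: @uop _ _ _ _ a Y z j).
    transitivity (\sum_z E Y l z *: \sum_k fmor F1 f z k *: @uop _ _ _ _ a X k i).
      under [RHS]eq_bigr do rewrite scaler_sumr.
      rewrite [RHS]exchange_big; apply: eq_bigr => z _ /=.
      by rewrite mxE scaler_suml; apply: eq_bigr => k _; rewrite scalerA.
    by apply: eq_bigr => z _; rewrite (us_nat us).
  apply: eq_bigr => z _; rewrite scaler_sumr; apply: eq_bigr => k _.
  by rewrite !scalerA mulrC.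
- move=> X Y K i j; rewrite /= scale_delta_sum.
  have /bmx_inj/(_ K (mxtens_index (i, j))) : bmx (@uop _ _ _ _ (upt_push a E) (tens_corep X Y)) =
      bmx (fun K I => \sum_Q (fmul F2 X Y K Q)%:M *m
             pfam (@uop _ _ _ _ (upt_push a E) X) (@uop _ _ _ _ (upt_push a E) Y) Q I).
    rewrite -bmxM -bmx_scalar pushE -(fam_of_mul us) mulmxA tens1M EM -tens1M -mulmxA pfam_mulmx.
    by congr (_ *m _); apply: pfam_ext => k' i'; rewrite uop_push.
  move=> ->; rewrite sum_mxtens; apply: eq_bigr => k _; apply: eq_bigr => l _.
  by rewrite pfamE mul_scalar_mx.
- move=> K; rewrite /= (scale_delta_sum (0 : 'I_1) (fun j => @uop _ _ _ _ (upt_push a E) (unit_corep A) K j)).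
  rewrite uop_push -Ee mxE raddf_sum; apply: eq_bigr => w _ /=.
  by rewrite (uop_unit us) scale_scalar_mx.
Qed.

End SameTarget.

(** * The correspondences *)

Section Correspondence.
Local Open Scope classical_set_scope.

Lemma eq_class_eq (T : Type) (X : set T) (e : T -> T -> Prop) x y :
  equivalence_on X e -> X x -> X y -> e x y -> eq_class X e x = eq_class X e y.
Proof.
case=> _ es et Xx Xy xy; apply/seteqP; split=> z [Xz h]; split=> //.
  by apply: (et y x z) => //; apply: es.
exact: (et x y z).
Qed.

Lemma eq_class_inv (T : Type) (X : set T) (e : T -> T -> Prop) x y :
  equivalence_on X e -> X y -> eq_class X e x = eq_class X e y -> e x y.
Proof.
case=> er _ _ Xy xy; suff [] : eq_class X e x y by [].
by rewrite xy; split=> //; exact: er.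
Qed.

(** The map on classes takes a class to the class of all results of a on it.  It is
    well defined and injective as a reflects and preserves the equivalences, and b is
    a right inverse on classes. *)
Lemma bijective_correspondence_intro (T U : Type) (X : set T) (eX : T -> T -> Prop)
    (Y : set U) (eY : U -> U -> Prop) (a : T -> U -> Prop) (b : U -> T -> Prop) :
  equivalence_on X eX -> equivalence_on Y eY ->
  is_construction X Y a -> is_construction Y X b ->
  (forall x x' y y', X x -> X x' -> a x y -> a x' y' -> eX x x' <-> eY y y') ->
  (forall y x, Y y -> b y x -> exists y', a x y' /\ eY y y') ->
  bijective_correspondence X eX Y eY a b.
Proof.
move=> EX EY ca cb aa ba.
have [_ sy ty] := EY; have [rx _ _] := EX.
pose Phi (S : set T) : set U := [set y | Y y /\ exists x y', [/\ X x, S x, a x y' & eY y' y]].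
have PhiE x y : X x -> a x y -> Phi (eq_class X eX x) = eq_class Y eY y.
  move=> Xx axy; have Yy := (ca x Xx).2 y axy.
  apply/seteqP; split=> z.
    case=> Yz [x' [y' [Xx' [_ xx'] ax'y' yz]]]; split=> //.
    have Yy' := (ca x' Xx').2 y' ax'y'.
    by apply: (ty y y' z) => //; apply/(aa x x' y y').
  case=> Yz yz; split=> //; exists x, y; split=> //.
  by split=> //; exact: rx.
have PhiE' x y : Y y -> b y x -> Phi (eq_class X eX x) = eq_class Y eY y.
  move=> Yy bxy; have Xx := (cb y Yy).2 x bxy; have [y' [axy' yy']] := ba y x Yy bxy.
  rewrite (PhiE x y') //; apply: eq_class_eq => //; first exact: (ca x Xx).2 y' axy'.
  by apply: sy => //; exact: (ca x Xx).2 y' axy'.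
split=> //; exists Phi; split=> //.
- move=> _ [x Xx <-] /=; have [y axy] := (ca x Xx).1.
  by rewrite (PhiE x y) //; exists y => //; exact: (ca x Xx).2 y axy.
- move=> S S' /set_mem[x Xx <-] /set_mem[x' Xx' <-].
  have [y axy] := (ca x Xx).1; have [y' axy'] := (ca x' Xx').1.
  rewrite (PhiE x y) // (PhiE x' y') // => /(eq_class_inv EY ((ca x' Xx').2 y' axy')) yy'.
  by apply: eq_class_eq => //; apply/(aa x x' y y').
- move=> _ [y Yy <-]; have [x bxy] := (cb y Yy).1; have Xx := (cb y Yy).2 x bxy.
  by exists (eq_class X eX x); [exists x|exact: PhiE'].
Qed.

End Correspondence.

Section Classes.
Variable R : realType.
Local Notation C := R[i].
Variable A : hopfStarAlg R.
Hypothesis hA : is_cqg A.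
Local Notation F := (canonical_functor A).
Local Notation id_ n := (1%:M : 'M[C]_n).
Local Notation op a := (@uop _ _ _ _ a _).

Lemma star_iso_refl (B : frobData A) : star_isomorphic B B.
Proof.
exists 1%:M; split.
- by split; rewrite dag1 mulmx1.
- exact: mod_id.
- by rewrite mul1mx tens11 mulmx1.
- exact: mul1mx.
Qed.

Lemma star_iso_sym (B B' : frobData A) : star_isomorphic B B' -> star_isomorphic B' B.
Proof.
case=> f [[f1 f2] /is_modificationP fM fm fu]; exists (f^t*); split.
- by split; rewrite trmxCK.
- apply/is_modificationP => X k i; rewrite -[LHS]mulmx1 -f2 !mulmxA -(mulmxA _ _ f) -fM.
  by rewrite mulmxA f1 mul1mx.
- rewrite -[LHS]mulmx1 -[X in _ *m X = _]tens11 -f2 -tensmx_mul -mulmxA (mulmxA (fr_mul B')) -fm.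
  by rewrite !mulmxA f1 mul1mx.
- by rewrite -fu mulmxA f1 mul1mx.
Qed.

Lemma star_iso_trans (B B' B'' : frobData A) :
  star_isomorphic B B' -> star_isomorphic B' B'' -> star_isomorphic B B''.
Proof.
case=> f [[f1 f2] fM fm fu] [g [[g1 g2] gM gm gu]]; exists (g *m f); split.
- split; rewrite dagM mulmxA.
    by rewrite -(mulmxA _ _ g) g1 mulmx1.
  by rewrite -(mulmxA _ f) f2 mulmx1.
- exact: mod_comp fM gM.
- by rewrite -mulmxA fm mulmxA gm -mulmxA tensmx_mul.
- by rewrite -mulmxA fu.
Qed.

Lemma upt_push_equivalent (F1 F2 : functorData A) (a : uptData F F1)
    (E : forall X, 'M[C]_(F2 X, F1 X)) : is_monoidal_iso E ->
  upt_equivalent (existT _ F1 a) (existT _ F2 (upt_push a E)).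
Proof.
move=> EI; have [EU _ _ _] := EI; apply/upt_equivalentP.
exists (fun X => (E X)^t*), 1%:M; split; first exact: monoidal_iso_inv.
  by split; rewrite dag1 mulmx1.
move=> X k i; rewrite mul1mx mulmx1.
under eq_bigr do rewrite uop_push scaler_sumr; rewrite exchange_big /=.
transitivity (\sum_z (((E X)^t* *m E X) k z) *: @uop _ _ _ _ a X z i).
  rewrite (EU X).1; under eq_bigr do rewrite mxE.
  by rewrite delta_sum'.
apply: eq_bigr => z _; rewrite mxE scaler_suml; apply: eq_bigr => j _.
by rewrite scalerA.
Qed.

(** An isomorphism of the targets is used to move a1 to the target of a2, which does
    not change its monoid up to isomorphism. *)
Lemma morita_iff (F1 F2 : functorData A) (a1 : uptData F F1) (a2 : uptData F F2)
    (B1 B2 : frobData A) :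
  is_upt B1 -> is_upt B2 -> is_frob_of B1 a1 -> is_frob_of B2 a2 ->
  morita_equivalent B1 B2 <-> monoidally_isomorphic F1 F2.
Proof.
move=> uB1 uB2 m1 m2; split; first exact: (monoidal_iso_of_morita hA m1 m2).
case=> E EI; have [ua1 s1] := m1.
apply: (morita_of_same_target hA (a1 := upt_push a1 E) uB1 uB2 _ m2); split.
  exact: upt_push_is_upt.
apply: (star_iso_trans s1); apply: star_iso_of_equivalent.
exact: upt_push_equivalent.
Qed.

Lemma split_is_frob_of (B : frobData A) (x : uptFrom F) :
  is_simple_frobenius B -> upt_from_frob B x -> is_frob_of B (projT2 x).
Proof.
move=> [frB _] [d [f [n [iota [d0 fB sp ->]]]]]; split.
  exact: (split_upt_is_upt frB d0 fB sp).
exact: (split_star_isomorphic d0 fB sp).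
Qed.

Lemma frob_of_upt_is_frob_of (F' : functorData A) (a : uptData F F') :
  is_upt a -> is_frob_of (frob_of_upt (existT _ F' a)) a.
Proof. by move=> ua; split=> //; exact: star_iso_refl. Qed.

Lemma upt_from_frob_exists (B : frobData A) :
  is_simple_frobenius B -> exists x, upt_from_frob B x.
Proof.
move=> [frB [d [d0 [f fB]]]]; have [n [iota sp]] := split_exists hA frB d0 fB.
by exists (existT _ (split_functor iota) (split_upt iota)), d, f, n, iota.
Qed.

Lemma accessible_of_upt (F' : functorData A) (a : uptData F F') : is_upt a -> accessible F'.
Proof. by move=> ua; split; [exact: fibre_functor_of_upt ua|exists a]. Qed.

Lemma simple_upt (B : frobData A) : is_simple_frobenius B -> is_upt B.
Proof. by case=> -[]. Qed.

Lemma equivalent_iff (x1 x2 : uptFrom F) : is_upt_from x1 -> is_upt_from x2 ->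
  upt_equivalent x1 x2 <-> star_isomorphic (frob_of_upt x1) (frob_of_upt x2).
Proof.
case: x1 => F1 a1; case: x2 => F2 a2 [_ /= ua1] [_ /= ua2]; split.
  exact: star_iso_of_equivalent.
exact: (equivalent_of_star_iso hA ua1 ua2).
Qed.

End Classes.

Theorem theorem4p14 (R : realType) (A : hopfStarAlg R) (hA : is_cqg A) :
  bijective_correspondence
    (fun F' : functorData A => accessible F')
    (fun F1 F2 : functorData A => monoidally_isomorphic F1 F2)
    (fun B : frobData A => is_simple_frobenius B)
    (fun B1 B2 : frobData A => morita_equivalent B1 B2)
    (fun (F' : functorData A) (B : frobData A) =>
       exists a : uptData (canonical_functor A) F',
         is_upt a /\ B = frob_of_upt (existT _ F' a))
    (fun (B : frobData A) (F' : functorData A) =>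
       exists x : uptFrom (canonical_functor A),
         upt_from_frob B x /\ F' = projT1 x)
  /\
  bijective_correspondence
    (fun x : uptFrom (canonical_functor A) => is_upt_from x)
    (fun x1 x2 : uptFrom (canonical_functor A) => upt_equivalent x1 x2)
    (fun B : frobData A => is_simple_frobenius B)
    (fun B1 B2 : frobData A => star_isomorphic B1 B2)
    (fun (x : uptFrom (canonical_functor A)) (B : frobData A) =>
       B = frob_of_upt x)
    (fun (B : frobData A) (x : uptFrom (canonical_functor A)) =>
       upt_from_frob B x).
Proof.
have frobS (F' : functorData A) (a : uptData (canonical_functor A) F') :
    is_upt a -> is_simple_frobenius (frob_of_upt (existT _ F' a)).
  exact: frob_of_upt_simple.
have splitU (B : frobData A) x : is_simple_frobenius B -> upt_from_frob B x -> is_upt_from x.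
  move=> sB Bx; have [ua _] := split_is_frob_of sB Bx.
  by split=> //; exact: accessible_of_upt ua.
split; apply: bijective_correspondence_intro.
- split=> [F1 _|F1 F2 _ _|F1 F2 F3 _ _ _]; first exact: monoidal_iso_refl.
    exact: monoidal_iso_sym.
  exact: monoidal_iso_trans.
- have mo (B1 B2 : frobData A) x1 x2 : is_simple_frobenius B1 -> is_simple_frobenius B2 ->
      upt_from_frob B1 x1 -> upt_from_frob B2 x2 ->
      morita_equivalent B1 B2 <-> monoidally_isomorphic (projT1 x1) (projT1 x2).
    move=> s1 s2 h1 h2; apply: (morita_iff hA (simple_upt s1) (simple_upt s2)).
      exact: (split_is_frob_of s1 h1).
    exact: (split_is_frob_of s2 h2).
  split=> [B sB|B1 B2 s1 s2 B12|B1 B2 B3 s1 s2 s3 B12 B23].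
  + have [x Bx] := upt_from_frob_exists hA sB; apply/(mo B B x x sB sB Bx Bx).
    exact: monoidal_iso_refl.
  + have [x1 h1] := upt_from_frob_exists hA s1; have [x2 h2] := upt_from_frob_exists hA s2.
    apply/(mo B2 B1 x2 x1 s2 s1 h2 h1); apply: monoidal_iso_sym.
    exact/(mo B1 B2 x1 x2 s1 s2 h1 h2).
  + have [x1 h1] := upt_from_frob_exists hA s1; have [x2 h2] := upt_from_frob_exists hA s2.
    have [x3 h3] := upt_from_frob_exists hA s3.
    apply/(mo B1 B3 x1 x3 s1 s3 h1 h3); apply: (@monoidal_iso_trans _ _ _ (projT1 x2)).
      exact/(mo B1 B2 x1 x2 s1 s2 h1 h2).
    exact/(mo B2 B3 x2 x3 s2 s3 h2 h3).
- move=> F' [_ [a ua]]; split; first by exists (frob_of_upt (existT _ F' a)), a.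
  by move=> _ [a' [ua' ->]]; exact: frobS.
- move=> B sB; split.
    by have [x Bx] := upt_from_frob_exists hA sB; exists (projT1 x), x.
  by move=> _ [x [Bx ->]]; case: (splitU B x sB Bx).
- move=> F1 F2 _ _ _ _ [a1 [ua1 ->]] [a2 [ua2 ->]]; symmetry.
  apply: (morita_iff hA); [exact: simple_upt (frobS _ _ ua1)|exact: simple_upt (frobS _ _ ua2)|exact: frob_of_upt_is_frob_of|exact: frob_of_upt_is_frob_of].
- move=> B _ sB [x [Bx ->]]; have mB := split_is_frob_of sB Bx; have [ua _] := mB.
  exists (frob_of_upt x); split; first by exists (projT2 x); split=> //; case: (x).
  have mF : is_frob_of (frob_of_upt x) (projT2 x) by case: (x) ua => F' a; exact: frob_of_upt_is_frob_of.
  apply/(morita_iff hA (simple_upt sB) _ mB mF); last exact: monoidal_iso_refl.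
  by apply: simple_upt; case: (x) ua => F' a; exact: frobS.
- split=> [x xU|x1 x2 h1 h2|x1 x2 x3 h1 h2 h3].
  + by apply/(equivalent_iff hA) => //; exact: star_iso_refl.
  + move/(equivalent_iff hA h1 h2) => s; apply/(equivalent_iff hA h2 h1); exact: star_iso_sym.
  + move/(equivalent_iff hA h1 h2) => s /(equivalent_iff hA h2 h3) s'.
    apply/(equivalent_iff hA h1 h3); exact: star_iso_trans s s'.
- split=> [B _|B1 B2 _ _|B1 B2 B3 _ _ _]; first exact: star_iso_refl.
    exact: star_iso_sym.
  exact: star_iso_trans.
- move=> [F' a] [_ /= ua]; split; first by exists (frob_of_upt (existT _ F' a)).
  by move=> _ ->; exact: frobS.
- move=> B sB; split; first exact: upt_from_frob_exists.
  by move=> x; exact: splitU.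
- by move=> x x' _ _ h h' -> ->; exact: equivalent_iff.
- move=> B x sB Bx; exists (frob_of_upt x); split=> //.
  by have [_] := split_is_frob_of sB Bx; case: (x).
Qed.
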